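(* Let $\mathcal{P}(t) = (p_1(t),\ldots,p_N(t)) \in Q^N$, $t \ge 0$, be the trajectories of $N$ sensors with dynamics $\dot p_i(t) = u_i(t)$ governed by the control law $u_i(t) = -k_{prop}\,\bigl(p_i(t) - \tilde{C}_{V^g_i}(\mathcal{P}(t))\bigr)$, $i \in I_N$, with a constant gain $k_{prop} > 0$, starting from any initial condition $\mathcal{P}(0) \in Q^N$ with $p_i(0) \neq p_j(0)$ whenever $i \neq j$. Then the trajectories asymptotically converge to the critical points of $\mathcal{H}$, i.e. $\mathcal{P}(t)$ converges as $t \to \infty$ to the set of configurations $$\{\mathcal{P} = (p_1,\ldots,p_N) \in Q^N : p_i = \tilde{C}_{V^g_i}(\mathcal{P}) \text{ for all } i \in I_N\}.$$
   Context: Let $N \ge 1$, $I_N = \{1,\ldots,N\}$, and let $Q \subset \mathbb{R}^d$ be a convex polytope. Let $\phi : Q \to [0,1]$ be a density distribution function. For each $i \in I_N$ let $f_i : \mathbb{R}^+ \to \mathbb{R}$ (where $\mathbb{R}^+ = [0,\infty)$) be a strictly decreasing analytic function, called the node function (sensor effectiveness function) of the $i$-th sensor. $\|\cdot\|$ is the Euclidean norm. For a configuration $\mathcal{P} = (p_1,\ldots,p_N)$ with $p_i \in Q$, the generalized Voronoi partition of $Q$ is the collection $\mathcal{V}^g = \{V^g_i\}_{i \in I_N}$, where $$V^g_i = V^g_i(\mathcal{P}) = \{ q \in Q : f_i(\|p_i - q\|) \ge f_j(\|p_j - q\|) \text{ for all } j \in I_N,\ j \neq i \}.$$ Cells may be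 disconnected or empty. The objective function is $$\mathcal{H}(\mathcal{P}) = \int_Q \max_{i \in I_N}\{f_i(\|q-p_i\|)\}\,\phi(q)\,dQ = \sum_{i\in I_N}\int_{V^g_i} f_i(\|q-p_i\|)\,\phi(q)\,dQ .$$ With $r_i = \|p_i - q\|$, define the perceived density $\tilde\phi^i(q,p_i) = -2\phi(q)\,\frac{\partial f_i(r_i)}{\partial (r_i^2)}$ (nonnegative since $f_i$ is decreasing), the mass $\tilde M_{V^g_i} = \int_{V^g_i} \tilde\phi^i(q,p_i)\,dQ$ and the centroid $\tilde C_{V^g_i} = \frac{1}{\tilde M_{V^g_i}} \int_{V^g_i} q\,\tilde\phi^i(q,p_i)\,dQ$ of the cell, so that the gradient of $\mathcal{H}$ with respect to $p_i$ is $-\tilde M_{V^g_i}(p_i - \tilde C_{V^g_i})$. If $V^g_i$ is empty (or null, i.e. $\tilde M_{V^g_i}=0$), set $\tilde C_{V^g_i} = p_i$. The critical points (critical configurations) of $\mathcal{H}$ are the configurations $\mathcal{P}$ with $p_i = \tilde C_{V^g_i}(\mathcal{P})$ for all $i \in I_N$; these are called generalized centroidal Voronoi configurations.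
   Formalization: The density is assumed measurable and each perceived density integrable over Q for every sensor position in Q; this is automatic for d ≥ 2, while for d = 1 with f_i'(0) ≠ 0 the mass can be infinite and the centroid undefined. *)

(* Defs.v *)
From HB Require Import structures.
From mathcomp Require Import all_boot all_order all_algebra.
From mathcomp Require Import all_classical all_reals all_analysis.
Set Implicit Arguments.
Unset Strict Implicit.
Unset Printing Implicit Defensive.
Import Order.TTheory GRing.Theory Num.Theory.
Import numFieldNormedType.Exports.
Local Open Scope classical_set_scope.
Local Open Scope ring_scope.

(* The library has Lebesgue measure on the line only.  As it does for
   [n.-tuple R], we give ['rV[R]_n] the sigma-algebra generated by the
   coordinates, i.e. the Borel sets of R^n. *)
Section measurable_rV.
Context {R : realType} (n : nat).

Definition rV_coord (i : 'I_n) (x : 'rV[R]_n) : measurableTypeR R := x ord0 i.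

Let rV_measurable0 : g_sigma_preimage rV_coord set0.
Proof. exact: sigma_algebra0. Qed.

Let rV_measurableC A :
  g_sigma_preimage rV_coord A -> g_sigma_preimage rV_coord (~` A).
Proof. exact: sigma_algebraC. Qed.

Let rV_measurable_bigcup (F : (set 'rV[R]_n)^nat) :
  (forall i, g_sigma_preimage rV_coord (F i)) ->
  g_sigma_preimage rV_coord (\bigcup_i (F i)).
Proof. exact: sigma_algebra_bigcup. Qed.

HB.instance Definition _ := @isMeasurable.Build
  (measure_tuple_display default_measure_display) 'rV[R]_n
  (g_sigma_preimage rV_coord)
  rV_measurable0 rV_measurableC rV_measurable_bigcup.

Lemma measurable_rV_coord i : measurable_fun setT (rV_coord i).
Proof.
move=> _ Y mY; rewrite setTI; apply: sub_sigma_algebra => /=.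
rewrite -bigcup_seq/=; exists i => /=; first by rewrite mem_index_enum.
by exists Y => //; rewrite setTI.
Qed.

Lemma measurable_fun_rVP d (T : measurableType d) (f : T -> 'rV[R]_n) :
  (forall i, measurable_fun setT (rV_coord i \o f)) -> measurable_fun setT f.
Proof.
move=> mf _ A mA; rewrite setTI.
have : g_sigma_preimage (fun i => rV_coord i \o f) `<=` measurable.
  apply: smallest_sub; first exact: sigma_algebra_measurable.
  rewrite -bigcup_seq => B [i _] [C mC <-].
  by have := mf i measurableT C mC.
by apply; rewrite g_sigma_preimage_comp; exists A => //; rewrite setTI.
Qed.

End measurable_rV.

Lemma sigma_finite_product d1 d2 (T1 : measurableType d1)
    (T2 : measurableType d2) (R : realType)
    (m1 : {sigma_finite_measure set T1 -> \bar R})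
    (m2 : {sigma_finite_measure set T2 -> \bar R}) :
  sigma_finite setT (m1 \x m2)%E.
Proof.
have /sigma_finiteP[F [TF ndF Foo]] := sigma_finiteT m1.
have /sigma_finiteP[G [TG ndG Goo]] := sigma_finiteT m2.
exists (fun n => F n `*` G n).
  rewrite -setXTT TF TG predeqE => -[x y]; split.
    move=> [/= [n _ Fnx] [k _ Gky]]; exists (maxn n k) => //; split.
      by move: x Fnx; exact/subsetPset/ndF/leq_maxl.
    by move: y Gky; exact/subsetPset/ndG/leq_maxr.
  by move=> [n _ []/= ? ?]; split; exists n.
move=> k; have [mF Fk] := Foo k; have [mG Gk] := Goo k.
split; first exact: measurableX.
by rewrite product_measure1E// lte_mul_pinfty// ge0_fin_numE.
Qed.

Section lebesgue_rV_succ.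
Context {R : realType} (n : nat).

Definition rV_cons (x : measurableTypeR R * 'rV[R]_n) : 'rV[R]_n.+1 :=
  \row_j (if unlift ord0 j is Some k then x.2 ord0 k else x.1).

Definition rV_uncons (v : 'rV[R]_n.+1) : measurableTypeR R * 'rV[R]_n :=
  (v ord0 ord0, \row_k v ord0 (lift ord0 k)).

Lemma rV_consK : cancel rV_cons rV_uncons.
Proof.
case=> a x; rewrite /rV_uncons mxE unlift_none; congr pair.
by apply/rowP => k; rewrite !mxE liftK.
Qed.

Lemma rV_unconsK : cancel rV_uncons rV_cons.
Proof.
move=> v; apply/rowP => j; rewrite mxE.
by case: unliftP => [k|] -> //=; rewrite mxE.
Qed.

Lemma measurable_rV_cons : measurable_fun setT rV_cons.
Proof.
apply: measurable_fun_rVP => j; case: (unliftP ord0 j) => [k|] ->.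
  rewrite (_ : _ \o _ = rV_coord k \o snd).
    by apply: measurableT_comp => //; exact: measurable_rV_coord.
  by apply/funext => x; rewrite /rV_coord /= mxE liftK.
rewrite (_ : _ \o _ = fst); first exact: measurable_fst.
by apply/funext => x; rewrite /rV_coord /= mxE unlift_none.
Qed.

Lemma measurable_rV_uncons : measurable_fun setT rV_uncons.
Proof.
apply/measurable_fun_pairP; split; first exact: (measurable_rV_coord ord0).
apply: measurable_fun_rVP => k.
rewrite (_ : _ \o _ = rV_coord (lift ord0 k)); first exact: measurable_rV_coord.
by apply/funext => x; rewrite /rV_coord /= mxE.
Qed.

Variable mu : {sigma_finite_measure set 'rV[R]_n -> \bar R}.

Definition lebesgue_rV_succ : set 'rV[R]_n.+1 -> \bar R :=
  pushforward (lebesgue_measure \x mu)%E rV_cons.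

Let succ0 : lebesgue_rV_succ set0 = 0%E.
Proof. by rewrite /lebesgue_rV_succ /pushforward preimage_set0 measure0. Qed.

Let succ_ge0 A : (0 <= lebesgue_rV_succ A)%E.
Proof. by rewrite /lebesgue_rV_succ /pushforward; exact: measure_ge0. Qed.

Let succ_sigma_additive : semi_sigma_additive lebesgue_rV_succ.
Proof.
move=> F mF tF mUF; rewrite /lebesgue_rV_succ /pushforward preimage_bigcup.
apply: measure_semi_sigma_additive.
- move=> k; rewrite -[X in measurable X]setTI; exact: measurable_rV_cons.
- apply/trivIsetP => /= i j _ _ ij; rewrite -preimage_setI.
  by move/trivIsetP : tF => /(_ _ _ _ _ ij) ->//; rewrite preimage_set0.
- by rewrite -preimage_bigcup -[X in measurable X]setTI;
    exact: measurable_rV_cons.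
Qed.

HB.instance Definition _ := isMeasure.Build _ _ _ lebesgue_rV_succ
  succ0 succ_ge0 succ_sigma_additive.

Let succ_sigma_finite : sigma_finite setT lebesgue_rV_succ.
Proof.
have [F TF mF] := sigma_finite_product lebesgue_measure mu.
exists (fun k => rV_uncons @^-1` F k).
  by rewrite -preimage_bigcup -TF preimage_setT.
move=> k; have [mFk Fk] := mF k; split.
  by rewrite -[X in measurable X]setTI; exact: measurable_rV_uncons.
rewrite /lebesgue_rV_succ /pushforward -comp_preimage.
by rewrite (_ : _ \o _ = id) ?preimage_id//; apply/funext; exact: rV_consK.
Qed.

HB.instance Definition _ := Measure_isSigmaFinite.Build _ _ _ lebesgue_rV_succ
  succ_sigma_finite.

End lebesgue_rV_succ.

Fixpoint lebesgue_rV (R : realType) (n : nat) :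
    {sigma_finite_measure set 'rV[R]_n -> \bar R} :=
  if n is m.+1 then [the {sigma_finite_measure set 'rV[R]_m.+1 -> \bar R} of
                     lebesgue_rV_succ (lebesgue_rV R m)]
  else [the {sigma_finite_measure set 'rV[R]_0 -> \bar R} of \d_(0 : 'rV[R]_0)].

Section locational_optimization.
Context {R : realType} {d : nat}.
Implicit Types (Q : set 'rV[R]_d) (phi : 'rV[R]_d -> R) (p q : 'rV[R]_d).

(* The library's norm on ['rV[R]_d] is the sup norm. *)
Definition enorm (x : 'rV[R]_d) : R := Num.sqrt (\sum_k x ord0 k ^+ 2).

Definition convex_polytope Q :=
  exists m (v : 'I_m -> 'rV[R]_d),
    Q = [set \sum_i w i *: v i
          | w in [set w : 'I_m -> R | (forall i, 0 <= w i) /\ \sum_i w i = 1]].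

(* Analyticity on the closed half-line [0, +oo[: at an endpoint the power
   series is only required to represent [f] on the half-line. *)
Definition analytic_on_nneg (f : R -> R) :=
  forall a, 0 <= a -> exists (c : nat -> R) (e : R), 0 < e /\
    forall r, 0 <= r -> `|r - a| < e -> pseries c (r - a) @ \oo --> f r.

Definition strictly_decreasing_on_nneg (f : R -> R) :=
  forall r s, 0 <= r -> r < s -> f s < f r.

(* The partial derivative of [f r] with respect to [r ^+ 2] is the derivative
   of [s |-> f (sqrt s)] at [s = r ^+ 2]; its value at the single point [q = p]
   is irrelevant to the integrals below. *)
Definition perceived_density phi (f : R -> R) p q : R :=
  - 2 * phi q * derive1 (fun s : R => f (Num.sqrt s)) (enorm (p - q) ^+ 2).

Section configuration.
Context {N : nat}.
Variables (Q : set 'rV[R]_d) (phi : 'rV[R]_d -> R) (f : 'I_N -> R -> R).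
Implicit Types (P : 'I_N -> 'rV[R]_d) (i j : 'I_N).

Definition gen_voronoi_cell P i : set 'rV[R]_d :=
  [set q | Q q /\
    forall j, j != i -> f j (enorm (P j - q)) <= f i (enorm (P i - q))].

Definition cell_mass P i : R :=
  \int[lebesgue_rV R d]_(q in gen_voronoi_cell P i)
    perceived_density phi (f i) (P i) q.

Definition cell_centroid P i : 'rV[R]_d :=
  if cell_mass P i == 0 then P i
  else (cell_mass P i)^-1 *:
    \row_k \int[lebesgue_rV R d]_(q in gen_voronoi_cell P i)
      (q ord0 k * perceived_density phi (f i) (P i) q).

(* The critical points of the coverage objective
   [P |-> \int_Q max_i f_i(|q - p_i|) phi(q) dq], whose gradient in [p_i] is
   [- cell_mass P i *: (P i - cell_centroid P i)]. *)
Definition centroidal_configuration P :=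
  (forall i, Q (P i)) /\ (forall i, P i = cell_centroid P i).

End configuration.

(* [x] has derivative [v] at time [t] as a function on [0, +oo[; the derivative
   is one-sided at [t = 0]. *)
Definition is_time_derivative (x : R -> 'rV[R]_d) (t : R) (v : 'rV[R]_d) :=
  h^-1 *: (x (t + h) - x t) @[h --> within [set h | 0 <= t + h] 0^'] --> v.

End locational_optimization.

(* Main.v *)
(* The coverage H(P) = int_Q max_i f_i(|q - p_i|) phi(q) dq serves as a Lyapunov
   function in the style of LaSalle; the difficulty is that H is not smooth, since
   cells may overlap.

   Say that i is below j if f_i(x) = f_j(x + r) for all x >= 0 and some
   r >= |p_i - p_j|; then j is everywhere at least as effective as i.  If i and j tie
   on a set of positive measure, then their values have equal gradients at almost
   every point q of it, so p_i, p_j and q are aligned, and analyticity forces i below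
   j or conversely.  So the cells of the maximal sensors of this preorder cover Q and
   overlap only in null sets, provided that no two sensors with the same node function
   share a position.  They never come to: each centroid stays on its side of the
   bisector, hence |p_i - p_j|^2 decays at most like exp(- 2 k t).

   Hence the lower right derivative of t |-> H(P(t)) is at least k times the sum of
   M_i |p_i - C_i|^2 over the maximal i.  As H is bounded and the trajectories are
   Lipschitz, this sum is not bounded away from 0 near a limit point X of P; as the
   masses are bounded uniformly in P, passing to the limit in the first moments of
   the cells shows that the maximal sensors of X are at their centroids.  A sensor of
   X that is not maximal need not be, but a small move towards a maximal sensor above
   it empties its cell and leaves the cells of the maximal sensors unchanged.  Thus X
   is a limit of centroidal configurations. *)
Require Import Defs.
From HB Require Import structures.
From mathcomp Require Import all_boot all_order all_algebra.
From mathcomp Require Import all_classical all_reals all_analysis.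
From mathcomp Require Import measurable_realfun ring lra.
Set Implicit Arguments.
Unset Strict Implicit.
Unset Printing Implicit Defensive.
Import Order.TTheory GRing.Theory Num.Theory.
Import numFieldNormedType.Exports.
Local Open Scope classical_set_scope.
Local Open Scope ring_scope.

(** * Real analytic functions on the half-line *)

(** The centroids need not depend continuously on the configuration, so the limit is taken not in
    them but in [cell_moment], the mass times the displacement from the centroid. Its density stays
    bounded where the perceived density may blow up like the inverse distance to the sensor, so
    dominated convergence applies. The uniform mass bound B serves to turn small dissipation into
    small moments: the square of M |p - C| is at most B times M |p - C|^2. In dimension one the
    inverse distance is not integrable; there the integrability hypothesis forces the density to
    vanish almost everywhere, unless the slope of the node function at 0 is zero.

    The growth estimate does not differentiate the maximum: after a move, the maximum is at least
    the new value of the sensor that attained it before. The exceptional sets are null because they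
    meet every line in one coordinate direction in a countable set. As node functions are given on a
    half-line only, the argument runs on C^1 extensions of them to the real line. *)

Section real_analysis.
Context {R : realType}.
Implicit Types (f g h E : R -> R) (a b c e r x : R) (u d : nat -> R).

(** The times at which the bound holds have a supremum, which belongs to them by continuity; if it
    were less than b, one more step h would pass it. A single arbitrarily small h at each time is
    enough, so a right difference quotient along a sequence of steps can be fed in. *)
Lemma dini_growth g a b c : continuous g -> a <= b ->
  (forall t, a <= t < b -> g a + c * (t - a) <= g t ->
     forall e, 0 < e -> exists2 h, 0 < h < e & g t + c * h <= g (t + h)) ->
  g a + c * (b - a) <= g b.
Proof.
move=> cg ab H.
pose S := [set t | a <= t <= b /\ g a + c * (t - a) <= g t].
have Sa : S a by split; rewrite ?lexx// subrr mulr0 addr0.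
have hS : has_sup S by split; [exists a | exists b => t [/andP[]]].
have as_ : a <= sup S by apply: ub_le_sup => //; case: hS.
have sb : sup S <= b by apply: sup_le_ub => [|t [/andP[]]//]; exists a.
have gs : g a + c * (sup S - a) <= g (sup S).
  rewrite leNgt; apply/negP => lt.
  have ck : g t - c * (t - a) @[t --> sup S] --> g (sup S) - c * (sup S - a).
    apply: cvgB; first exact: cg.
    by apply: cvgMr; apply: cvgB; [exact: cvg_id|exact: cvg_cst].
  have : \forall t \near sup S, g t - c * (t - a) < g a.
    by apply: cvgr_lt ck _ _; rewrite ltrBlDr.
  move=> /nbhs_ballP[e /= e0 sub].
  have [t St st] := sup_adherent e0 hS.
  have ts : t <= sup S by apply: ub_le_sup => //; case: hS.
  have [_ {}St] := St.
  have : ball (sup S) e t by rewrite /ball /= ger0_norm ?subr_ge0//; lra.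
  by move=> /sub; lra.
have [sE|slt] : sup S = b \/ sup S < b.
  by move: sb; rewrite le_eqVlt => /orP[/eqP|]; [left|right].
  by move: gs; rewrite sE.
have [|//|h /andP[h0 hb] gh] := H (sup S) _ gs (b - sup S); rewrite ?subr_gt0//.
  by rewrite as_.
have : S (sup S + h).
  split; first by apply/andP; split; lra.
  by apply: le_trans gh; rewrite (_ : sup S + h - a = (sup S - a) + h); [nra|ring].
move=> /(ub_le_sup (proj2 hS)); lra.
Qed.

(** Homogeneous Bernoulli inequality; it bounds a term of a differentiated power series at x by a
    term of the original series at x + y. *)
Lemma exprD_ge_bernoulli x y n : 0 <= x -> 0 <= y ->
  x ^+ n.+1 + n.+1%:R * x ^+ n * y <= (x + y) ^+ n.+1.
Proof.
move=> x0 y0; elim: n => [|n IH]; first by rewrite !expr1 expr0 !mul1r.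
rewrite (exprS (x + y)); apply: le_trans (ler_wpM2l _ IH); last exact: addr_ge0.
have := exprn_ge0 n x0; rewrite -(natr1 n.+1) !exprS => xn.
have := ler0n R n.+1 => n0.
have : 0 <= n.+1%:R * (x ^+ n) * y * y by rewrite !mulr_ge0.
nra.
Qed.

Lemma pseriesS u x n : pseries u x n.+1 = u 0%N + x * pseries (u \o S) x n.
Proof.
rewrite /pseries /series /= big_nat_recl//= expr0 mulr1; congr (_ + _).
by rewrite mulr_sumr; apply: eq_bigr => i _; rewrite exprS mulrCA.
Qed.

(** With y strictly between |x| and |z| and D = y - |x|, Bernoulli gives (i+1) |x|^i <= y^(i+1) / D,
    and the series converges absolutely at y. *)
Lemma is_cvg_pseries_diffs u (z x : R) :
  cvgn (pseries u z) -> `|x| < `|z| -> cvgn (pseries (pseries_diffs u) x).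
Proof.
move=> cu xz; pose y := (`|x| + `|z|) / 2.
have [xy yz] : `|x| < y /\ y < `|z| by rewrite /y; split; lra.
have y0 : 0 < y by apply: le_lt_trans xy.
pose D := y - `|x|; have D0 : 0 < D by rewrite subr_gt0.
have cy : cvgn (pseries (fun i => `|u i|) y).
  by apply: is_cvg_pseries_inside_norm cu _; rewrite gtr0_norm.
apply: normed_cvg.
pose v i := D^-1 * (`|u i.+1| * y ^+ i.+1).
apply: (@series_le_cvg _ _ v) => [i|i|i|].
- exact: normr_ge0.
- by rewrite /v !mulr_ge0// ?invr_ge0 ?exprn_ge0// ltW.
- rewrite /v /pseries_diffs /= !normrM normrX normr_nat.
  rewrite mulrCA (mulrC i.+1%:R) -mulrA; apply: ler_wpM2l => //.
  rewrite -ler_pdivrMl ?invr_gt0// invrK mulrC.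
  have := @exprD_ge_bernoulli `|x| D i (normr_ge0 _) (ltW D0).
  rewrite /D addrCA subrr addr0; apply: le_trans.
  by rewrite lerDr exprn_ge0.
- have -> : v = D^-1 *: (fun i => `|u i.+1| * y ^+ i.+1).
    by apply/funext => i; rewrite /v /= fctE.
  apply: is_cvg_seriesZ.
  have -> : series (fun i => `|u i.+1| * y ^+ i.+1)
      = (fun n => pseries (fun i => `|u i|) y n.+1 - `|u 0%N|).
    apply/funext => n; rewrite pseriesS addrAC subrr add0r.
    rewrite /pseries /series /= mulr_sumr; apply: eq_bigr => i _.
    by rewrite exprS mulrCA.
  apply: is_cvgB; last exact: is_cvg_cst.
  by apply/cvg_ex; exists (limn (pseries (fun i => `|u i|) y)); rewrite cvg_shiftS.
Qed.

Definition powser u x := limn (pseries u x).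

Definition cvg_disk u e := forall x, `|x| < e -> cvgn (pseries u x).

Lemma cvg_disk_diffs u e : cvg_disk u e -> cvg_disk (pseries_diffs u) e.
Proof.
move=> cu x xe; pose z := (`|x| + e) / 2.
have [xz ze] : `|x| < z /\ z < e by rewrite /z; split; lra.
have z0 : 0 < z by apply: le_lt_trans xz.
apply: (@is_cvg_pseries_diffs _ z); last by rewrite (gtr0_norm z0).
by apply: cu; rewrite gtr0_norm.
Qed.

Lemma is_derive_powser u e x : cvg_disk u e -> `|x| < e ->
  is_derive x 1 (powser u) (powser (pseries_diffs u) x).
Proof.
move=> cu xe; pose z := (`|x| + e) / 2.
have [xz ze] : `|x| < z /\ z < e by rewrite /z; split; lra.
have z0 : 0 < z by apply: le_lt_trans xz.
have zE : `|z| < e by rewrite gtr0_norm.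
apply: (@pseries_snd_diffs _ u z x); last by rewrite (gtr0_norm z0).
- exact: cu.
- exact: cvg_disk_diffs zE.
- by apply: cvg_disk_diffs zE; exact: cvg_disk_diffs.
Qed.

Lemma is_derive_continuous g x b : is_derive x 1 g b -> {for x, continuous g}.
Proof. by move=> H; apply/differentiable_continuous/derivable1_diffP; case: H. Qed.

Lemma continuous_powser u e x : cvg_disk u e -> `|x| < e ->
  {for x, continuous (powser u)}.
Proof.
move=> cu xe; have H := is_derive_powser cu xe.
exact: (is_derive_continuous H).
Qed.

Lemma powser_at0 u : powser u 0 = u 0%N.
Proof.
apply/cvg_lim => //; rewrite -cvg_shiftS; apply: cvg_near_cst.
by near=> n; rewrite /= pseriesS mul0r addr0.
Unshelve. all: by end_near. Qed.

Lemma cvg_disk_shift u e : cvg_disk u e -> cvg_disk (u \o S) e.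
Proof.
move=> cu x xe; have [->|x0] := eqVneq x 0.
  apply/cvg_ex; exists (u 1%N); rewrite -cvg_shiftS; apply: cvg_near_cst.
  by near=> n; rewrite /= pseriesS mul0r addr0.
have -> : pseries (u \o S) x = (fun n => x^-1 * (pseries u x n.+1 - u 0%N)).
  by apply/funext => n; rewrite pseriesS addrAC subrr add0r mulKf.
apply: is_cvgMr; apply: is_cvgB; last exact: is_cvg_cst.
by apply/cvg_ex; exists (limn (pseries u x)); rewrite cvg_shiftS; exact: cu.
Unshelve. all: by end_near. Qed.

Lemma powser_shift u e x : cvg_disk u e -> `|x| < e ->
  powser u x = u 0%N + x * powser (u \o S) x.
Proof.
move=> cu xe; apply/cvg_lim => //; rewrite -cvg_shiftS.
under eq_fun do rewrite pseriesS.
apply: cvgD; first exact: cvg_cst.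
have /cvg_ex[l cl] := cvg_disk_shift cu xe.
by apply: cvgMr; rewrite /powser (cvg_lim _ cl).
Qed.

(** Induction on the index of a nonzero coefficient: if the constant term is nonzero, continuity at
    0 suffices; otherwise a factor x splits off and the shifted series remains. *)
Lemma powser_isolated_zero u e n : 0 < e -> cvg_disk u e -> u n != 0 ->
  exists2 D, 0 < D & forall x, 0 < `|x| < D -> powser u x != 0.
Proof.
move=> e0; elim: n u => [|n IH] u cu un.
  have c0 : {for 0, continuous (powser u)} by apply: continuous_powser cu _; rewrite normr0.
  have : \forall x \near 0, powser u x != 0.
    by apply: (cvgr_neq0 _ c0); rewrite powser_at0.
  move=> /nbhs_ballP[D /= D0 sub]; exists D => // x /andP[_ xD].
  by apply: sub; rewrite /ball /= sub0r normrN.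
have [u0|u0] := eqVneq (u 0%N) 0; last first.
  have c0 : {for 0, continuous (powser u)} by apply: continuous_powser cu _; rewrite normr0.
  have : \forall x \near 0, powser u x != 0.
    by apply: (cvgr_neq0 _ c0); rewrite powser_at0.
  move=> /nbhs_ballP[D /= D0 sub]; exists D => // x /andP[_ xD].
  by apply: sub; rewrite /ball /= sub0r normrN.
have [D D0 HD] := IH (u \o S) (cvg_disk_shift cu) un.
exists (Num.min D e); first by rewrite lt_min D0.
move=> x /andP[x0]; rewrite lt_min => /andP[xD xe].
rewrite (powser_shift cu xe) u0 add0r mulf_neq0 -?normr_gt0//.
by rewrite normr_gt0; apply: HD; rewrite x0.
Qed.

Lemma powser_eq0 u : (forall n, u n = 0) -> powser u = cst 0.
Proof.
move=> u0; apply/funext => x; apply/cvg_lim => //.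
rewrite (_ : pseries u x = cst 0); first exact: cvg_cst.
apply/funext => n; rewrite /pseries /series /= big1// => i _.
by rewrite u0 mul0r.
Qed.

(** The definition gives convergence only at points of the half-line. The points a + z with 0 < z <
    e all lie there, and convergence at z implies convergence on the disk of radius z, hence on the
    full disk even when a = 0. *)
Lemma analytic_local h a : analytic_on_nneg h -> 0 <= a ->
  exists u e, [/\ 0 < e, cvg_disk u e &
    forall r, 0 <= r -> `|r - a| < e -> h r = powser u (r - a)].
Proof.
move=> ah a0; have [u [e [e0 H]]] := ah a a0; exists u, e; split => //.
- move=> x xe; pose z := (`|x| + e) / 2.
  have [xz ze] : `|x| < z /\ z < e by rewrite /z; split; lra.
  have z0 : 0 < z by apply: le_lt_trans xz.
  apply: (@is_cvg_pseries_inside _ _ z); last by rewrite (gtr0_norm z0).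
  have az : a + z - a = z by ring.
  apply/cvg_ex; exists (h (a + z)).
  have := H (a + z); rewrite az; apply; first lra.
  by rewrite gtr0_norm.
- by move=> r r0 re; apply/esym/cvg_lim => //; exact: H.
Qed.

Lemma analytic_dichotomy h a : analytic_on_nneg h -> 0 <= a ->
  (exists2 D, 0 < D & forall r, 0 <= r -> `|r - a| < D -> h r = 0) \/
  (exists2 D, 0 < D & forall r, 0 <= r -> 0 < `|r - a| < D -> h r != 0).
Proof.
move=> ah a0; have [u [e [e0 cu hu]]] := analytic_local ah a0.
have [u0|] := pselect (forall n, u n = 0).
  by left; exists e => // r r0 re; rewrite hu// powser_eq0.
move=> /existsNP[n /eqP un]; right.
have [D D0 HD] := powser_isolated_zero e0 cu un.
exists (Num.min D e); first by rewrite lt_min D0.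
move=> r r0 /andP[ra]; rewrite lt_min => /andP[rD re].
by rewrite hu//; apply: HD; rewrite ra.
Qed.

Lemma isolated_ball (A : set R) a D : A a -> 0 < D ->
  (forall r, A r -> 0 < `|r - a| < D -> False) -> isolated A a.
Proof.
move=> Aa D0 H; split; first exact: mem_set.
exists (ball a D); first exact: nbhsx_ballx.
apply/seteqP; split => [r [/=]|r ->]; last by split => //; exact: ballxx.
rewrite /ball/= distrC => rD Ar; apply/eqP; rewrite -subr_eq0 -normr_le0 leNgt.
by apply/negP => r0; apply: (H r Ar); rewrite r0.
Qed.

(** If all zeros are isolated, they are countable. Otherwise the function vanishes near some zero a,
    and the vanishing propagates along the segment from a to any other point. *)
Lemma analytic_zeros h : analytic_on_nneg h ->
  (forall x, 0 <= x -> h x = 0) \/ countable [set x | 0 <= x /\ h x = 0].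
Proof.
move=> ah; set Z := [set x | _].
have [iZ|] := pselect (Z `<=` isolated Z).
  by right; apply: sub_countable (countable_isolated Z); exact: subset_card_le.
move=> /existsNP[a /not_implyP[Za nia]]; left.
have [a0 ha] := Za.
have [[D0 D00 HD0]|[D D0 HD]] := analytic_dichotomy ah a0; last first.
  exfalso; apply: nia; apply: isolated_ball D0 _ => // r [r0 hr] rD.
  by have := HD _ r0 rD; rewrite hr eqxx.
move=> t t0.
(* Parametrizing the segment by [0, 1] treats targets on either side of a alike. *)
pose p s := a + s * (t - a).
have p0 s : 0 <= s <= 1 -> 0 <= p s.
  by rewrite /p => /andP[s0 s1]; nra.
have [ta|ta] := eqVneq t a; first by rewrite ta.
pose S := [set s | 0 <= s <= 1 /\ forall r, 0 <= r <= s -> h (p r) = 0].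
have S0 : S 0.
  split; first by rewrite lexx ler01.
  by move=> r /le_anti <-; rewrite /p mul0r addr0.
have hS : has_sup S by split; [exists 0 | exists 1 => s [/andP[]]].
have s0 : 0 <= sup S by apply: ub_le_sup => //; case: hS.
have s1 : sup S <= 1 by apply: sup_le_ub => [|s [/andP[]]//]; exists 0.
have ps0 : 0 <= p (sup S) by apply: p0; rewrite s0.
have tan : 0 < `|t - a| by rewrite normr_gt0 subr_eq0.
have pd r s : `|p r - p s| = `|r - s| * `|t - a|.
  by rewrite -normrM; congr `|_|; rewrite /p; ring.
have below r : 0 <= r < sup S -> h (p r) = 0.
  move=> /andP[r0 rs]; have e0 : 0 < sup S - r by rewrite subr_gt0.
  have [s [_ Ss] ss] := sup_adherent e0 hS.
  by apply: Ss; rewrite r0 /=; lra.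
(* A punctured neighbourhood without zeros is impossible at [p (sup S)]: there are zeros at
   parameters just below [sup S] or, if [sup S] is 0, at the points just to the right of a. *)
have [[D D_0 HD]|[D D_0 HD]] := analytic_dichotomy ah ps0; last first.
  exfalso; have [s00|sgt] := eqVneq (sup S) 0.
    pose r := Num.min a D0.
    have pS : p (sup S) = a by rewrite /p s00 mul0r addr0.
    rewrite pS in HD; pose m := Num.min D D0 / 2.
    have m0 : 0 < m by rewrite /m divr_gt0// lt_min D_0.
    have [mD mD0] : m < D /\ m < D0.
      have : Num.min D D0 <= D by rewrite ge_min lexx.
      have : Num.min D D0 <= D0 by rewrite ge_min lexx orbT.
      by rewrite /m; split; lra.
    have : h (a + m) != 0.
      by apply: HD; [lra|rewrite addrAC subrr add0r gtr0_norm// m0].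
    rewrite HD0 ?eqxx//; first lra.
    by rewrite addrAC subrr add0r gtr0_norm.
  have sgt0 : 0 < sup S by rewrite lt_neqAle eq_sym sgt.
  pose m := Num.min (sup S) (D / `|t - a|) / 2.
  have m0 : 0 < m by rewrite /m divr_gt0// lt_min sgt0 divr_gt0.
  have [ms mD] : m < sup S /\ m < D / `|t - a|.
    have : Num.min (sup S) (D / `|t - a|) <= sup S by rewrite ge_min lexx.
    have : Num.min (sup S) (D / `|t - a|) <= D / `|t - a|.
      by rewrite ge_min lexx orbT.
    by move: m0; rewrite /m; split; lra.
  have : h (p (sup S - m)) != 0.
    apply: HD; first by apply: p0; apply/andP; split; lra.
    rewrite pd addrAC subrr add0r normrN gtr0_norm// mulr_gt0//=.
    by rewrite -ltr_pdivlMr.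
  by rewrite below ?eqxx//; apply/andP; split; lra.
have near_s r : 0 <= r <= 1 -> `|r - sup S| < D / `|t - a| -> h (p r) = 0.
  by move=> r01 rs; apply: HD; [exact: p0|rewrite pd -ltr_pdivlMr].
have Dt : 0 < D / `|t - a| by rewrite divr_gt0.
have Ss : S (Num.min 1 (sup S + D / `|t - a| / 2)).
  split; first by rewrite le_min ler01 ge_min lexx/= andbT; lra.
  move=> r /andP[r0]; rewrite le_min => /andP[r1 rs].
  have [rlt|rge] := ltP r (sup S); first by apply: below; rewrite r0.
  by apply: near_s; rewrite ?r0// ger0_norm ?subr_ge0//; lra.
have := ub_le_sup (proj2 hS) Ss; rewrite ge_min => /orP[s11|]; last lra.
have -> : t = p 1 by rewrite /p mul1r; ring.
case: Ss => _; apply; rewrite ler01/= le_min lexx/=; lra.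
Qed.

End real_analysis.

(** * C^1 extension of the node functions and countability of exceptional radii *)

Section c1_extension.
Context {R : realType}.
Implicit Types (f g h E : R -> R) (a b c e r x : R) (u d : nat -> R).

Lemma near_eq_continuous g h r : (\near r, g r = h r) ->
  {for r, continuous g} -> {for r, continuous h}.
Proof.
move=> gh cg; rewrite /prop_for /continuous_at -(nbhs_singleton gh).
by apply: cvg_trans cg; apply: near_eq_cvg; apply: filterS gh => x ->.
Qed.

(** The derivative is asserted for r > 0 only, since [f] is arbitrary on the negative half-line. *)
Lemma analytic_derive f a : analytic_on_nneg f -> 0 <= a ->
  exists u e, [/\ 0 < e, cvg_disk u e,
    (forall r, 0 <= r -> `|r - a| < e -> f r = powser u (r - a)) &
    forall r, 0 < r -> `|r - a| < e ->
      is_derive r 1 f (powser (pseries_diffs u) (r - a))].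
Proof.
move=> af a0; have [u [e [e0 cu fu]]] := analytic_local af a0.
exists u, e; split => // r r0 re.
apply: (@near_eq_is_derive _ _ _ (powser u \o (fun s => s - a))).
  have re0 : 0 < e - `|r - a| by rewrite subr_gt0.
  have : \forall s \near r, 0 < s by exact: lt_nbhsr.
  apply: filterS2 (nbhsx_ballx r _ re0) => s /= rs s0.
  rewrite fu//; first exact: ltW.
  move: rs; rewrite /ball/= ltrBrDr; apply: le_lt_trans.
  by rewrite -(subrKA r) distrC ler_normD.
rewrite -[X in is_derive _ _ _ X]mulr1.
apply: is_derive1_comp; first exact: (is_derive_powser cu).
by apply: is_derive_eq; rewrite subr0.
Qed.

(** The extension follows the tangent line at 0 on the negative half-line. The linear bound on the
    slope near 0 is what keeps the perceived density bounded when the slope at 0 vanishes. *)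
Lemma analytic_C1_extension f : analytic_on_nneg f ->
  exists g E, [/\ (forall r, 0 <= r -> g r = f r),
    (forall r, is_derive r 1 g (E r)), continuous E &
    exists C e, 0 < e /\ forall r, 0 <= r < e -> `|E r - E 0| <= C * r].
Proof.
move=> af; have [u [e [e0 cu fu du]]] := analytic_derive af (lexx 0).
pose b := powser (pseries_diffs u) 0.
pose E r := if r <= 0 then b else derive1 f r.
pose g r := if r < 0 then f 0 + b * r else f r.
have cu' := cvg_disk_diffs cu.
have EE r : 0 <= r -> r < e -> E r = powser (pseries_diffs u) r.
  move=> r0 re; rewrite /E; case: leP => [r0'|r0'].
    by have -> : r = 0 by apply/le_anti; rewrite r0'.
  rewrite derive1E; have := du r r0'; rewrite subr0 gtr0_norm// => /(_ re) H.
  by rewrite derive_val.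
have gneg r : r < 0 -> \forall s \near r, f 0 + b * s = g s.
  by move=> r0; near=> s; rewrite /g ifT//; near: s; exact: lt_nbhsl.
have gpos r : 0 < r -> \forall s \near r, f s = g s.
  move=> r0; near=> s; rewrite /g ifF//; apply/negbTE; rewrite -leNgt ltW//.
  by near: s; exact: lt_nbhsr.
exists g, E; split.
- by move=> r r0; rewrite /g ltNge r0.
- move=> r; have [r0|r0|->] := ltgtP r 0.
  + apply: near_eq_is_derive (gneg r r0) _; rewrite /E (ltW r0).
    rewrite (_ : (fun s => _) = cst (f 0) + b *: (@id R)); last exact/funext.
    by apply: is_derive_eq; rewrite add0r /GRing.scale/= mulr1.
  + apply: near_eq_is_derive (gpos r r0) _; rewrite /E leNgt r0/= derive1E.
    apply: DeriveDef => //.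
    have [v [e' [e'0 _ _]]] := analytic_derive af (ltW r0).
    by move=> /(_ r r0); rewrite subrr normr0 => /(_ e'0)[].
  + have E0 : E 0 = b by rewrite /E lexx.
    have D0 : is_derive (0:R) 1 (powser u) b by apply: is_derive_powser cu _; rewrite normr0.
    suff H : h^-1 *: (g (h *: 1 + 0) - g 0) @[h --> (0:R)^'] --> b.
      have Hc : cvg (h^-1 *: (g (h *: 1 + 0) - g 0) @[h --> (0:R)^']).
        by apply/cvg_ex; exists b.
      by rewrite E0; apply: DeriveDef => //; exact: cvg_lim H.
    have : h^-1 *: (powser u (h *: 1 + 0) - powser u 0) @[h --> (0:R)^'] --> b.
      by case: D0 => /[swap] <-.
    move=> /cvgrPdist_lt cv; apply/cvgrPdist_lt => eps eps0.
    have := cv _ eps0; apply: filter_app.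
    near=> h; rewrite /GRing.scale/= mulr1 addr0.
    have h0 : h != 0 by near: h; exact: nbhs_dnbhs_neq.
    have he : `|h| < e.
      near: h; apply: nbhs_dnbhs; apply/nbhs_ballP; exists e => //= s.
      by rewrite /ball/= sub0r normrN.
    rewrite /g ltxx; have [h0'|h0'] := ltP h 0 => H.
      by rewrite addrAC subrr add0r mulrCA mulVf// mulr1 subrr normr0.
    have := fu h h0'; rewrite subr0 => /(_ he) ->.
    by have := fu 0 (lexx 0); rewrite subr0 normr0 => /(_ e0) ->; exact: H.
- move=> r; have [r0|r0|->] := ltgtP r 0.
  + apply: (@near_eq_continuous (cst b)); last exact: cst_continuous.
    by near=> s; rewrite /E ifT//; apply: ltW; near: s; exact: lt_nbhsl.
  + have [v [e' [e'0 cv _ dv]]] := analytic_derive af (ltW r0).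
    have cv' := cvg_disk_diffs cv.
    apply: (@near_eq_continuous (powser (pseries_diffs v) \o (fun s => s - r))).
      near=> s; have s0 : 0 < s by near: s; exact: lt_nbhsr.
      have sr : `|s - r| < e'.
        near: s; apply/nbhs_ballP; exists e' => //= s.
        by rewrite /ball/= distrC.
      have := dv s s0 sr; rewrite /E leNgt s0/= derive1E => H.
      by rewrite derive_val.
    apply: continuous_comp; first by apply: continuousB; [exact: cvg_id|exact: cst_continuous].
    by rewrite subrr; apply: continuous_powser cv' _; rewrite normr0.
  + have E0 : E 0 = b by rewrite /E lexx.
    have : {for 0, continuous (powser (pseries_diffs u))}.
      by apply: continuous_powser cu' _; rewrite normr0.
    move=> /cvgrPdist_lt cv; apply/cvgrPdist_lt => eps eps0.
    rewrite E0; have := cv _ eps0; apply: filterS2 (nbhsx_ballx 0 _ e0) => s.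
    rewrite /ball/= sub0r normrN => se.
    have [s0|s0] := leP s 0; first by rewrite /E s0 subrr normr0.
    by rewrite EE// ?ltW// -(gtr0_norm s0).
- have E0 : E 0 = b by rewrite /E lexx.
  have D0 : is_derive (0:R) 1 (powser (pseries_diffs u)) (powser (pseries_diffs (pseries_diffs u)) 0).
    by apply: is_derive_powser cu' _; rewrite normr0.
  set l := powser _ _ in D0.
  have : h^-1 *: (powser (pseries_diffs u) (h *: 1 + 0) - b) @[h --> (0:R)^'] --> l.
    by case: D0 => /[swap] <-.
  move=> /cvgrPdist_lt/(_ _ ltr01)/nbhs_ballP[D /= D_0 HD].
  (* Here [l] is the derivative of the slope series at 0, and the difference quotients of the slope
     are within 1 of it. *)
  exists (`|l| + 1), (Num.min D e); split; first by rewrite lt_min D_0.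
  move=> r /andP[]; rewrite le_eqVlt => /orP[/eqP<- _|r0].
    by rewrite subrr normr0 mulr0.
  rewrite lt_min => /andP[rD re].
  have := HD r; rewrite /ball /= sub0r normrN gtr0_norm// => /(_ rD (lt0r_neq0 r0)).
  rewrite E0 (EE r (ltW r0) re) /GRing.scale/= mulr1 addr0.
  set q := _ - b => H.
  have -> : q = (r^-1 * q) * r by rewrite mulrAC mulVf ?mul1r// gt_eqF.
  rewrite normrM (gtr0_norm r0) ler_pM2r//.
  have := ler_normB l (l - r^-1 * q); rewrite subKr => /le_trans; apply.
  by rewrite lerD2l ltW.
Unshelve. all: by end_near. Qed.

(** At a > 0 the slope is a power series. Were all its coefficients zero, [f] would be constant near
    a, against strict decrease; hence zeros are isolated. The point 0 is added by hand. *)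
Lemma decreasing_derive_zeros f g E : analytic_on_nneg f ->
  strictly_decreasing_on_nneg f -> (forall r, 0 <= r -> g r = f r) ->
  (forall r, is_derive r 1 g (E r)) -> countable [set r | 0 <= r /\ E r = 0].
Proof.
move=> af df gf dg.
pose Z := [set r | 0 < r /\ E r = 0].
have cZ : countable Z.
  suff iZ : Z `<=` isolated Z.
    by apply: sub_countable (countable_isolated Z); exact: subset_card_le.
  move=> a [a0 Ea].
  have [u [e [e0 cu fu du]]] := analytic_derive af (ltW a0).
  have Eu r : 0 < r -> `|r - a| < e -> E r = powser (pseries_diffs u) (r - a).
    move=> r0 re; have fr := du r r0 re.
    have gr : is_derive r 1 g (powser (pseries_diffs u) (r - a)).
      apply: near_eq_is_derive fr; near=> s; rewrite gf// ltW//.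
      by near: s; exact: lt_nbhsr.
    by case: (dg r) => _ <-; case: gr => _ <-.
  have [u0|] := pselect (forall n, u n.+1 = 0).
    exfalso; pose s := a + e / 2.
    have sa : s - a = e / 2 by rewrite /s addrAC subrr add0r.
    have e20 : 0 < e / 2 by rewrite divr_gt0.
    have := df a s (ltW a0); rewrite /s ltrDl => /(_ e20).
    rewrite (fu a (ltW a0)) ?subrr ?normr0// (fu (a + e / 2)) ?sa ?gtr0_norm//; [|lra|lra].
    rewrite powser_at0 (powser_shift cu) ?gtr0_norm; [|lra|lra].
    by rewrite (@powser_eq0 _ (u \o S))// mulr0 addr0 ltxx.
  move=> /existsNP[n /eqP un].
  have un' : pseries_diffs u n != 0 by rewrite mulf_neq0// pnatr_eq0.
  have [D D0 HD] := powser_isolated_zero e0 (cvg_disk_diffs cu) un'.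
  apply: (@isolated_ball _ _ _ (Num.min D e)) => //; first by rewrite lt_min D0.
  move=> r [r0 Er] /andP[ra]; rewrite lt_min => /andP[rD re].
  by have := HD (r - a); rewrite ra rD -Eu// Er eqxx => /(_ isT).
apply: (@sub_countable _ _ _ ([set 0] `|` Z)).
  apply: subset_card_le => r [r0 Er]; move: r0; rewrite le_eqVlt => /orP[/eqP<-|r0].
    by left.
  by right.
rewrite -bigcup2E; apply: bigcup_countable => // -[|[|n]] _ //=.
Unshelve. all: by end_near. Qed.

(** The difference of the two sides is itself analytic on the half-line. With c the distance between
    two sensors, this decides between a tie on countably many spheres and the relation [below]. *)
Lemma shifted_coincidence f1 f2 c : analytic_on_nneg f1 -> analytic_on_nneg f2 ->
  0 <= c -> (forall x, 0 <= x -> f1 x = f2 (x + c)) \/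
    countable [set x | 0 <= x /\ f1 x = f2 (x + c)].
Proof.
move=> a1 a2 c0.
have : analytic_on_nneg (fun x => f1 x - f2 (x + c)).
  move=> a a0.
  have [u1 [e1 [e10 H1]]] := a1 a a0.
  have [u2 [e2 [e20 H2]]] := a2 (a + c) (addr_ge0 a0 c0).
  exists (u1 \- u2), (Num.min e1 e2); split; first by rewrite lt_min e10.
  move=> r r0; rewrite lt_min => /andP[r1 r2].
  have rc : r + c - (a + c) = r - a by ring.
  have := H2 (r + c) (addr_ge0 r0 c0); rewrite rc => /(_ r2) {}H2.
  rewrite (_ : pseries _ _ = pseries u1 (r - a) \- pseries u2 (r - a)).
    by apply: cvgB => //; exact: H1.
  apply/funext => n; rewrite /pseries /series /= -sumrB.
  by apply: eq_bigr => i _; rewrite mulrBl.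
move=> /analytic_zeros[H|H]; [left|right].
  by move=> x x0; apply/eqP; rewrite -subr_eq0; apply/eqP; exact: H.
apply: sub_countable H; apply: subset_card_le => x [x0 H]; split => //.
by rewrite H subrr.
Qed.

End c1_extension.

(** * Euclidean norm and Lebesgue measure on row vectors *)

Section enorm.
Context {R : realType} {d : nat}.
Implicit Types (x y z p q : 'rV[R]_d) (a : R).

Lemma enorm_ge0 x : 0 <= enorm x.
Proof. exact: sqrtr_ge0. Qed.

Lemma sum_sqr_ge0 x : 0 <= \sum_k x ord0 k ^+ 2.
Proof. by apply: sumr_ge0 => k _; exact: sqr_ge0. Qed.

Lemma enorm_sqr x : enorm x ^+ 2 = \sum_k x ord0 k ^+ 2.
Proof. by rewrite sqr_sqrtr// sum_sqr_ge0. Qed.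

Lemma enormZ a x : enorm (a *: x) = `|a| * enorm x.
Proof.
rewrite /enorm -sqrtr_sqr -sqrtrM ?sqr_ge0// mulr_sumr.
by congr Num.sqrt; apply: eq_bigr => k _; rewrite mxE exprMn.
Qed.

Lemma enormN x : enorm (- x) = enorm x.
Proof. by rewrite -scaleN1r enormZ normrN1 mul1r. Qed.

Lemma enormB x y : enorm (x - y) = enorm (y - x).
Proof. by rewrite -enormN opprB. Qed.

Lemma enorm0 : enorm (0 : 'rV[R]_d) = 0.
Proof. by rewrite -(scale0r 0) enormZ normr0 mul0r. Qed.

Lemma coord_le_enorm x k : `|x ord0 k| <= enorm x.
Proof.
rewrite -sqrtr_sqr ler_sqrt ?sum_sqr_ge0// (bigD1 k)//= lerDl.
by apply: sumr_ge0 => j _; exact: sqr_ge0.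
Qed.

Lemma enorm_eq0 x : enorm x = 0 -> x = 0.
Proof.
move=> x0; apply/rowP => k; rewrite mxE; apply/eqP.
by rewrite -normr_le0 -x0 coord_le_enorm.
Qed.

Lemma cauchy_schwarz x y :
  \sum_k x ord0 k * y ord0 k <= enorm x * enorm y.
Proof.
have [->|y0] := eqVneq y 0.
  by rewrite enorm0 mulr0 big1// => k _; rewrite mxE mulr0.
have [C CE] : exists C, C = \sum_k x ord0 k * y ord0 k by eexists.
rewrite -CE.
have e0 : 0 < enorm y by rewrite lt_neqAle enorm_ge0 andbT eq_sym; apply: contra_neq y0 => /enorm_eq0.
(* The summands are the squared coordinates of |y|^2 times the component of x orthogonal to y. *)
have : 0 <= \sum_k (enorm y ^+ 2 * x ord0 k - C * y ord0 k) ^+ 2.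
  by apply: sumr_ge0 => k _; exact: sqr_ge0.
have -> : \sum_k (enorm y ^+ 2 * x ord0 k - C * y ord0 k) ^+ 2 =
   enorm y ^+ 2 * (enorm x ^+ 2 * enorm y ^+ 2 - C ^+ 2).
  transitivity (enorm y ^+ 2 ^+ 2 * (\sum_k x ord0 k ^+ 2)
     + (- (2 * enorm y ^+ 2 * C) * (\sum_k x ord0 k * y ord0 k)
        + C ^+ 2 * \sum_k y ord0 k ^+ 2)).
    by rewrite !mulr_sumr -!big_split/=; apply: eq_bigr => k _; ring.
  by rewrite -CE -!enorm_sqr; ring.
rewrite pmulr_rge0 ?exprn_gt0// subr_ge0 -exprMn => H.
have [C0|C0] := leP C 0; first by apply: le_trans C0 _; rewrite mulr_ge0 ?enorm_ge0.
by rewrite -ler_sqr ?nnegrE ?(ltW C0)// mulr_ge0 ?enorm_ge0.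
Qed.

Lemma enormD x y : enorm (x + y) <= enorm x + enorm y.
Proof.
rewrite -ler_sqr ?nnegrE ?addr_ge0 ?enorm_ge0// sqrrD !enorm_sqr.
have -> : \sum_k (x + y) ord0 k ^+ 2 = \sum_k x ord0 k ^+ 2
    + (\sum_k x ord0 k * y ord0 k) *+ 2 + \sum_k y ord0 k ^+ 2.
  by rewrite -sumrMnl -!big_split/=; apply: eq_bigr => k _; rewrite mxE sqrrD.
by rewrite lerD2r lerD2l lerMn2r/= cauchy_schwarz.
Qed.

Lemma enorm_triangle x y z : enorm (x - z) <= enorm (x - y) + enorm (y - z).
Proof. by rewrite -[x - z](subrKA y) enormD. Qed.

Lemma enorm_dist x y : `|enorm x - enorm y| <= enorm (x - y).
Proof.
rewrite ler_norml lerBlDr lerBrDr.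
have := enormD (x - y) y; rewrite subrK addrC.
have := enormD (y - x) x; rewrite subrK -(enormB x) => H1 H2.
by apply/andP; split; lra.
Qed.

Lemma enorm_le_sum x : enorm x <= \sum_k `|x ord0 k|.
Proof.
rewrite -ler_sqr ?nnegrE ?enorm_ge0 ?sumr_ge0// enorm_sqr.
apply: (@le_trans _ _ (\sum_k `|x ord0 k| * \sum_j `|x ord0 j|)); last first.
  by rewrite -mulr_suml expr2.
apply: ler_sum => k _; rewrite -real_normK ?num_real// expr2 ler_wpM2l//.
by rewrite (bigD1 k)//= lerDl sumr_ge0.
Qed.

End enorm.

Section measure_rV.
Context {R : realType}.

Lemma measurable_coord_preimage n (k : 'I_n) (B : set R) :
  measurable B -> measurable [set q : 'rV[R]_n | B (q ord0 k)].
Proof. by move=> mB; have := measurable_rV_coord k measurableT mB; rewrite setTI. Qed.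

Lemma measurable_coord_ball n (k : 'I_n) (a b : R) :
  measurable [set q : 'rV[R]_n | `|q ord0 k - a| <= b].
Proof.
have := measurable_coord_preimage k (@measurable_itv R `[a - b, a + b]).
by congr (measurable _); apply/seteqP; split => q /=; rewrite in_itv/= ler_distl.
Qed.

(** An open set is the countable union of the boxes with rational centre and radius 1/(m+1) that it
    contains. *)
Lemma open_measurable_rV n (U : set 'rV[R]_n) : open U -> measurable U.
Proof.
move=> oU.
pose bx (c : 'rV[rat]_n * nat) : set 'rV[R]_n :=
  [set q | forall k, `|ratr (c.1 ord0 k) - q ord0 k| < c.2.+1%:R^-1].
pose F c := if pselect (bx c `<=` U) then bx c else set0.
have -> : U = \bigcup_c F c.
  apply/seteqP; split => [q Uq|q [c _]]; last first.
    by rewrite /F; case: pselect => // H /H.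
  have : nbhs q U by move: oU; rewrite openE => /(_ q Uq).
  move=> /nbhs_ballP[e /= e0 qU].
  have [m me] : exists m, m.+1%:R^-1 < e / 2.
    have e20 : 0 < e / 2 by rewrite divr_gt0.
    have [m _ /(_ m (leqnn _)) H] := near_infty_natSinv_lt (PosNum e20).
    by exists m.
  have cP k : exists c : rat, `|ratr c - q ord0 k| < m.+1%:R^-1.
    have m0 : 0 < m.+1%:R^-1 :> R by rewrite invr_gt0 ltr0n.
    have oB : open (ball (q ord0 k) m.+1%:R^-1) by exact: ball_open.
    have [z [/= cq [c _ cE]]] := dense_rat (ex_intro _ _ (ballxx (q ord0 k) m0)) oB.
    by exists c; move: cq; rewrite -cE /ball/= distrC.
  pose c := \row_k projT1 (cid (cP k)).
  have qc : bx (c, m) q by move=> k /=; rewrite mxE; case: cid.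
  exists (c, m) => //; rewrite /F; case: pselect => // -[].
  move=> y /= yc; apply: qU; split => // i k; rewrite (ord1 i) /ball/=.
  have := yc k; have := qc k => /= H1 H2.
  rewrite -(subrKA (ratr (c ord0 k))) (le_lt_trans (ler_normD _ _))// distrC.
  by apply: (le_lt_trans (lerD (ltW H1) (ltW H2))); rewrite (splitr e) ltrD.
apply: countable_bigcupT_measurable; first exact: countableP.
move=> c; rewrite /F; case: pselect => [_b|_b] /=; last exact: measurable0.
have -> : bx c = \bigcap_(k : 'I_n) [set q | `|ratr (c.1 ord0 k) - q ord0 k| < c.2.+1%:R^-1].
  by apply/seteqP; split => q H k //; have := H k; exact.
apply: fin_bigcap_measurable => // k _.
pose a : R := ratr (c.1 ord0 k).
have := @measurable_coord_preimage n k (ball a c.2.+1%:R^-1).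
by apply; apply: open_measurable; apply: ball_open; rewrite invr_gt0 ltr0n.
Qed.

Lemma closed_measurable_rV n (A : set 'rV[R]_n) : closed A -> measurable A.
Proof.
move=> cA; rewrite -(setCK A); apply: measurableC; apply: open_measurable_rV.
exact: closed_openC.
Qed.

Definition upd n (q : 'rV[R]_n) (k : 'I_n) (x : R) : 'rV[R]_n :=
  \row_j (if j == k then x else q ord0 j).

Lemma rV_cons_measurable n (A : set 'rV[R]_n.+1) :
  measurable A -> measurable (@rV_cons R n @^-1` A).
Proof. by move=> mA; rewrite -[X in measurable X]setTI; exact: measurable_rV_cons. Qed.

(** Fubini, by induction on the dimension. If k is the first coordinate, the sections along it are
    countable, hence null; otherwise fixing the first coordinate leaves a set of the same kind in
    one dimension less. *)
Lemma null_lines n (A : set 'rV[R]_n) (k : 'I_n) : measurable A ->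
  (forall q, countable [set x | A (upd q k x)]) -> lebesgue_rV R n A = 0%E.
Proof.
elim: n A k => [A [] //|n IH A k mA cA].
have mA' := rV_cons_measurable mA.
rewrite /= /lebesgue_rV_succ /pushforward.
have [j kE|kE] := unliftP ord0 k.
  rewrite /product_measure1; apply: integral0_eq => x _ /=.
  rewrite /xsection/=; apply: (IH _ j).
    exact: (measurable_xsection x mA').
  move=> y; apply: sub_countable (cA (rV_cons (x, y))); apply: subset_card_le.
  move=> t /=; rewrite inE /=; congr A.
  apply/rowP => i; rewrite !mxE; have [i'|] := unliftP ord0 i => ->.
    by rewrite /= mxE kE (inj_eq lift_inj).
  by rewrite /= kE (negbTE (neq_lift _ _)).
(* The sections along the first coordinate have to be measured first, so the order of integration is
   exchanged. *)
rewrite (product_measure_unique (m' := [the measure _ _ of (lebesgue_measure \x^ lebesgue_rV R n)%E]))//; last first.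
  by move=> B1 B2 mB1 mB2; exact: product_measure2E.
rewrite /= /product_measure2; apply: integral0_eq => y _ /=.
apply: countable_lebesgue_measure0.
apply: sub_countable (cA (rV_cons (0, y))); apply: subset_card_le.
move=> t /=; rewrite /ysection /= inE /=; congr A.
apply/rowP => i; rewrite !mxE; have [i'|] := unliftP ord0 i => ->.
  by rewrite /= kE eq_sym (negbTE (neq_lift _ _)).
by rewrite /= kE eqxx.
Qed.

Lemma lebesgue_rV_box n (c rho : 'I_n -> R) : (forall k, 0 <= rho k) ->
  lebesgue_rV R n [set q | forall k, `|q ord0 k - c k| <= rho k]
  = (\prod_k (2 * rho k))%:E.
Proof.
elim: n c rho => [c rho _|n IH c rho r0].
  by rewrite /= big_ord0 diracE mem_set// => -[].
rewrite /= /lebesgue_rV_succ /pushforward.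
pose B1 : set (measurableTypeR R) := `[c ord0 - rho ord0, c ord0 + rho ord0]%classic.
pose B2 : set 'rV[R]_n := [set q | forall k, `|q ord0 k - c (lift ord0 k)| <= rho (lift ord0 k)].
have -> : @rV_cons R n @^-1` [set q | forall k, `|q ord0 k - c k| <= rho k] = B1 `*` B2.
  apply/seteqP; split => -[x y] /=.
    move=> H; split; first by rewrite /B1/= in_itv/= -ler_distl; have := H ord0; rewrite mxE unlift_none.
    by move=> k; have := H (lift ord0 k); rewrite mxE liftK.
  move=> [H1 H2] k; rewrite mxE; have [i|] := unliftP ord0 k => ->; first exact: H2.
  by rewrite ler_distl; move: H1; rewrite /B1/= in_itv.
have mB2 : measurable B2.
  have -> : B2 = \bigcap_(k : 'I_n) [set q | `|q ord0 k - c (lift ord0 k)| <= rho (lift ord0 k)].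
    by apply/seteqP; split => q H k //; have := H k; exact.
  apply: fin_bigcap_measurable => // k _.
  exact: measurable_coord_ball.
rewrite product_measure1E//; last exact: measurable_itv.
rewrite (IH _ (fun k => rho (lift ord0 k)))// big_ord_recl EFinM; congr (_ * _)%E.
suff lB : lebesgue_measure (`[c ord0 - rho ord0, c ord0 + rho ord0]%classic : set R)
    = (2 * rho ord0)%:E by exact: lB.
rewrite lebesgue_measure_itv/= lte_fin.
have [r00|] := ltP; first by rewrite -EFinD; congr EFin; ring.
have := r0 ord0 => H1 H2; have -> : rho ord0 = 0 by move: H1 H2; lra.
by rewrite mulr0.
Qed.

End measure_rV.

(** * Integrals of real-valued functions *)

Section integral_tools.
Context d (T : measurableType d) (R : realType) (mu : {measure set T -> \bar R}).
Implicit Types (D : set T) (f g : T -> R) (K : R).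

Lemma le_const_integrable D f K : measurable D -> (mu D < +oo)%E ->
  measurable_fun D f -> (forall x, D x -> `|f x| <= K) ->
  mu.-integrable D (EFin \o f).
Proof.
move=> mD D_fin mf fK; apply: measurable_bounded_integrable => //.
exists K; split; first exact: num_real.
by move=> M KM x Dx /=; rewrite (le_trans (fK x Dx))// ltW.
Qed.

Lemma Rintegral_dominated_cvg D (u : nat -> T -> R) f (b : T -> R) :
  measurable D -> (forall n, measurable_fun D (u n)) -> measurable_fun D f ->
  mu.-integrable D (EFin \o b) -> (forall n x, D x -> `|u n x| <= b x) ->
  {ae mu, forall x, D x -> u ^~ x @ \oo --> f x} ->
  \int[mu]_(x in D) u n x @[n --> \oo] --> \int[mu]_(x in D) f x.
Proof.
move=> mD mu_ mf ib ub uf.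
have [] := @dominated_convergence _ _ _ mu D mD (fun n => EFin \o u n) (EFin \o f) (EFin \o b).
- by move=> n; apply/measurable_EFinP.
- exact/measurable_EFinP.
- by apply: filterS uf => x H Dx; apply: cvg_EFin; [exact: nearW|exact: H].
- exact: ib.
- by apply: aeW => x n Dx /=; rewrite lee_fin ub.
move=> intf _ cv; rewrite /Rintegral.
by apply: fine_cvg; rewrite fineK//; exact: integrable_fin_num.
Qed.

Lemma integrable_sum_ord (n : nat) D (f : 'I_n -> T -> R) : measurable D ->
  (forall i, mu.-integrable D (EFin \o f i)) ->
  mu.-integrable D (EFin \o (fun x => \sum_i f i x)).
Proof.
move=> mD intf.
have -> : EFin \o (fun x => \sum_i f i x) = (fun x => \sum_i (f i x)%:E)%E.
  by apply/funext => x /=; rewrite sumEFin.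
by apply: integrable_sum => // i _; exact: intf.
Qed.

Lemma Rintegral_sum_ord (n : nat) D (f : 'I_n -> T -> R) : measurable D ->
  (forall i, mu.-integrable D (EFin \o f i)) ->
  \int[mu]_(x in D) (\sum_i f i x) = \sum_i \int[mu]_(x in D) f i x.
Proof.
move=> mD intf.
apply: EFin_inj; rewrite /Rintegral fineK; last first.
  by apply: integrable_fin_num => //; exact: integrable_sum_ord.
have -> : (\int[mu]_(x in D) (\sum_i f i x)%:E)%E = (\int[mu]_(x in D) \sum_i (f i x)%:E)%E.
  by apply: eq_integral => x _; rewrite -sumEFin.
rewrite integral_sum// -sumEFin; apply: eq_bigr => i _.
by rewrite fineK//; have := integrable_fin_num mD (intf i).
Qed.

Lemma ae_le_Rintegral D f g K : measurable D -> (mu D < +oo)%E ->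
  measurable_fun D f -> measurable_fun D g ->
  (forall x, D x -> `|f x| <= K) -> (forall x, D x -> `|g x| <= K) ->
  {ae mu, forall x, D x -> f x <= g x} ->
  \int[mu]_(x in D) f x <= \int[mu]_(x in D) g x.
Proof.
move=> mD Dfin mf mg fK gK fg.
(* Monotonicity of the integral asks for an inequality at every point; [h] dominates [f] everywhere
   and equals [g] almost everywhere. *)
pose h := f \max g.
have mh : measurable_fun D h by exact: measurable_maxr.
have hK x : D x -> `|h x| <= K.
  by move=> Dx; rewrite /h /= /Num.max; case: ifP => _; [exact: gK|exact: fK].
have -> : \int[mu]_(x in D) g x = \int[mu]_(x in D) h x.
  rewrite /Rintegral; congr fine; apply: ae_eq_integral => //; try exact/measurable_EFinP.
  apply: filterS fg => x fgx Dx; congr EFin; rewrite /h /=.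
  by apply/esym/max_idPr; exact: fgx.
apply: le_Rintegral => //; [exact: le_const_integrable fK|exact: le_const_integrable hK|].
by move=> x Dx; rewrite /h /= le_max lexx.
Qed.

Lemma Rintegral_le_const D f K : measurable D -> (mu D < +oo)%E ->
  measurable_fun D f -> (forall x, D x -> `|f x| <= K) ->
  `|\int[mu]_(x in D) f x| <= K * fine (mu D).
Proof.
move=> mD Dfin mf fK.
have intf := le_const_integrable mD Dfin mf fK.
apply: le_trans (le_normr_Rintegral mD intf) _.
rewrite -Rintegral_cst//; apply: le_Rintegral => //.
- by have := integrable_abse intf.
- apply: (@le_const_integrable _ _ `|K|) => //; exact: measurable_cst.
Qed.

Lemma negligible_ae (P : T -> Prop) (A : set T) : mu.-negligible A ->
  (forall x, ~ A x -> P x) -> {ae mu, forall x, P x}.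
Proof.
by move=> nA H; apply: negligibleS nA => x /= nP; apply: contrapT => nAx; exact/nP/H.
Qed.

End integral_tools.

Section measurable_enorm.
Context {R : realType} {d : nat}.

Lemma measurable_coordB (D : set 'rV[R]_d) (p : 'rV[R]_d) k :
  measurable_fun D (fun q : 'rV[R]_d => (p - q) ord0 k).
Proof.
apply: measurable_funTS.
have -> : (fun q : 'rV[R]_d => (p - q) ord0 k) = (fun q => p ord0 k - rV_coord k q).
  by apply/funext => q; rewrite !mxE.
by apply: measurable_funB => //; exact: measurable_rV_coord.
Qed.

Lemma measurable_enorm (D : set 'rV[R]_d) (p : 'rV[R]_d) :
  measurable_fun D (fun q : 'rV[R]_d => enorm (p - q)).
Proof.
have ms : measurable_fun setT (@Num.sqrt R).
  by apply: continuous_measurable_fun; exact: sqrt_continuous.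
have mg : measurable_fun D (fun q : 'rV[R]_d => \sum_k (p - q) ord0 k ^+ 2).
  by apply: measurable_sum => k; apply: measurable_funX; exact: measurable_coordB.
exact: (measurableT_comp ms mg).
Qed.

Lemma measurable_comp_enorm (D : set 'rV[R]_d) (p : 'rV[R]_d) (g : R -> R) : continuous g ->
  measurable_fun D (fun q : 'rV[R]_d => g (enorm (p - q))).
Proof.
move=> cg; have mg : measurable_fun setT g by exact: continuous_measurable_fun.
exact: (measurableT_comp mg (@measurable_enorm D p)).
Qed.

Lemma bounded_rV_lt_pinfty (Q : set 'rV[R]_d) L :
  (forall q k, Q q -> `|q ord0 k| <= L) -> measurable Q -> (lebesgue_rV R d Q < +oo)%E.
Proof.
move=> QL mQ.
have := @lebesgue_rV_box R d (fun=> 0) (fun=> `|L|) (fun=> normr_ge0 _).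
pose B : set 'rV[R]_d := [set q | forall k, `|q ord0 k - 0| <= `|L|].
rewrite -/B => BE.
have mB : measurable B.
  have -> : B = \bigcap_(k : 'I_d) [set q | `|q ord0 k - 0| <= `|L|].
    by apply/seteqP; split => q H k //; have := H k; exact.
  by apply: fin_bigcap_measurable => // k _; exact: measurable_coord_ball.
apply: le_lt_trans (ltry (\prod_(k < d) (2 * `|L|))); rewrite -BE.
apply: le_measure; rewrite ?inE//.
by move=> q Qq k; rewrite subr0 (le_trans (QL q k Qq))// ler_norm.
Qed.

End measurable_enorm.

(** * Integral of the inverse distance in dimension at least two *)

Section inverse_distance.
Context {R : realType}.

(** The n sought satisfies 2^-(n+1) < r <= 2^-n; it precedes the least index with 2^-m < r, which is
    positive because r <= 1. *)
Lemma dyadic_scale (r : R) : 0 < r <= 1 -> exists n, r <= 2^-1 ^+ n /\ r^-1 <= 2 ^+ n.+1.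
Proof.
move=> /andP[r0 r1].
have ex : exists n, (fun n => 2^-1 ^+ n < r) n.
  have : (2^-1 : R) ^+ n @[n --> \oo] --> 0 by apply: cvg_expr; rewrite gtr0_norm; lra.
  move=> /cvgrPdist_lt/(_ _ r0)[n _ /(_ _ (leqnn n))]; rewrite sub0r normrN /= => H.
  by exists n; rewrite gtr0_norm in H; rewrite ?exprn_gt0.
case: (ex_minnP ex) => -[|n] Hn Hmin; first by move: Hn; rewrite expr0 ltNge r1.
exists n; split.
  by rewrite leNgt; apply/negP => /Hmin; rewrite ltnn.
rewrite -[leRHS]invrK lef_pV2 ?posrE ?invr_gt0 ?exprn_gt0//.
by rewrite -exprVn ltW.
Qed.

(** A box shrinking like 2^-n in two directions has measure of order 4^-n, which beats the size
    2^(n+1) of the inverse distance at that scale: a geometric series remains, whatever p is. *)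
Lemma integral_inv_enorm_bound (d : nat) (Q : set 'rV[R]_d) (L : R) :
  (1 < d)%N -> measurable Q -> (forall q k, Q q -> `|q ord0 k| <= L) ->
  exists B : R, forall p (g : 'rV[R]_d -> R), Q p -> measurable_fun Q g ->
    (forall q, Q q -> 0 <= g q <= (enorm (p - q))^-1) ->
    (\int[lebesgue_rV R d]_(q in Q) (g q)%:E <= B%:E)%E.
Proof.
case: d Q => [|[|d]]// Q _ mQ QL.
pose L' := `|L|; have L0 : 0 <= L' by exact: normr_ge0.
have {}QL q k : Q q -> `|q ord0 k| <= L' by move=> /(QL q k)/le_trans; apply; exact: ler_norm.
pose mu := lebesgue_rV R d.+2.
have mQfin : (mu Q < +oo)%E by exact: bounded_rV_lt_pinfty QL mQ.
pose rho n (k : 'I_d.+2) : R := if (k <= 1)%N then 2^-1 ^+ n else 2 * L'.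
have rho0 n k : 0 <= rho n k.
  by rewrite /rho; case: ifP => _; rewrite ?exprn_ge0 ?mulr_ge0.
pose box (p : 'rV[R]_d.+2) n : set 'rV[R]_d.+2 := [set q | forall k, `|q ord0 k - p ord0 k| <= rho n k].
have mbox p n : measurable (box p n).
  have -> : box p n = \bigcap_(k : 'I_d.+2) [set q | `|q ord0 k - p ord0 k| <= rho n k].
    by apply/seteqP; split => q H k //; have := H k; exact.
  by apply: fin_bigcap_measurable => // k _; exact: measurable_coord_ball.
pose W := (2 * (2 * L')) ^+ d.
have W0 : 0 <= W by rewrite exprn_ge0// !mulr_ge0.
have boxE p n : mu (box p n) = (4 * (2^-1 ^+ n * 2^-1 ^+ n) * W)%:E.
  rewrite /mu lebesgue_rV_box// !big_ord_recl/=; congr EFin.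
  rewrite (eq_bigr (fun=> 2 * (2 * L'))) ?prodr_const ?card_ord; first by rewrite /rho/= -/W; ring.
  by [].
(* The constant 1 contributes the measure of Q, and the n-th box at most 8 W 2^-n, which sums to 16
   W. *)
exists (fine (mu Q) + 16 * W) => p g Qp mg g01.
(* The box [box p n] has sides of order [2 ^- n] in its first two directions, and
   [1 / |p - q|] is at most the sum of [1] and of the [2 ^+ n.+1] over the boxes
   containing [q]. *)
pose F n q : \bar R := ((2 ^+ n.+1) * \1_(box p n) q)%:E.
have F0 n q : (0 <= F n q)%E by rewrite lee_fin mulr_ge0// exprn_ge0.
have mF n : measurable_fun Q (F n).
  apply/measurable_EFinP; apply: measurable_funM; first exact: measurable_cst.
  exact: (measurable_indic (mbox p n)).
have F0' q : (0 <= \sum_(0 <= n <oo) F n q)%E by apply: nneseries_ge0.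
have mS : measurable_fun Q (fun q => \sum_(0 <= n <oo) F n q)%E.
  exact: ge0_emeasurable_sum.
apply: (@le_trans _ _ (\int[mu]_(q in Q) (cst 1%E q + \sum_(0 <= n <oo) F n q))%E).
  apply: ge0_le_integral => //.
  - by move=> q /g01/andP[]; rewrite lee_fin.
  - exact/measurable_EFinP.
  - exact: emeasurable_funD.
  move=> q Qq; have r0 := enorm_ge0 (p - q).
  apply: (@le_trans _ _ ((enorm (p - q))^-1)%:E).
    by have /andP[_] := g01 q Qq; rewrite lee_fin.
  have [r1|r1] := ltP 1 (enorm (p - q)).
    rewrite (@le_trans _ _ 1%E)//; last by rewrite leeDl.
    by rewrite lee_fin invf_le1 ?ltW// (lt_trans _ r1).
  (* At q = p the inverse of 0 is 0 by convention, so the bound is trivial. *)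
  have [->|rn0] := eqVneq (enorm (p - q)) 0.
    by rewrite invr0 adde_ge0.
  have [] := @dyadic_scale (enorm (p - q)); first by rewrite r1 lt_neqAle eq_sym rn0 r0.
  move=> n [rn rVn].
  have bq : box p n q.
    move=> k; rewrite /rho; case: ifP => _.
      by apply: le_trans rn; rewrite distrC; have := coord_le_enorm (p - q) k; rewrite !mxE.
    rewrite (le_trans (ler_normB _ _))//.
    by have := QL q k Qq; have := QL p k Qp => ? ?; lra.
  apply: (@le_trans _ _ (F n q)).
    by rewrite /F indicE mem_set// mulr1 lee_fin.
  apply: (@le_trans _ _ (\sum_(0 <= n <oo) F n q)%E); last by rewrite leeDr.
  apply: le_trans (nneseries_lim_ge n.+1 _) => //.
  by rewrite big_nat_recr//= leeDr// sume_ge0.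
rewrite ge0_integralD//.
rewrite integral_cst// mul1e EFinD fineK ?ge0_fin_numE//.
rewrite leeD2l// integral_nneseries//.
have Fle n : (\int[mu]_(q in Q) F n q <= (8 * 2^-1 ^+ n * W)%:E)%E.
  have e0 : (0 <= (2 ^+ n.+1 : R)%:E)%E by rewrite lee_fin exprn_ge0.
  have mi : measurable_fun Q (fun q => (\1_(box p n) q : R)%:E).
    by apply/measurable_EFinP; exact: (measurable_indic (mbox p n)).
  rewrite /F; under eq_integral do rewrite EFinM.
  rewrite ge0_integralZl//.
  rewrite integral_indic//.
  apply: (@le_trans _ _ ((2 ^+ n.+1)%:E * mu (box p n))%E).
    apply: lee_wpmul2l; first exact: e0.
    by apply: le_measure; rewrite ?inE//; apply: measurableI.
  rewrite boxE -EFinM lee_fin exprS.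
  have -> : 2 * 2 ^+ n * (4 * (2^-1 ^+ n * 2^-1 ^+ n) * W) =
            8 * (2 ^+ n * 2^-1 ^+ n) * 2^-1 ^+ n * W :> R by ring.
  by rewrite -exprMn divff// expr1n mulr1.
apply: lime_le.
  by apply: is_cvg_nneseries => n _ _; apply: integral_ge0 => q _; exact: F0.
apply: nearW => m.
apply: (@le_trans _ _ (\sum_(0 <= n < m) (8 * 2^-1 ^+ n * W)%:E)%E).
  by apply: lee_sum => n _; exact: Fle.
rewrite sumEFin lee_fin -mulr_suml -mulr_sumr ler_wpM2r//.
suff -> : \sum_(0 <= n < m) 2^-1 ^+ n = 2 - 2 * 2^-1 ^+ m :> R.
  by have : 0 <= 2^-1 ^+ m :> R by [rewrite exprn_ge0]; lra.
elim: m => [|m IH]; first by rewrite big_nil expr0; ring.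
by rewrite big_nat_recr//= IH exprS; field.
Qed.

End inverse_distance.

(** * Polytopes and limit points of trajectories *)

Section polytope.
Context {R : realType} {d : nat}.
Implicit Types (Q : set 'rV[R]_d) (p q x : 'rV[R]_d).

Lemma polytope_bounded Q : convex_polytope Q ->
  exists L : R, forall q k, Q q -> `|q ord0 k| <= L.
Proof.
move=> [m [v ->]]; exists (\sum_i enorm (v i)) => q k [w [w0 w1] <-].
rewrite summxE (le_trans (ler_norm_sum _ _ _))//; apply: ler_sum => i _.
rewrite mxE normrM ger0_norm//.
apply: (@le_trans _ _ (1 * `|v i ord0 k|)); last by rewrite mul1r coord_le_enorm.
apply: ler_wpM2r => //; rewrite -w1 (bigD1 i)//= lerDl.
by apply: sumr_ge0 => j _; exact: w0.
Qed.

Lemma polytope_convex Q p q (a : R) : convex_polytope Q -> 0 <= a <= 1 ->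
  Q p -> Q q -> Q (p + a *: (q - p)).
Proof.
move=> [m [v ->]] /andP[a0 a1] [w [w0 w1] <-] [u [u0 u1] <-].
exists (fun i => (1 - a) * w i + a * u i); first split.
- by move=> i; rewrite addr_ge0// mulr_ge0// subr_ge0.
- by rewrite big_split/= -!mulr_sumr w1 u1 !mulr1 subrK.
- rewrite scalerBr addrCA -[X in X + _]scale1r.
  rewrite (_ : \sum_i w i *: v i - a *: \sum_i w i *: v i = (1 - a) *: \sum_i w i *: v i); last first.
    by rewrite scalerBl scale1r.
  rewrite scale1r !scaler_sumr addrC -big_split/=; apply: eq_bigr => i _.
  by rewrite !scalerA -scalerDl.
Qed.

Lemma continuous_sumr (T : topologicalType) (V : normedModType R) (I : Type)
    (s : seq I) (F : I -> T -> V) :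
  (forall i, continuous (F i)) -> continuous (fun t => \sum_(i <- s) F i t).
Proof.
move=> cF; elim: s => [|i s IH] t.
  rewrite (_ : (fun t => _) = cst 0); first exact: cst_continuous.
  by apply/funext => u; rewrite big_nil.
rewrite (_ : (fun t => _) = F i \+ (fun t => \sum_(i <- s) F i t)).
  by apply: continuousD; [exact: cF|exact: IH].
by apply/funext => u; rewrite big_cons.
Qed.

Lemma polytope_compact Q : convex_polytope Q -> compact Q.
Proof.
move=> [m [v ->]].
pose S : set 'rV[R]_m := [set w | (forall i, 0 <= w ord0 i) /\ \sum_i w ord0 i = 1].
pose F (w : 'rV[R]_m) := \sum_i w ord0 i *: v i.
have -> : [set \sum_i w i *: v i | w in [set w : 'I_m -> R | (forall i, 0 <= w i) /\ \sum_i w i = 1]]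
   = F @` S.
  apply/seteqP; split => q [w [w0 w1] <-].
    exists (\row_i w i); last by apply: eq_bigr => i _; rewrite mxE.
    by split => [i|]; [rewrite mxE|rewrite -w1; apply: eq_bigr => i _; rewrite mxE].
  by exists (fun i => w ord0 i).
apply: continuous_compact.
  apply: continuous_subspaceT; apply: continuous_sumr => i w.
  have cc : continuous (fun t : 'rV[R]_m => t ord0 i) by exact: coord_continuous.
  by apply: (@cvgZl _ _ _ (nbhs w) _ (fun t : 'rV[R]_m => t ord0 i) (w ord0 i)); exact: cc.
apply: bounded_closed_compact.
  exists 1; split; first exact: num_real.
  move=> M M1 w [w0 w1] /=; have M0 : 0 <= M by rewrite (le_trans ler01)// ltW.
  rewrite /Num.norm/= mx_normrE; apply: bigmax_le => // -[i j] _ /=.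
  rewrite (ord1 i) ger0_norm//; apply: (le_trans _ (ltW M1)).
  by rewrite -w1 (bigD1 j)//= lerDl; apply: sumr_ge0 => l _; exact: w0.
have -> : S = [set w : 'rV[R]_m | forall i, 0 <= w ord0 i] `&`
              [set w : 'rV[R]_m | \sum_i w ord0 i = 1] by [].
apply: closedI.
  have -> : [set w : 'rV[R]_m | forall i, 0 <= w ord0 i] =
      \bigcap_(i : 'I_m) ((fun w : 'rV[R]_m => w ord0 i) @^-1` [set x | 0 <= x]).
    by apply/seteqP; split => w H i //; have := H i; exact.
  apply: closed_bigI => i _; apply: closed_comp; last exact: closed_ge.
  by move=> w _; exact: coord_continuous.
apply: (@closed_comp _ _ (fun w : 'rV[R]_m => \sum_i w ord0 i) [set 1]).
  move=> w _; apply: continuous_sumr => i; exact: coord_continuous.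
exact: closed_eq.
Qed.

Lemma polytope_measurable Q : convex_polytope Q -> measurable Q.
Proof.
move=> /polytope_compact cQ; apply: closed_measurable_rV.
by apply: compact_closed cQ; exact: norm_hausdorff.
Qed.

Import ArrowAsProduct.

(** By Tychonoff, [P] has a cluster point along the filter of times of B tending to infinity. B is a
    parameter so that the limit point can be taken along times at which convergence fails. *)
Lemma trajectory_limit_point (N : nat) Q (P : R -> 'I_N -> 'rV[R]_d) (B : set R) :
  compact Q -> (forall t, 0 <= t -> forall i, Q (P t i)) ->
  (forall T, exists2 t, T <= t & B t) ->
  exists2 X : 'I_N -> 'rV[R]_d, (forall i, Q (X i)) &
    forall D T, 0 < D -> exists t, [/\ T <= t, B t & forall i, enorm (P t i - X i) < D].
Proof.
move=> cQ PQ Bunb.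
pose G := within B (+oo : set_system R).
have GP : ProperFilter G.
  apply: Build_ProperFilter => -[M [_ HM]].
  have [t Mt Bt] := Bunb (M + 1); apply: (HM t) => //; lra.
have cK := @tychonoff 'I_N (fun=> 'rV[R]_d) (fun=> Q) (fun=> cQ).
have : (P @ G) [set f : 'I_N -> 'rV[R]_d | forall i, Q (f i)].
  by apply: filterS (nbhs_pinfty_ge (num_real (0 : R))) => t t0 _ i; exact: PQ.
move=> /(cK _ _)[X [QX clX]]; exists X => // D T D0.
(* The d coordinate differences, each at most e, then sum to less than D; d + 1 also avoids a zero
   denominator. *)
pose e := D / d.+1%:R; have e0 : 0 < e by rewrite divr_gt0.
have nX : nbhs X [set f : 'I_N -> 'rV[R]_d | forall i, ball (X i) e (f i)].
  have H i : nbhs X [set f : 'I_N -> 'rV[R]_d | ball (X i) e (f i)].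
    by apply: (@proj_continuous 'I_N (fun=> 'rV[R]_d) i X); exact: nbhsx_ballx.
  exact: (@filter_forall _ _ (fun i (f : 'I_N -> 'rV[R]_d) => ball (X i) e (f i)) _ (nbhs_filter X) H).
have GT : (P @ G) [set f | exists t, [/\ T <= t, B t & f = P t]].
  by apply: filterS (nbhs_pinfty_ge (num_real T)) => t Tt Bt; exists t.
have [f [[t [Tt Bt ->]] ft]] := clX _ _ GT nX.
exists t; split => // i; rewrite enormB.
apply: le_lt_trans (enorm_le_sum _) _.
apply: (@le_lt_trans _ _ (\sum_(k < d) e)).
  apply: ler_sum => k _; rewrite !mxE.
  by have [_ /(_ ord0 k)/ltW] := ft i.
rewrite sumr_const card_ord -mulr_natr /e -mulrA -[ltRHS]mulr1 ltr_pM2l//.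
by rewrite mulrC ltr_pdivrMr// mul1r ltr_nat.
Qed.

End polytope.

(** * Null sets obtained from lines in a coordinate direction *)

Section null_sets.
Context {R : realType} {d : nat}.
Implicit Types (p q x : 'rV[R]_d) (k : 'I_d) (f g E : R -> R).

Lemma derive_isolated_zero g (x b : R) : is_derive x 1 g b -> b != 0 -> g x = 0 ->
  exists2 D, 0 < D & forall y, 0 < `|y - x| < D -> g y != 0.
Proof.
move=> [dg gb] b0 gx.
have : h^-1 *: (g (h *: 1 + x) - g x) @[h --> (0:R)^'] --> b by rewrite -gb.
move=> /cvgr_neq0/(_ b0)[D /= D0 HD]; exists D => // y /andP[y0 yD].
have := HD (y - x); rewrite /ball/= sub0r normrN => /(_ yD); rewrite -normr_gt0 => /(_ y0).
rewrite /GRing.scale/= mulr1 subrK gx subr0.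
by apply: contraNneq => ->; rewrite mulr0.
Qed.

(** A zero with nonzero derivative is isolated among all zeros, and a set of reals has only
    countably many isolated points. *)
Lemma countable_transversal_zeros g :
  countable [set x | g x = 0 /\ exists2 b, b != 0 & is_derive x 1 g b].
Proof.
set Z := [set x | _]; apply: sub_countable (countable_isolated Z).
apply: subset_card_le => x [gx [b b0 db]].
have [D D0 HD] := derive_isolated_zero db b0 gx.
apply: (@isolated_ball _ _ _ D) => //; first by split => //; exists b.
by move=> y [gy _] /HD; rewrite gy eqxx.
Qed.

Definition off_coord p q k := \sum_(j | j != k) (p ord0 j - q ord0 j) ^+ 2.

Lemma off_coord_ge0 p q k : 0 <= off_coord p q k.
Proof. by apply: sumr_ge0 => j _; exact: sqr_ge0. Qed.

Lemma enorm_upd p q k (x : R) :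
  enorm (p - upd q k x) = Num.sqrt (off_coord p q k + (p ord0 k - x) ^+ 2).
Proof.
rewrite /enorm (bigD1 k)//= addrC !mxE eqxx; congr (Num.sqrt (_ + _)).
by apply: eq_bigr => j jk; rewrite !mxE (negbTE jk).
Qed.

Lemma is_derive_comp_enorm f E p q k (x : R) :
  (forall r : R, is_derive r 1 f (E r)) -> enorm (p - upd q k x) != 0 ->
  is_derive x 1 (fun y => f (enorm (p - upd q k y)))
    (- ((p - upd q k x) ord0 k * E (enorm (p - upd q k x)) / enorm (p - upd q k x))).
Proof.
move=> df r0; set r := enorm _ in r0 *.
pose h := fun y : R => off_coord p q k + (p ord0 k - y) ^+ 2.
have hx : 0 < h x.
  rewrite -sqrtr_gt0 -enorm_upd -/r lt_neqAle enorm_ge0 andbT eq_sym//.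
have dh : is_derive x 1 h (- (2 * (p ord0 k - x))).
  rewrite (_ : h = cst (off_coord p q k) + (cst (p ord0 k) - id) ^+ 2); last first.
    by apply/funext => y; rewrite /h !fctE.
  apply: is_derive_eq; rewrite !fctE /GRing.scale/=; ring.
have ds : is_derive x 1 (Num.sqrt \o h) ((2 * r)^-1 * - (2 * (p ord0 k - x))).
  by rewrite /r enorm_upd; apply: is_derive1_comp; exact: is_derive1_sqrt.
have -> : (fun y => f (enorm (p - upd q k y))) = f \o (Num.sqrt \o h).
  by apply/funext => y /=; rewrite enorm_upd.
have -> : - ((p - upd q k x) ord0 k * E r / r) = E r * ((2 * r)^-1 * - (2 * (p ord0 k - x))).
  by rewrite !mxE eqxx; field; exact: r0.
apply: is_derive1_comp ds.
by rewrite /= -enorm_upd; exact: df.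
Qed.

(** A line in direction k meets each sphere about p in at most two points, whose coordinates are the
    values of [g1] and [g2] at the radius. *)
Lemma null_sphere p k (S : set R) : countable S ->
  (lebesgue_rV R d).-negligible [set q | S (enorm (p - q))].
Proof.
move=> cS; have mS : measurable [set q | S (enorm (p - q))].
  have := @measurable_enorm R d setT p measurableT S (countable_measurable (@measurable_set1 R) cS).
  by rewrite setTI.
apply/negligibleP => //; apply: (@null_lines _ _ _ k) => // q.
pose c := off_coord p q k.
pose g1 (r : R) := p ord0 k - Num.sqrt (r ^+ 2 - c).
pose g2 (r : R) := p ord0 k + Num.sqrt (r ^+ 2 - c).
apply: (@sub_countable _ _ _ (g1 @` S `|` g2 @` S)).
  apply: subset_card_le => x /= Sx.
  have sE : Num.sqrt (enorm (p - upd q k x) ^+ 2 - c) = `|p ord0 k - x|.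
    rewrite enorm_upd sqr_sqrtr ?addr_ge0 ?off_coord_ge0 ?sqr_ge0//.
    by rewrite addrAC subrr add0r sqrtr_sqr.
  have [H|H] := leP 0 (p ord0 k - x).
    left; exists (enorm (p - upd q k x)) => //.
    by rewrite /g1 sE ger0_norm//; ring.
  right; exists (enorm (p - upd q k x)) => //.
  by rewrite /g2 sE ltr0_norm//; ring.
rewrite -bigcup2E; apply: bigcup_countable => // -[|[|n]] _ //=;
  exact: card_le_trans (card_image_le _ _) cS.
Qed.

(** Along a line in direction k, a tie point at which the two partial derivatives differ is a
    transversal zero of the difference [u], so there are countably many of them. *)
Lemma ae_equal_slopes f g E F p p' k :
  (forall r : R, is_derive r 1 f (E r)) -> (forall r : R, is_derive r 1 g (F r)) ->
  continuous E -> continuous F ->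
  {ae lebesgue_rV R d, forall q, f (enorm (p - q)) = g (enorm (p' - q)) ->
    enorm (p - q) != 0 -> enorm (p' - q) != 0 ->
    (p - q) ord0 k * E (enorm (p - q)) / enorm (p - q) =
    (p' - q) ord0 k * F (enorm (p' - q)) / enorm (p' - q)}.
Proof.
move=> df dg cE cF.
have cf : continuous f by move=> r; exact: is_derive_continuous (df r).
have cg : continuous g by move=> r; exact: is_derive_continuous (dg r).
pose u q := f (enorm (p - q)) - g (enorm (p' - q)).
(* The difference of the partial derivatives, cleared of denominators; [w] is nonzero away from the
   two sensors. *)
pose v (q : 'rV[R]_d) := (p - q) ord0 k * E (enorm (p - q)) * enorm (p' - q)
  - (p' - q) ord0 k * F (enorm (p' - q)) * enorm (p - q).
pose w (q : 'rV[R]_d) := enorm (p - q) * enorm (p' - q).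
have mu : measurable_fun setT u.
  by apply: measurable_funB; exact: measurable_comp_enorm.
have mv : measurable_fun setT v.
  apply: measurable_funB; apply: measurable_funM; try exact: measurable_enorm;
    by apply: measurable_funM; [exact: measurable_coordB|exact: measurable_comp_enorm].
have mw : measurable_fun setT w.
  by apply: measurable_funM; exact: measurable_enorm.
pose A := u @^-1` [set 0] `&` (v @^-1` (~` [set 0]) `&` w @^-1` (~` [set 0])).
have mA : measurable A.
  have m0 : measurable ([set 0] : set R) by exact: measurable_set1.
  have m1 : measurable (~` [set 0] : set R) by exact: measurableC.
  apply: measurableI; first by have := mu measurableT _ m0; rewrite setTI.
  apply: measurableI; first by have := mv measurableT _ m1; rewrite setTI.
  by have := mw measurableT _ m1; rewrite setTI.
have nA : (lebesgue_rV R d).-negligible A.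
  apply/negligibleP => //; apply: (@null_lines _ _ _ k) => // q.
  have cz := countable_transversal_zeros (fun x : R => u (upd q k x)).
  apply: (sub_countable _ cz); apply: subset_card_le => x [/= ux [vx wx]]; split => //.
  have [r0 r0'] : enorm (p - upd q k x) != 0 /\ enorm (p' - upd q k x) != 0.
    by split; apply/eqP => r0; apply: wx; rewrite /w r0 ?mul0r ?mulr0.
  exists (- ((p - upd q k x) ord0 k * E (enorm (p - upd q k x)) / enorm (p - upd q k x))
     - - ((p' - upd q k x) ord0 k * F (enorm (p' - upd q k x)) / enorm (p' - upd q k x))).
    apply: contra_not_neq vx => /eqP; rewrite opprK addrC subr_eq0 eqr_div// => /eqP H.
    by rewrite /v -H subrr.
  by apply: is_deriveB; exact: is_derive_comp_enorm.
apply: negligible_ae nA _ => q Aq uq r0 r0'.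
apply: contrapT => vq; apply: Aq; split.
  by rewrite /= /u uq subrr.
split; last by apply/eqP; rewrite mulf_neq0.
move=> /= /eqP; rewrite subr_eq0 => H; apply: vq.
by apply/eqP; rewrite eqr_div.
Qed.

End null_sets.

(** * Node functions and generic points *)

(** Everything the rest of the proof retains from analyticity. Here [f] is the extended family, with
    true derivative [E] on the whole line. *)
Record node_family (R : realType) (N : nat) (f E : 'I_N -> R -> R) : Prop := {
  node_derive : forall i (r : R), is_derive r 1 (f i) (E i r);
  node_slope_continuous : forall i, continuous (E i);
  node_decreasing : forall i, strictly_decreasing_on_nneg (f i);
  node_slope_zeros : forall i, countable [set r | 0 <= r /\ E i r = 0];
  node_coincidence : forall i j c, 0 <= c ->
    (forall x, 0 <= x -> f i x = f j (x + c)) \/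
    countable [set x | 0 <= x /\ f i x = f j (x + c)];
  node_slope_at0 : forall i, exists C e, 0 < e /\
    forall r, 0 <= r < e -> `|E i r - E i 0| <= C * r }.

Section node_functions.
Context {R : realType} {d N : nat} (f E : 'I_N -> R -> R).
Hypothesis nf : node_family f E.
Implicit Types (Y X : 'I_N -> 'rV[R]_d) (p q : 'rV[R]_d) (i j l : 'I_N) (r s x : R).

Lemma node_continuous i : continuous (f i).
Proof. by move=> r; exact: is_derive_continuous (node_derive nf i r). Qed.

Lemma node_le i r s : 0 <= r -> r <= s -> f i s <= f i r.
Proof.
move=> r0; rewrite le_eqVlt => /orP[/eqP->//|rs].
exact/ltW/(node_decreasing nf i r0 rs).
Qed.

Lemma node_inj i r s : 0 <= r -> 0 <= s -> f i r = f i s -> r = s.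
Proof.
move=> r0 s0 frs; have [rs|sr|//] := ltgtP r s.
  by have := node_decreasing nf i r0 rs; rewrite frs ltxx.
by have := node_decreasing nf i s0 sr; rewrite frs ltxx.
Qed.

Lemma node_slope_le0 i r : 0 < r -> E i r <= 0.
Proof.
move=> r0; have dr := node_derive nf i r.
have <- : (f i)^`()%classic r = E i r by rewrite derive1E derive_val.
apply: (@decr_derive1_le0_itvy _ _ true 0).
- by move=> x _; case: (node_derive nf i x).
- move=> x y; rewrite !in_itv/= !andbT => x0 y0 xy.
  exact: (node_decreasing nf i y0 xy).
- by rewrite in_itv/= andbT.
Qed.

Lemma is_derive_comp_sqrt i r : 0 < r ->
  is_derive (r ^+ 2) 1 (fun s => f i (Num.sqrt s)) (E i r / (2 * r)).
Proof.
move=> r0; have rE : Num.sqrt (r ^+ 2) = r by rewrite sqrtr_sqr gtr0_norm.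
have r20 : 0 < r ^+ 2 by rewrite exprn_gt0.
have ds := is_derive1_sqrt r20; rewrite rE in ds.
by apply: is_derive1_comp => //; rewrite rE; exact: (node_derive nf).
Qed.

(** At r = 0 both sides are 0: the right one because the inverse of 0 is 0; the left one because the
    square root of a negative number is 0, so the left difference quotients vanish, and because a
    divergent limit has the default value 0. *)
Lemma derive1_comp_sqrt i r : 0 <= r ->
  derive1 (fun s => f i (Num.sqrt s)) (r ^+ 2) = E i r / (2 * r).
Proof.
rewrite le_eqVlt => /orP[/eqP<-|r0].
  rewrite mulr0 invr0 mulr0 expr0n/=.
  have [cv|ncv] := pselect (cvg (h^-1 *: (f i (Num.sqrt (h + 0)) - f i (Num.sqrt 0)) @[h --> (0:R)^'])); last first.
    by rewrite /derive1 dvgP.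
  apply: (@cvg_unique _ (@norm_hausdorff _ R) (h^-1 *: (f i (Num.sqrt (h + 0)) - f i (Num.sqrt 0)) @[h --> (0:R)^'-])).
    have sub : (0:R)^'- `=>` (0:R)^'.
      by move=> A; rewrite /at_left /dnbhs /within/=; apply: filterS => h H /lt_eqF/negbT; exact: H.
    by apply: cvg_trans (cvg_app _ sub) _; exact: cv.
  apply: cvg_near_cst; near=> h; have h0 : h < 0 by near: h; exact: nbhs_left_lt.
  by rewrite addr0 sqrtr0 ler0_sqrtr ?(ltW h0)// subrr scaler0.
by rewrite derive1E -[RHS](@derive_val _ _ _ _ _ _ _ (is_derive_comp_sqrt i r0)).
Unshelve. all: by end_near. Qed.

Lemma perceived_densityE phi i p q :
  perceived_density phi (f i) p q = - (phi q * E i (enorm (p - q)) / enorm (p - q)).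
Proof.
rewrite /perceived_density derive1_comp_sqrt ?enorm_ge0// invfM.
by move: (enorm (p - q))^-1 => u; field.
Qed.

(** The k-th partial derivative of [f i (enorm (p - q))] with respect to p, away from p = q. *)
Definition radial_slope i (k : 'I_d) p q :=
  (p - q) ord0 k * E i (enorm (p - q)) / enorm (p - q).

(* Up to null sets, two sensors tie only if one of them is [below] the other. *)
Definition below Y i j := exists2 r, enorm (Y i - Y j) <= r &
  forall x, 0 <= x -> f i x = f j (x + r).

Lemma below_refl Y i : below Y i i.
Proof.
by exists 0; [rewrite subrr enorm0|move=> x; rewrite addr0].
Qed.

Lemma below_trans Y i j l : below Y i j -> below Y j l -> below Y i l.
Proof.
move=> [r dr fr] [s ds fs]; exists (r + s).
  by apply: le_trans (enorm_triangle _ (Y j) _) _; exact: lerD.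
have r0 : 0 <= r by exact: le_trans (enorm_ge0 _) dr.
by move=> x x0; rewrite fr// fs ?addr_ge0// addrA.
Qed.

Lemma below_le Y i j q : below Y i j ->
  f i (enorm (Y i - q)) <= f j (enorm (Y j - q)).
Proof.
move=> [r dr fr]; rewrite fr ?enorm_ge0//; apply: node_le; first exact: enorm_ge0.
apply: le_trans (enorm_triangle _ (Y i) _) _.
by rewrite addrC lerD2l enormB.
Qed.

Lemma below_antisym Y i j : below Y i j -> below Y j i ->
  Y i = Y j /\ forall x, 0 <= x -> f i x = f j x.
Proof.
move=> [r dr fr] [s ds fs].
have r0 : 0 <= r by exact: le_trans (enorm_ge0 _) dr.
have s0 : 0 <= s by exact: le_trans (enorm_ge0 _) ds.
have : 0 = 0 + r + s.
  by apply: (@node_inj i) => //; rewrite ?addr_ge0// -fs ?addr_ge0// -fr.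
rewrite add0r => rs; have [rE sE] : r = 0 /\ s = 0 by split; lra.
split; last by move=> x x0; rewrite fr// rE addr0.
apply/eqP; rewrite -subr_eq0; apply/eqP/enorm_eq0/le_anti.
by rewrite enorm_ge0 -rE dr.
Qed.

Definition maximal Y i := forall j, below Y i j -> below Y j i.

(** Among the sensors above i, one with the largest value at distance 0 is maximal: lying below
    another one with shift r > 0 would make that value strictly smaller. *)
Lemma exists_maximal Y i : exists2 j, below Y i j & maximal Y j.
Proof.
have bii : (fun j => `[< below Y i j >]) i by apply/asboolP; exact: below_refl.
case: (@Order.TotalTheory.arg_maxP _ _ _ i (fun j => `[< below Y i j >]) (fun j => f j 0) bii).
move=> j /asboolP bij jmax; exists j => // l bjl.
have /= fl := jmax l (introT (asboolP _) (below_trans bij bjl)).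
have [r dr fr] := bjl; have r0 : 0 <= r by exact: le_trans (enorm_ge0 _) dr.
have := fr 0 (lexx 0); rewrite add0r => fj0.
have rE : r = 0.
  apply/eqP; rewrite eq_le r0 andbT leNgt; apply/negP => rgt.
  by have := node_decreasing nf l (lexx 0) rgt; rewrite -fj0 ltNge fl.
exists 0; first by rewrite -enormB -rE.
by move=> x x0; rewrite addr0 fr// rE addr0.
Qed.

Definition generic Y q :=
  (forall i, enorm (Y i - q) != 0) /\
  forall i j, f i (enorm (Y i - q)) = f j (enorm (Y j - q)) ->
    (below Y i j \/ below Y j i) /\
    forall k, radial_slope i k (Y i) q = radial_slope j k (Y j) q.

(** As both slopes are negative, equal gradients make p - q a positive multiple of p' - q: seen from
    q, the two sensors lie on one ray. *)
Lemma overlap_colinear i j p p' q :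
  enorm (p - q) != 0 -> enorm (p' - q) != 0 ->
  E i (enorm (p - q)) != 0 -> E j (enorm (p' - q)) != 0 ->
  (forall k, radial_slope i k p q = radial_slope j k p' q) ->
  enorm (p' - q) = enorm (p - q) + enorm (p - p') \/
  enorm (p - q) = enorm (p' - q) + enorm (p - p').
Proof.
move=> r0 r0' E0 E0' H.
pose a := E i (enorm (p - q)) / enorm (p - q).
pose b := E j (enorm (p' - q)) / enorm (p' - q).
have rp : 0 < enorm (p - q) by rewrite lt_neqAle eq_sym r0 enorm_ge0.
have rp' : 0 < enorm (p' - q) by rewrite lt_neqAle eq_sym r0' enorm_ge0.
have a0 : a < 0.
  by rewrite /a pmulr_llt0 ?invr_gt0// lt_neqAle E0 node_slope_le0.
have b0 : b < 0.
  by rewrite /b pmulr_llt0 ?invr_gt0// lt_neqAle E0' node_slope_le0.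
pose t := b / a; have t0 : 0 < t by rewrite /t nmulr_rgt0// invr_lt0.
have pq : p - q = t *: (p' - q).
  apply/rowP => k; have := H k; rewrite /radial_slope -mulrA -/a -mulrA -/b => Hk.
  rewrite [RHS]mxE /t.
  have -> : (p - q) ord0 k = (p - q) ord0 k * a / a by rewrite mulfK// lt_eqF.
  by rewrite Hk; field; rewrite lt_eqF.
have rE : enorm (p - q) = t * enorm (p' - q) by rewrite pq enormZ gtr0_norm.
have dE : enorm (p - p') = `|t - 1| * enorm (p' - q).
  by rewrite -enormZ scalerBl scale1r -pq opprB addrA subrK.
rewrite rE dE; have [t1|t1] := leP 1 t.
  by right; rewrite ger0_norm ?subr_ge0//; ring.
by left; rewrite ltr0_norm ?subr_lt0//; ring.
Qed.

(** Collinearity turns a tie into f_i(x) = f_j(x + |Y_i - Y_j|) at the distance x from q to the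
    nearer sensor i. Unless this holds identically, such x are countable and the corresponding
    spheres null; so are the spheres on which a slope vanishes. *)
Lemma generic_ae (k0 : 'I_d) Y : {ae lebesgue_rV R d, forall q, generic Y q}.
Proof.
have spherical i (S : set R) : countable S ->
    {ae lebesgue_rV R d, forall q, ~ S (enorm (Y i - q))}.
  move=> cS; apply: negligibleS (null_sphere (Y i) k0 cS) => q /=.
  exact: contrapT.
have H0 i : {ae lebesgue_rV R d, forall q, enorm (Y i - q) != 0}.
  by apply: filterS (spherical i [set 0] (countable1 _)) => q /eqP.
have HE i : {ae lebesgue_rV R d, forall q, E i (enorm (Y i - q)) != 0}.
  apply: filterS (spherical i _ (node_slope_zeros nf i)) => q H.
  by apply/eqP => E0; apply: H; split; rewrite ?enorm_ge0.
have HS i j k := ae_equal_slopes (Y i) (Y j) k (node_derive nf i) (node_derive nf j)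
  (@node_slope_continuous _ _ _ _ nf i) (@node_slope_continuous _ _ _ _ nf j).
have HC i j : {ae lebesgue_rV R d, forall q,
    f i (enorm (Y i - q)) = f j (enorm (Y i - q) + enorm (Y i - Y j)) -> below Y i j}.
  have [fij|cij] := node_coincidence nf i j (enorm_ge0 (Y i - Y j)).
    by apply: aeW => q _; exists (enorm (Y i - Y j)).
  apply: filterS (spherical i _ cij) => q H fq; exfalso; apply: H.
  by split; rewrite ?enorm_ge0.
have H1 : {ae lebesgue_rV R d, forall q, forall i, enorm (Y i - q) != 0}.
  exact: filter_forall.
have H2 : {ae lebesgue_rV R d, forall q, forall i, E i (enorm (Y i - q)) != 0}.
  exact: filter_forall.
have H3 : {ae lebesgue_rV R d, forall q, forall i j k,
   f i (enorm (Y i - q)) = f j (enorm (Y j - q)) ->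
    enorm (Y i - q) != 0 -> enorm (Y j - q) != 0 ->
    radial_slope i k (Y i) q = radial_slope j k (Y j) q}.
  apply: filter_forall => i; apply: filter_forall => j; apply: filter_forall => k.
  exact: HS.
have H4 : {ae lebesgue_rV R d, forall q, forall i j,
    f i (enorm (Y i - q)) = f j (enorm (Y i - q) + enorm (Y i - Y j)) -> below Y i j}.
  by apply: filter_forall => i; apply: filter_forall => j; exact: HC.
apply: filterS2 (filterI H1 H2) (filterI H3 H4) => q [h1 h2] [h3 h4].
split => // i j fij.
have sl k : radial_slope i k (Y i) q = radial_slope j k (Y j) q by exact: h3.
split => //; have [H|H] := overlap_colinear (h1 i) (h1 j) (h2 i) (h2 j) sl.
  by left; apply: h4; rewrite -H.
by right; apply: h4; rewrite (enormB (Y j) (Y i)) -H.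
Qed.

End node_functions.

(** * Densities on the line *)

Section line.
Context {R : realType}.
Implicit Types (p q : 'rV[R]_1).

(* [w p q] plays the role of [phi q / |p - q|], which is not integrable near [p] in
   dimension one unless [phi] is small there: the integral of [phi] over
   [`]p, p + h]] is [o(h)] for every [p], so that the distribution function [Phi] of
   [phi] has zero right derivative everywhere. *)
Lemma density_null_line (Q : set 'rV[R]_1) (phi : 'rV[R]_1 -> R)
    (w : 'rV[R]_1 -> 'rV[R]_1 -> R) (L : R) :
  closed Q -> (forall q k, Q q -> `|q ord0 k| <= L) ->
  (forall q, Q q -> 0 <= phi q <= 1) -> measurable_fun Q phi ->
  (forall p, Q p -> (lebesgue_rV R 1).-integrable Q (EFin \o w p)) ->
  (forall p q, Q p -> Q q -> 0 <= w p q) ->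
  (forall p, Q p -> exists c e, [/\ 0 <= c, 0 < e & forall q, Q q ->
     0 < `|p ord0 ord0 - q ord0 ord0| < e ->
     phi q <= c * `|p ord0 ord0 - q ord0 ord0| * w p q]) ->
  \int[lebesgue_rV R 1]_(q in Q) phi q = 0.
Proof.
move=> clQ QL phi01 mphi iw w0 wphi.
pose mu := lebesgue_rV R 1.
have mQ : measurable Q by exact: closed_measurable_rV.
have Qfin : (mu Q < +oo)%E by exact: bounded_rV_lt_pinfty QL mQ.
have I0 (g : 'rV[R]_1 -> R) : (forall q, Q q -> g q = 0) -> \int[mu]_(q in Q) g q = 0.
  move=> g0; rewrite (@eq_Rintegral _ _ _ mu Q (cst 0)) ?Rintegral_cst ?mul0r//.
  by move=> q /set_mem; exact: g0.
pose S (x y : R) : set 'rV[R]_1 := [set q | `]x, y]%classic (q ord0 ord0)].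
have mS x y : measurable (S x y).
  by apply: measurable_coord_preimage; exact: measurable_itv.
have m1 x y : measurable_fun Q (\1_(S x y) : 'rV[R]_1 -> R) by exact: measurable_indic.
have i01 x y q : 0 <= (\1_(S x y) q : R) <= 1 by rewrite indicE; case: (_ \in _); rewrite ?lexx ?ler01.
have SE x y q : (\1_(S x y) q : R) = (x < q ord0 ord0 <= y)%R%:R.
  rewrite indicE; congr (_%:R); apply: congr1; apply/idP/idP => [/set_mem|H].
    by rewrite /S /= in_itv.
  by apply/mem_set; rewrite /S /= in_itv.
(* Strictly to the left of Q, so that [Phi] starts from 0 and the strips, open on the left, miss no
   point of Q. *)
pose a0 := - (`|L| + 1).
have Qa0 q : Q q -> a0 < q ord0 ord0.
  move=> /(QL q ord0); rewrite ler_norml => /andP[H _]; rewrite /a0.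
  by have := ler_norm L; lra.
have Qb0 q : Q q -> q ord0 ord0 <= `|L| + 1.
  move=> /(QL q ord0); rewrite ler_norml => /andP[_ H].
  by have := ler_norm L; lra.
pose u x y q := phi q * \1_(S x y) q.
have mu_ x y : measurable_fun Q (u x y) by exact: measurable_funM.
have u01 x y q : Q q -> 0 <= u x y q <= 1.
  move=> Qq; have /andP[p0 p1] := phi01 q Qq; have /andP[s0 s1] := i01 x y q.
  by rewrite /u mulr_ge0//= -[leRHS]mulr1 ler_pM.
have ub x y q : Q q -> `|u x y q| <= 1.
  by move=> /(u01 x y)/andP[? ?]; rewrite ger0_norm.
have iu x y : mu.-integrable Q (EFin \o u x y).
  by apply: (@le_const_integrable _ _ _ _ _ _ 1) => // q; exact: ub.
pose Phi x := \int[mu]_(q in Q) u a0 x q.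
have PhiB x y : x <= y -> Phi y = Phi x + \int[mu]_(q in Q) u x y q.
  move=> xy; rewrite /Phi -RintegralD//; apply: eq_Rintegral => q /set_mem Qq.
  rewrite /u -mulrDr !SE Qa0//=; congr (_ * _).
  have [qx|qx] := leP (q ord0 ord0) x; last by rewrite add0r.
  by rewrite (le_trans qx xy) addr0.
have ule x y : x <= y -> 0 <= \int[mu]_(q in Q) u x y q <= y - x.
  move=> xy; apply/andP; split.
    by apply: Rintegral_ge0 => q /(u01 x y)/andP[].
  pose B : set 'rV[R]_1 := [set q | forall k, `|q ord0 k - (x + y) / 2| <= (y - x) / 2].
  have mB : measurable B.
    have -> : B = \bigcap_(k : 'I_1) [set q | `|q ord0 k - (x + y) / 2| <= (y - x) / 2].
      by apply/seteqP; split => q H k //; have := H k; exact.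
    by apply: fin_bigcap_measurable => // k _; exact: measurable_coord_ball.
  rewrite -lee_fin /Rintegral fineK; last by have := integrable_fin_num mQ (iu x y).
  apply: (@le_trans _ _ (\int[mu]_(q in Q) (\1_B q)%:E)%E).
    apply: ge0_le_integral => //.
    - by move=> q /(u01 x y)/andP[]; rewrite lee_fin.
    - exact/measurable_EFinP.
    - by apply/measurable_EFinP; exact: measurable_indic.
    move=> q Qq; rewrite lee_fin /u [\1_(S x y) q]indicE.
    have /andP[p0 p1] := phi01 q Qq.
    have [Sq|Sq] := boolP (q \in S x y); last by rewrite mulr0 indicE ler0n.
    rewrite mulr1 indicE mem_set//= => k; rewrite (ord1 k).
    by move: Sq => /set_mem; rewrite /S /= in_itv/= => /andP[H1 H2]; rewrite ler_norml; lra.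
  rewrite integral_indic//.
  apply: (@le_trans _ _ (mu B)); first by apply: le_measure; rewrite ?inE//; exact: measurableI.
  have rho0 (k : 'I_1) : 0 <= (y - x) / 2 by rewrite divr_ge0 ?subr_ge0.
  rewrite /mu (@lebesgue_rV_box R 1 (fun=> (x + y) / 2) (fun=> (y - x) / 2))// big_ord1 lee_fin.
  by rewrite mulrC divfK.
have cPhi : continuous Phi.
  move=> x; apply/cvgrPdist_lt => e e0; apply/nbhs_ballP; exists e => // y; rewrite /ball/=.
  apply: le_lt_trans; have [xy|/ltW yx] := leP x y.
    have /andP[H0 H1] := ule x y xy.
    by rewrite (PhiB x y)// opprD addNKr normrN ger0_norm// distrC ger0_norm// subr_ge0.
  have /andP[H0 H1] := ule y x yx.
  by rewrite (PhiB y x)// addrAC subrr add0r !ger0_norm// subr_ge0.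
(* If t is outside the closed set Q, a short strip misses Q. Otherwise [phi] is at most c h times
   [w] on the strip of width h, and the integral of [w] over the shrinking strips tends to 0,
   because they exclude t. *)
have dini (eta t e : R) : 0 < eta -> 0 < e ->
    exists2 h, 0 < h < e & \int[mu]_(q in Q) u t (t + h) q <= eta * h.
  move=> eta0 e0; pose p : 'rV[R]_1 := const_mx t.
  have pt : p ord0 ord0 = t by rewrite mxE.
  have [Qp|nQp] := pselect (Q p); last first.
    have : nbhs p (~` Q).
      by have := closed_openC clQ; rewrite openE => /(_ p nQp).
    move=> /nbhs_ballP[r /= r0 rQ].
    pose h := Num.min e r / 2.
    have m0 : 0 < Num.min e r by rewrite lt_min e0.
    have [me mr] : Num.min e r <= e /\ Num.min e r <= r by rewrite !ge_min !lexx orbT.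
    exists h; first by rewrite /h; apply/andP; split; lra.
    rewrite (_ : \int[mu]_(q in Q) _ = 0); first by rewrite mulr_ge0 ?ltW// /h divr_gt0.
    apply: I0 => q Qq; rewrite /u indicE memNset ?mulr0//.
    rewrite /S /= in_itv/= => /andP[H1 H2]; apply: (rQ q) => //.
    split => // i k; rewrite !ord1 /ball/= pt ltr_norml.
    by move: H1 H2; rewrite /h => H1 H2; apply/andP; split; lra.
  have [c [r [c0 r0 Hc]]] := wphi p Qp.
  pose hn n : R := n.+1%:R^-1.
  have hn0 n : 0 < hn n by rewrite invr_gt0 ltr0n.
  pose v n q := w p q * \1_(S t (t + hn n)) q.
  have mw : measurable_fun Q (w p) by apply/measurable_EFinP; exact: measurable_int (iw p Qp).
  have mv n : measurable_fun Q (v n) by exact: measurable_funM.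
  have v0 n q : Q q -> 0 <= v n q.
    by move=> Qq; rewrite /v mulr_ge0 ?w0//; have /andP[] := i01 t (t + hn n) q.
  have vw n q : Q q -> `|v n q| <= w p q.
    by move=> Qq; rewrite ger0_norm ?v0// /v -[leRHS]mulr1 ler_wpM2l ?w0//; have /andP[] := i01 t (t + hn n) q.
  have iv n : mu.-integrable Q (EFin \o v n).
    apply: le_integrable (iw p Qp) => //; first exact/measurable_EFinP.
    by move=> q Qq /=; rewrite lee_fin (ger0_norm (w0 p q Qp Qq)); exact: vw.
  have hncv : hn n @[n --> \oo] --> 0 by exact: cvg_harmonic.
  have : \int[mu]_(q in Q) v n q @[n --> \oo] --> \int[mu]_(q in Q) (cst 0 q).
    apply: (@Rintegral_dominated_cvg _ _ _ _ _ v (cst 0) (w p)) => //; first exact: iw.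
    apply: aeW => q Qq; apply: cvg_near_cst.
    have [qt|qt] := leP (q ord0 ord0) t.
      apply: nearW => n; rewrite /v indicE memNset ?mulr0// /S /= in_itv/= => /andP[].
      by rewrite ltNge qt.
    have qt0 : 0 < q ord0 ord0 - t by rewrite subr_gt0.
    have := hncv => /cvgrPdist_lt/(_ _ qt0); apply: filterS => n.
    rewrite sub0r normrN gtr0_norm// => hq.
    rewrite /v indicE memNset ?mulr0// /S /= in_itv/= => /andP[_].
    by lra.
  have -> : \int[mu]_(q in Q) (cst 0 q) = 0 :> R by rewrite Rintegral_cst// mul0r.
  (* The denominator c + 1 makes c times the integral of [v n] at most eta, even when c = 0. *)
  have c10 : 0 < eta / (c + 1) by rewrite divr_gt0// ltr_wpDl.
  move=> /cvgrPdist_lt/(_ _ c10) => vcv.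
  have m0 : 0 < Num.min e r by rewrite lt_min e0.
  have [n [vn hnm]] : exists n, `|0 - \int[mu]_(q in Q) v n q| < eta / (c + 1)
      /\ hn n < Num.min e r.
    have /cvgrPdist_lt/(_ _ m0) hcv := hncv.
    have [n _ /(_ n (leqnn n)) [H1 H2]] := filterI vcv hcv.
    by exists n; split => //; move: H2; rewrite sub0r normrN gtr0_norm.
  move: hnm; rewrite lt_min => /andP[he hr].
  exists (hn n); first by rewrite hn0.
  apply: (@le_trans _ _ (\int[mu]_(q in Q) (c * hn n * v n q))).
    apply: le_Rintegral => //.
      rewrite (_ : _ \o _ = (fun q => (c * hn n)%:E * (v n q)%:E)%E).
        by apply: integrableZl => //; exact: iv.
      by apply/funext => q /=; rewrite EFinM.
    move=> q Qq; rewrite /u /v !indicE.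
    have [Sq|Sq] := boolP (q \in _); last by rewrite !mulr0.
    move: Sq => /set_mem; rewrite /S /= in_itv/= => /andP[H1 H2].
    have tq : 0 < `|p ord0 ord0 - q ord0 ord0| <= hn n.
      by rewrite pt distrC gtr0_norm ?subr_gt0//; apply/andP; split; lra.
    have /andP[tq0 tqh] := tq.
    rewrite !mulr1; apply: le_trans (Hc q Qq _) _; first by rewrite tq0 (le_lt_trans tqh).
    by rewrite ler_wpM2r ?w0// ler_wpM2l.
  rewrite RintegralZl// -mulrA mulrCA [leRHS]mulrC ler_wpM2l ?(ltW (hn0 n))//.
  move: vn; rewrite sub0r normrN ger0_norm; last by apply: Rintegral_ge0 => q; exact: v0.
  rewrite ltr_pdivlMr ?ltr_wpDl// => H.
  have : 0 <= \int[mu]_(q in Q) v n q by apply: Rintegral_ge0 => q; exact: v0.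
  by move: H; set z := Rintegral _ _ _; move=> H z0; lra.
have Phib : Phi (`|L| + 1) = \int[mu]_(q in Q) phi q.
  apply: eq_Rintegral => q /set_mem Qq; rewrite /u indicE mem_set ?mulr1// /S /=.
  by rewrite in_itv/= Qa0// Qb0.
have Phia : Phi a0 = 0.
  apply: I0 => q _; rewrite /u indicE memNset ?mulr0// /S /= in_itv/=.
  by move=> /andP[H1 H2]; move: (lt_le_trans H1 H2); rewrite ltxx.
have ab : a0 <= `|L| + 1 by rewrite /a0; have := normr_ge0 L => ?; lra.
apply/le_anti; rewrite Rintegral_ge0 ?andbT; last by move=> q /phi01/andP[].
apply/ler_addgt0Pr => e e0; rewrite add0r -Phib.
(* An upper bound on [Phi] is a lower bound on its opposite: with slope - eta, the total growth over
   the interval is at most e. *)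
pose eta := e / (`|L| + 1 - a0 + 1).
have den0 : 0 < `|L| + 1 - a0 + 1 by rewrite ltr_wpDl// subr_ge0.
have eta0 : 0 < eta by rewrite divr_gt0.
have := @dini_growth R (fun x => - Phi x) a0 (`|L| + 1) (- eta) _ ab.
rewrite Phia oppr0 add0r mulNr lerN2 => H.
apply: le_trans (H _ _) _.
- by move=> x; apply: continuousN; exact: cPhi.
- move=> t _ _ e1 e10; have [h /andP[h0 he] Hh] := dini eta t e1 eta0 e10.
  exists h; rewrite ?h0// mulNr -opprD lerN2 (PhiB t (t + h)); last by rewrite lerDl ltW.
  by rewrite lerD2l.
by rewrite /eta mulrAC -mulrA ler_piMr ?(ltW e0)// ler_pdivrMr// mul1r lerDl.
Qed.

Lemma density_null_low_dim d (k0 : 'I_d) (Q : set 'rV[R]_d) (phi : 'rV[R]_d -> R)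
    (w : 'rV[R]_d -> 'rV[R]_d -> R) (L : R) : (d <= 1)%N ->
  closed Q -> (forall (q : 'rV[R]_d) k, Q q -> `|q ord0 k| <= L) ->
  (forall q : 'rV[R]_d, Q q -> 0 <= phi q <= 1) -> measurable_fun Q phi ->
  (forall p : 'rV[R]_d, Q p -> (lebesgue_rV R d).-integrable Q (EFin \o w p)) ->
  (forall p q : 'rV[R]_d, Q p -> Q q -> 0 <= w p q) ->
  (forall p : 'rV[R]_d, Q p -> exists c e, [/\ 0 <= c, 0 < e & forall q : 'rV[R]_d, Q q ->
     0 < enorm (p - q) < e -> phi q <= c * enorm (p - q) * w p q]) ->
  \int[lebesgue_rV R d]_(q in Q) phi q = 0.
Proof.
case: d k0 Q phi w => [[]//|[|//]] k0 Q phi w _ clQ QL phi01 mphi iw w0 wphi.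
apply: (density_null_line clQ QL phi01 mphi iw w0) => p Qp.
have [c [e [c0 e0 H]]] := wphi p Qp; exists c, e; split => // q Qq.
suff -> : `|p ord0 ord0 - q ord0 ord0| = enorm (p - q) by exact: H.
apply/le_anti; have := coord_le_enorm (p - q) ord0; rewrite !mxE => -> /=.
by have := enorm_le_sum (p - q); rewrite big_ord1 !mxE.
Qed.

End line.

(** * Masses and moments of the cells *)

Record sensing_problem (R : realType) (d N : nat) (Q : set 'rV[R]_d)
    (phi : 'rV[R]_d -> R) (f E : 'I_N -> R -> R) : Prop := {
  problem_nodes : node_family f E;
  problem_domain : convex_polytope Q;
  problem_density : forall q, Q q -> 0 <= phi q <= 1;
  problem_measurable_density : measurable_fun Q phi;
  problem_integrable : forall i p, Q p ->
    (lebesgue_rV R d).-integrable Q (EFin \o perceived_density phi (f i) p) }.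

Section sensing_domain.
Context {R : realType} {d N : nat} (Q : set 'rV[R]_d) (phi : 'rV[R]_d -> R).
Context (f E : 'I_N -> R -> R).
Hypothesis pb : sensing_problem Q phi f E.

Let nf := problem_nodes pb.
Let polyQ := problem_domain pb.
Let phi01 := problem_density pb.
Let mphi := problem_measurable_density pb.
Let fint := problem_integrable pb.
Implicit Types (Y X : 'I_N -> 'rV[R]_d) (p q : 'rV[R]_d) (i j l : 'I_N) (r s x : R).

Let mu := lebesgue_rV R d.

Lemma measurable_domain : measurable Q. Proof. exact: polytope_measurable. Qed.

Lemma domain_lt_pinfty : (mu Q < +oo)%E.
Proof. by have [L QL] := polytope_bounded polyQ; exact: bounded_rV_lt_pinfty QL measurable_domain. Qed.

Lemma diameter_bound : exists2 D, 0 < D & forall p q, Q p -> Q q -> enorm (p - q) <= D.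
Proof.
have [L QL] := polytope_bounded polyQ.
exists (\sum_(k < d) (2 * `|L|) + 1).
  by rewrite ltr_wpDl// sumr_ge0// => k _; rewrite mulr_ge0.
move=> p q Qp Qq; apply: le_trans (enorm_le_sum _) _.
rewrite -[leLHS]addr0 lerD// ler_sum// => k _; rewrite !mxE.
rewrite (le_trans (ler_normB _ _))//.
by have := QL p k Qp; have := QL q k Qq; have := ler_norm L => ? ? ?; lra.
Qed.

Lemma segment_bound (g : R -> R) D : continuous g ->
  exists K, forall r, 0 <= r <= D -> `|g r| <= K.
Proof.
move=> cg.
have : compact (g @` `[0, D]%classic).
  apply: continuous_compact; last exact: segment_compact.
  exact: continuous_subspaceT.
move=> /compact_bounded[M [_ HM]]; exists (M + 1) => r r0D.
by apply: (HM (M + 1)); [rewrite ltrDl|exists r].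
Qed.

Lemma uniform_bounds : exists D K, [/\ 0 < D, 0 < K,
  (forall p q, Q p -> Q q -> enorm (p - q) <= D),
  (forall i r, 0 <= r <= D -> `|f i r| <= K) &
  (forall i r, 0 <= r <= D -> `|E i r| <= K) /\
  (forall i r s, 0 <= r <= D -> 0 <= s <= D -> `|f i r - f i s| <= K * `|r - s|)].
Proof.
have [D D0 QD] := diameter_bound.
have [K1 HK1] := choice (fun i => segment_bound D (@node_continuous _ _ _ _ nf i)).
have [K2 HK2] := choice (fun i => segment_bound D (@node_slope_continuous _ _ _ _ nf i)).
pose K := \sum_i (`|K1 i| + `|K2 i|) + 1.
have K1K i : K1 i <= K.
  rewrite /K (bigD1 i)//= (le_trans (ler_norm _))//.
  have : 0 <= \sum_(j | j != i) (`|K1 j| + `|K2 j|) by apply: sumr_ge0 => j _; exact: addr_ge0.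
  by have := normr_ge0 (K2 i) => ? ?; lra.
have K2K i : K2 i <= K.
  rewrite /K (bigD1 i)//= (le_trans (ler_norm _))//.
  have : 0 <= \sum_(j | j != i) (`|K1 j| + `|K2 j|) by apply: sumr_ge0 => j _; exact: addr_ge0.
  by have := normr_ge0 (K1 i) => ? ?; lra.
have HE i r : 0 <= r <= D -> `|E i r| <= K by move=> /(HK2 i r)/le_trans; apply; exact: K2K.
have lip i r s : 0 <= r <= D -> 0 <= s <= D -> r < s -> `|f i s - f i r| <= K * `|s - r|.
  move=> /andP[r0 rD] /andP[s0 sD] rs.
  have [] := @MVT R (f i) (E i) r s rs.
  - by move=> x _; exact: (node_derive nf).
  - by apply: continuous_subspaceT; exact: (node_continuous nf).
  move=> c; rewrite in_itv/= => /andP[rc cs] ->; rewrite normrM ler_wpM2r//.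
  by apply: HE; apply/andP; split; lra.
exists D, K; split => //.
- by rewrite ltr_wpDl// sumr_ge0// => j _; exact: addr_ge0.
- by move=> i r /(HK1 i r)/le_trans; apply; exact: K1K.
- split => // i r s rD sD; have [rs|rs|->] := ltgtP r s.
  + by rewrite distrC (distrC r); exact: lip.
  + exact: lip.
  + by rewrite !subrr normr0 mulr0.
Qed.

(** The factor p - q cancels the singularity of the perceived density, so this is bounded; up to
    sign it is [phi] times [radial_slope]. *)
Definition moment_density i k p q := (p - q) ord0 k * perceived_density phi (f i) p q.

Lemma moment_densityE i k p q :
  moment_density i k p q = - (phi q * radial_slope E i k p q).
Proof. by rewrite /moment_density (perceived_densityE nf) /radial_slope; ring. Qed.

Lemma perceived_density_ge0 i p q : Q q -> 0 <= perceived_density phi (f i) p q.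
Proof.
move=> /phi01/andP[p0 _]; rewrite (perceived_densityE nf).
have [->|r0] := eqVneq (enorm (p - q)) 0; first by rewrite invr0 mulr0 oppr0.
have rp : 0 < enorm (p - q) by rewrite lt_neqAle eq_sym r0 enorm_ge0.
rewrite oppr_ge0 -mulrA; apply: mulr_ge0_le0 => //.
by apply: mulr_le0_ge0; [exact: (node_slope_le0 nf)|rewrite invr_ge0 ltW].
Qed.

Lemma radial_slope_le i k p q : `|radial_slope E i k p q| <= `|E i (enorm (p - q))|.
Proof.
rewrite /radial_slope; have [->|r0] := eqVneq (enorm (p - q)) 0.
  by rewrite invr0 mulr0 normr0.
have rp : 0 < enorm (p - q) by rewrite lt_neqAle eq_sym r0 enorm_ge0.
rewrite !normrM normfV (ger0_norm (enorm_ge0 _)) ler_pdivrMr// mulrC ler_wpM2l//.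
exact: coord_le_enorm.
Qed.

Lemma moment_density_le i k p q K : Q q -> `|E i (enorm (p - q))| <= K ->
  `|moment_density i k p q| <= K.
Proof.
move=> /phi01/andP[p0 p1] EK; rewrite moment_densityE normrN normrM ger0_norm//.
rewrite -[K]mul1r; apply: ler_pM => //.
exact: le_trans (radial_slope_le _ _ _ _) EK.
Qed.

Lemma moment_density_le_mass i k p q D : Q q -> enorm (p - q) <= D ->
  `|moment_density i k p q| <= D * perceived_density phi (f i) p q.
Proof.
move=> Qq pqD; rewrite /moment_density normrM (ger0_norm (perceived_density_ge0 _ _ Qq)).
apply: ler_wpM2r; first exact: perceived_density_ge0.
exact: le_trans (coord_le_enorm _ _) pqD.
Qed.

Lemma measurable_perceived_density i p V : measurable V -> V `<=` Q -> Q p ->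
  measurable_fun V (perceived_density phi (f i) p).
Proof.
move=> mV VQ Qp; apply/measurable_EFinP.
by have := integrableS measurable_domain mV VQ (fint i Qp) => /measurable_int.
Qed.

Lemma measurable_moment_density i k p V : measurable V -> V `<=` Q -> Q p ->
  measurable_fun V (moment_density i k p).
Proof.
move=> mV VQ Qp; apply: measurable_funM; first exact: measurable_coordB.
exact: measurable_perceived_density.
Qed.

(** Near 0 this is [node_slope_at0]; for r >= e the constant bound is at most (|K| / e) r. *)
Lemma slope_linear_bound i D K : (forall r, 0 <= r <= D -> `|E i r| <= K) ->
  exists C, forall r, 0 <= r <= D -> `|E i r| <= `|E i 0| + C * r.
Proof.
move=> EK; have [C [e [e0 HC]]] := node_slope_at0 nf i.
exists (`|C| + `|K| / e) => r /andP[r0 rD]; have [re|re] := ltP r e.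
  have := HC r; rewrite r0 => /(_ re) H.
  rewrite -[E i r](subrK (E i 0)) (le_trans (ler_normD _ _))// addrC lerD2l.
  apply: le_trans H _; apply: ler_wpM2r => //; rewrite (le_trans (ler_norm _))// lerDl.
  by rewrite divr_ge0// ltW.
have EiK : `|E i r| <= `|K| by rewrite (le_trans _ (ler_norm _))// EK// r0.
apply: le_trans EiK _; rewrite ler_wpDl// mulrDl ler_wpDl ?mulr_ge0//.
by rewrite -mulrA ler_peMr// mulrC ler_pdivlMr// mul1r.
Qed.

(* The perceived density is bounded if [E i 0 = 0], and is at most a constant times
   [1 / |p - q|] otherwise.  The latter is integrable, uniformly in [p], in dimension
   at least two; in dimension one the integrability assumption gives [phi = 0] almost
   everywhere. *)
Lemma mass_bound (k0 : 'I_d) : exists2 B, 0 < B & forall i p, Q p ->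
  \int[mu]_(q in Q) perceived_density phi (f i) p q <= B.
Proof.
have [D [K [D0 K0 QD fK [EK _]]]] := uniform_bounds.
have mQ := measurable_domain; have Qfin := domain_lt_pinfty.
suff H i : exists B, forall p, Q p -> \int[mu]_(q in Q) perceived_density phi (f i) p q <= B.
  have [B HB] := choice H.
  exists (\sum_i `|B i| + 1); first by rewrite ltr_wpDl// sumr_ge0.
  move=> i p Qp; apply: le_trans (HB i p Qp) _; rewrite (bigD1 i)//=.
  have : 0 <= \sum_(j | j != i) `|B j| by apply: sumr_ge0.
  by have := ler_norm (B i) => ? ?; lra.
have [E0|E0] := eqVneq (E i 0) 0.
  have [C HC] := slope_linear_bound (EK i).
  exists (`|C| * fine (mu Q)) => p Qp.
  apply: le_trans (ler_norm _) _; apply: Rintegral_le_const => //.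
    exact: measurable_perceived_density.
  move=> q Qq; rewrite (perceived_densityE nf) normrN !normrM normfV (ger0_norm (enorm_ge0 _)).
  have /andP[p0 p1] := phi01 Qq; rewrite ger0_norm//.
  have [->|r0] := eqVneq (enorm (p - q)) 0; first by rewrite invr0 mulr0.
  have rp : 0 < enorm (p - q) by rewrite lt_neqAle eq_sym r0 enorm_ge0.
  rewrite ler_pdivrMr//.
  have := HC (enorm (p - q)); rewrite enorm_ge0 QD// E0 normr0 add0r => /(_ isT) H.
  rewrite -[leRHS]mul1r; apply: ler_pM => //; apply: le_trans H _.
  by apply: ler_wpM2r => //; [exact: ltW|exact: ler_norm].
have [d1|d1] := leqP d 1; last first.
  have [L QL] := polytope_bounded polyQ.
  have [B HB] := integral_inv_enorm_bound d1 measurable_domain QL.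
  exists (K * B) => p Qp.
  pose g q := K^-1 * perceived_density phi (f i) p q.
  have ig : mu.-integrable Q (EFin \o g).
    rewrite (_ : _ \o _ = (fun q => (K^-1)%:E * (perceived_density phi (f i) p q)%:E)%E).
      by apply: integrableZl => //; exact: fint.
    by apply/funext => q; rewrite /g /= EFinM.
  have mg : measurable_fun Q g by apply/measurable_EFinP; exact: measurable_int ig.
  have g01 q : Q q -> 0 <= g q <= (enorm (p - q))^-1.
    move=> Qq; rewrite /g mulr_ge0 ?invr_ge0 ?(ltW K0) ?perceived_density_ge0//=.
    rewrite (perceived_densityE nf) ler_pdivrMl// -mulNr ler_wpM2r ?invr_ge0 ?enorm_ge0//.
    apply: le_trans (ler_norm _) _; rewrite normrN normrM.
    have /andP[p0 p1] := phi01 Qq; rewrite ger0_norm// -[leRHS]mul1r; apply: ler_pM => //.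
    by apply: EK; rewrite enorm_ge0 QD.
  have := HB p g Qp mg g01; rewrite -[X in (X <= _)%E -> _]fineK; last exact: integrable_fin_num.
  rewrite lee_fin => H; rewrite -ler_pdivrMl// -RintegralZl//; exact: fint.
suff phi0 : \int[mu]_(q in Q) phi q = 0.
  have ephi : {ae mu, forall q, Q q -> phi q = 0}.
    have : (\int[mu]_(q in Q) `|(phi q)%:E| = 0)%E.
      rewrite (eq_integral (fun q => (phi q)%:E)); last first.
        by move=> q /set_mem/phi01/andP[p0 _]; rewrite gee0_abs.
      rewrite -[LHS]fineK ?[fine _]phi0//; apply: integrable_fin_num => //.
      apply: (@le_const_integrable _ _ _ _ _ _ 1) => // q /phi01/andP[p0 p1].
      by rewrite ger0_norm.
    move=> /ae_eq_integral_abs; rewrite -/mu => /(_ measurable_domain).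
    move=> /(_ (proj2 (measurable_EFinP _ _) mphi)); apply: filterS => q H Qq.
    by have [] := H Qq.
  exists 0 => p Qp; rewrite (_ : Rintegral _ _ _ = 0)// /Rintegral.
  rewrite (@ae_eq_integral _ _ _ _ _ (cst 0%E)) ?integral_cst// ?mul0e//.
    by apply/measurable_EFinP; exact: measurable_perceived_density.
  apply: filterS ephi => q H Qq; congr EFin.
  by rewrite (perceived_densityE nf) H// !mul0r oppr0.
have [L QL] := polytope_bounded polyQ.
have clQ : closed Q by apply: compact_closed (polytope_compact polyQ); exact: norm_hausdorff.
apply: (@density_null_low_dim R d k0 Q phi (perceived_density phi (f i)) L) => //.
- exact: fint.
- by move=> p q _; exact: perceived_density_ge0.
(* Close to 0 the slope is at least half of its value at 0 in absolute value, which bounds [phi] by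
   2 r / |E i 0| times the perceived density. *)
move=> p Qp; exists (2 / `|E i 0|).
have E0n : 0 < `|E i 0| by rewrite normr_gt0.
have E02 : 0 < `|E i 0| / 2 by rewrite divr_gt0.
have /cvgrPdist_lt/(_ _ E02)/nbhs_ballP[e /= e0 He] := @node_slope_continuous _ _ _ _ nf i 0.
exists e; split => //.
move=> q Qq /andP[rp re]; rewrite (perceived_densityE nf).
have /andP[p0 _] := phi01 Qq.
set r := enorm (p - q) in rp re *.
have Er : `|E i 0| / 2 <= `|E i r|.
  have := He r; rewrite /ball/= sub0r normrN gtr0_norm// => /(_ re) H.
  have := ler_normD (E i 0 - E i r) (E i r); rewrite subrK => H'.
  by move: H H'; set z := `|E i 0 - E i r|; lra.
have Er0 : E i r <= 0 by exact: (node_slope_le0 nf).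
have -> : 2 / `|E i 0| * r * - (phi q * E i r / r) = phi q * (2 / `|E i 0| * - E i r).
  by field; rewrite normr_eq0 E0/= gt_eqF.
rewrite -[leLHS]mulr1 ler_wpM2l// mulrAC ler_pdivlMr// mul1r.
by rewrite -(ler0_norm Er0); lra.
Qed.

Lemma measurable_cell Y i : measurable (gen_voronoi_cell Q f Y i).
Proof.
rewrite (_ : gen_voronoi_cell Q f Y i = Q `&` \bigcap_(j : 'I_N)
    [set q | 0 <= f i (enorm (Y i - q)) - f j (enorm (Y j - q))]); last first.
  apply/seteqP; split => q [Qq H]; split => // j.
    move=> _ /=; have [->|ji] := eqVneq j i; first by rewrite subrr.
    by rewrite subr_ge0; exact: H.
  by move=> _; rewrite -subr_ge0; exact: H.
apply: measurableI; first exact: measurable_domain.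
apply: fin_bigcap_measurable => // j _.
have : measurable_fun setT (fun q : 'rV[R]_d => f i (enorm (Y i - q)) - f j (enorm (Y j - q))).
  apply: measurable_funB; apply: measurable_comp_enorm;
  exact: (@node_continuous _ _ _ _ nf).
move=> /(_ measurableT `[0, +oo[%classic (measurable_itv _)); rewrite setTI.
by congr (measurable _); apply/seteqP; split => q /=; rewrite in_itv/= andbT.
Qed.

Lemma cell_sub Y i : gen_voronoi_cell Q f Y i `<=` Q.
Proof. by move=> q []. Qed.

Lemma cell_le Y i j q : gen_voronoi_cell Q f Y i q ->
  f j (enorm (Y j - q)) <= f i (enorm (Y i - q)).
Proof. by move=> [_ H]; have [->//|] := eqVneq j i; exact: H. Qed.

Lemma integrable_perceived_density_cell Y i : Q (Y i) ->
  mu.-integrable (gen_voronoi_cell Q f Y i) (EFin \o perceived_density phi (f i) (Y i)).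
Proof.
move=> QY; apply: integrableS (fint i QY); [exact: measurable_domain|exact: measurable_cell|exact: cell_sub].
Qed.

Lemma cell_mass_ge0 Y i : 0 <= cell_mass Q phi f Y i.
Proof. by apply: Rintegral_ge0 => q [Qq _]; exact: perceived_density_ge0. Qed.

Lemma cell_mass_le Y i B : Q (Y i) ->
  \int[mu]_(q in Q) perceived_density phi (f i) (Y i) q <= B ->
  cell_mass Q phi f Y i <= B.
Proof.
move=> QY; apply: le_trans; rewrite /cell_mass.
apply: fine_le.
- by have := integrable_fin_num (measurable_cell Y i) (integrable_perceived_density_cell QY).
- by have := integrable_fin_num measurable_domain (fint i QY).
apply: ge0_subset_integral => //.
- exact: measurable_cell.
- exact: measurable_domain.
- by have := measurable_int _ (fint i QY).
- by move=> q Qq; rewrite lee_fin; exact: perceived_density_ge0.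
- exact: cell_sub.
Qed.

Definition cell_moment Y i k :=
  \int[mu]_(q in gen_voronoi_cell Q f Y i) moment_density i k (Y i) q.

Lemma integrable_moment_density V i k p : measurable V -> V `<=` Q -> Q p ->
  mu.-integrable V (EFin \o moment_density i k p).
Proof.
move=> mV VQ Qp; have [D [K [D0 K0 QD fK [EK _]]]] := uniform_bounds.
apply: (@le_const_integrable _ _ _ _ _ _ K) => //.
- by apply: le_lt_trans domain_lt_pinfty; apply: le_measure; rewrite ?inE//; exact: measurable_domain.
- exact: measurable_moment_density.
- by move=> q /VQ Qq; apply: moment_density_le => //; apply: EK; rewrite enorm_ge0 QD.
Qed.

Lemma cell_moment_le_mass Y i k D : Q (Y i) -> (forall q, Q q -> enorm (Y i - q) <= D) ->
  `|cell_moment Y i k| <= D * cell_mass Q phi f Y i.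
Proof.
move=> QY YD; set V := gen_voronoi_cell Q f Y i.
have mV : measurable V := measurable_cell Y i.
have VQ : V `<=` Q by exact: cell_sub.
have ipd := integrable_perceived_density_cell QY.
have im := integrable_moment_density i k mV VQ QY.
apply: le_trans (le_normr_Rintegral mV im) _.
rewrite /cell_mass -RintegralZl//; apply: le_Rintegral => //.
- by have := integrable_abse im.
- rewrite (_ : _ \o _ = (fun q => D%:E * (perceived_density phi (f i) (Y i) q)%:E)%E).
    by apply: integrableZl => //; exact: ipd.
  by apply/funext => q /=; rewrite EFinM.
by move=> q /VQ Qq; apply: moment_density_le_mass => //; exact: YD.
Qed.

(** This holds for null cells too: the centroid is then the position by convention, and the moment
    is at most a constant times the mass. The left side passes to limits of configurations, the
    centroid alone need not. *)
Lemma cell_momentE Y i k : Q (Y i) -> cell_moment Y i k =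
  cell_mass Q phi f Y i * (Y i - cell_centroid Q phi f Y i) ord0 k.
Proof.
move=> QY; set V := gen_voronoi_cell Q f Y i.
have mV : measurable V := measurable_cell Y i.
have VQ : V `<=` Q by exact: cell_sub.
have ipd := integrable_perceived_density_cell QY.
pose g q := q ord0 k * perceived_density phi (f i) (Y i) q.
have gE : g = fun q => Y i ord0 k * perceived_density phi (f i) (Y i) q - moment_density i k (Y i) q.
  by apply/funext => q; rewrite /g /moment_density !mxE; ring.
have iz : mu.-integrable V (EFin \o (fun q => Y i ord0 k * perceived_density phi (f i) (Y i) q)).
  rewrite (_ : _ \o _ = (fun q => (Y i ord0 k)%:E * (perceived_density phi (f i) (Y i) q)%:E)%E).
    by apply: integrableZl => //; exact: ipd.
  by apply/funext => q /=; rewrite EFinM.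
have im := integrable_moment_density i k mV VQ QY.
have gint : \int[mu]_(q in V) g q = Y i ord0 k * cell_mass Q phi f Y i - cell_moment Y i k.
  by rewrite gE RintegralB// RintegralZl.
rewrite /cell_centroid; case: eqP => [M0|/eqP M0].
  have [D [K [D0 K0 QD _ _]]] := uniform_bounds.
  have := cell_moment_le_mass k QY (fun q Qq => QD _ _ QY Qq).
  by rewrite M0 mulr0 normr_le0 subrr mxE mulr0 => /eqP.
rewrite !mxE -/V -/mu; move: gint; rewrite /g => ->.
by field.
Qed.

Lemma centroid_displacement_le Y i k D : Q (Y i) -> 0 <= D ->
  (forall q, Q q -> enorm (Y i - q) <= D) ->
  `|(Y i - cell_centroid Q phi f Y i) ord0 k| <= D.
Proof.
move=> QY D0 YD; have := cell_moment_le_mass k QY YD; rewrite cell_momentE//.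
have [M0 _|M0] := eqVneq (cell_mass Q phi f Y i) 0.
  by rewrite /cell_centroid M0 eqxx subrr mxE normr0.
have Mp : 0 < cell_mass Q phi f Y i by rewrite lt_neqAle eq_sym M0 cell_mass_ge0.
by rewrite normrM (gtr0_norm Mp) mulrC ler_pM2r.
Qed.

(* For equal node functions the cell of [i] lies on the side of [Y i] of the bisector
   of [Y i] and [Y j], and so does its centroid. *)
Lemma centroid_bisector Y i j : Q (Y i) -> (forall x, 0 <= x -> f i x = f j x) ->
  \sum_k (Y i - Y j) ord0 k * (Y i - cell_centroid Q phi f Y i) ord0 k
    <= enorm (Y i - Y j) ^+ 2 / 2.
Proof.
move=> QY fE; set V := gen_voronoi_cell Q f Y i.
have mV : measurable V := measurable_cell Y i.
have VQ : V `<=` Q by exact: cell_sub.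
have ipd := integrable_perceived_density_cell QY.
have [M0|M0] := eqVneq (cell_mass Q phi f Y i) 0.
  rewrite /cell_centroid M0 eqxx big1 ?divr_ge0 ?sqr_ge0// => k _.
  by rewrite subrr [X in _ * X]mxE mulr0.
have Mp : 0 < cell_mass Q phi f Y i by rewrite lt_neqAle eq_sym M0 cell_mass_ge0.
rewrite -(ler_pM2l Mp) mulr_sumr.
pose w k q := (Y i - Y j) ord0 k * moment_density i k (Y i) q.
have iw k : mu.-integrable V (EFin \o w k).
  rewrite (_ : _ \o _ = (fun q => ((Y i - Y j) ord0 k)%:E * (moment_density i k (Y i) q)%:E)%E).
    by apply: integrableZl => //; exact: integrable_moment_density.
  by apply/funext => q /=; rewrite EFinM.
have -> : \sum_k cell_mass Q phi f Y i *
    ((Y i - Y j) ord0 k * (Y i - cell_centroid Q phi f Y i) ord0 k) =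
    \int[mu]_(q in V) \sum_k w k q.
  rewrite Rintegral_sum_ord//; apply: eq_bigr => k _.
  rewrite mulrCA -cell_momentE// /cell_moment -RintegralZl//.
  exact: integrable_moment_density.
rewrite mulrC /cell_mass -RintegralZl//; apply: le_Rintegral => //.
- exact: integrable_sum_ord.
- rewrite (_ : _ \o _ = (fun q => (enorm (Y i - Y j) ^+ 2 / 2)%:E * (perceived_density phi (f i) (Y i) q)%:E)%E).
    by apply: integrableZl => //; exact: ipd.
  by apply/funext => q /=; rewrite EFinM.
move=> q Vq; have Qq := VQ q Vq.
have -> : \sum_k w k q = (\sum_k (Y i - Y j) ord0 k * (Y i - q) ord0 k) * perceived_density phi (f i) (Y i) q.
  by rewrite mulr_suml; apply: eq_bigr => k _; rewrite /w /moment_density mulrA.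
apply: ler_wpM2r; first exact: perceived_density_ge0.
have rij : enorm (Y i - q) <= enorm (Y j - q).
  rewrite leNgt; apply/negP => lt.
  have := node_decreasing nf i (enorm_ge0 _) lt.
  by rewrite [X in _ < X]fE ?enorm_ge0// ltNge (cell_le j Vq).
have : enorm (Y i - q) ^+ 2 <= enorm (Y j - q) ^+ 2.
  by rewrite ler_sqr ?nnegrE ?enorm_ge0.
rewrite !enorm_sqr.
have -> : \sum_k (Y j - q) ord0 k ^+ 2 = \sum_k (Y i - q) ord0 k ^+ 2
   + (\sum_k (Y i - Y j) ord0 k ^+ 2 - 2 * \sum_k (Y i - Y j) ord0 k * (Y i - q) ord0 k).
  rewrite mulr_sumr -sumrB -big_split/=; apply: eq_bigr => k _; rewrite !mxE; ring.
set A := \sum_k _; set B := \sum_k (Y i - Y j) ord0 k ^+ 2; set C := \sum_k _.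
lra.
Qed.

End sensing_domain.

(** * Chain rule along sequences *)

Section chain_rule.
Context {R : realType}.

Lemma cvg_sumr (T I : Type) (F : set_system T) (FF : Filter F) (s : seq I)
    (G : I -> T -> R) (l : I -> R) :
  (forall i, G i t @[t --> F] --> l i) ->
  \sum_(i <- s) G i t @[t --> F] --> \sum_(i <- s) l i.
Proof.
move=> Gl; elim: s => [|i s IH].
  rewrite big_nil (_ : (fun t => _) = cst 0); first exact: cvg_cst.
  by apply/funext => t; rewrite big_nil.
rewrite big_cons (_ : (fun t => _) = G i \+ (fun t => \sum_(j <- s) G j t)).
  by apply: cvgD; [exact: Gl|exact: IH].
by apply/funext => t; rewrite big_cons.
Qed.

Lemma cvg_comp_quotient (g : R -> R) (s0 b v : R) (s h : nat -> R) :
  is_derive s0 1 g b -> (forall n, h n != 0) -> h n @[n --> \oo] --> 0 ->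
  (s n - s0) / h n @[n --> \oo] --> v ->
  (g (s n) - g s0) / h n @[n --> \oo] --> b * v.
Proof.
move=> [dg gb] h0 hcv qcv.
have scv : s n @[n --> \oo] --> s0.
  have -> : s = (fun n => s0 + (s n - s0) / h n * h n).
    by apply/funext => n; rewrite divfK// addrC subrK.
  rewrite -[X in _ --> X]addr0 -[X in _ --> _ + X](mulr0 v).
  by apply: cvgD; [exact: cvg_cst|exact: cvgM].
(* Giving the difference quotient the value b at s0 makes it continuous there and covers the terms
   with s n = s0. *)
pose th x := if x == s0 then b else (g x - g s0) / (x - s0).
have thE x : g x - g s0 = th x * (x - s0).
  rewrite /th; case: eqP => [->|/eqP xs]; first by rewrite !subrr mulr0.
  by rewrite divfK// subr_eq0.
have thcv : th x @[x --> s0] --> b.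
  have : h^-1 *: (g (h *: 1 + s0) - g s0) @[h --> (0:R)^'] --> b by rewrite -gb.
  move=> /cvgrPdist_lt H; apply/cvgrPdist_lt => e e0.
  have /nbhs_ballP[r /= r0 Hr] := H e e0.
  apply/nbhs_ballP; exists r => //= x; rewrite /ball/= => xr.
  rewrite /th; case: eqP => [_|/eqP xs]; first by rewrite subrr normr0.
  have := Hr (x - s0); rewrite /ball/= sub0r normrN distrC => /(_ xr).
  by rewrite subr_eq0 => /(_ xs); rewrite /GRing.scale/= mulr1 subrK mulrC.
have -> : (fun n => (g (s n) - g s0) / h n) = (fun n => th (s n) * ((s n - s0) / h n)).
  by apply/funext => n; rewrite thE mulrA.
by apply: cvgM => //; exact: cvg_comp thcv.
Qed.

End chain_rule.

(** * The coverage function *)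

Section coverage.
Context {R : realType} {d N : nat} (Q : set 'rV[R]_d) (phi : 'rV[R]_d -> R).
Context (f E : 'I_N -> R -> R).
Hypothesis pb : sensing_problem Q phi f E.
Variables (k0 : 'I_d) (i0 : 'I_N).
Implicit Types (Y X : 'I_N -> 'rV[R]_d) (p q : 'rV[R]_d) (i j l : 'I_N) (r s x : R).

Let mu := lebesgue_rV R d.
Let nf := problem_nodes pb.
Let phi01 := problem_density pb.
Let mphi := problem_measurable_density pb.
Let mQ := measurable_domain pb.
Let Qfin := domain_lt_pinfty pb.

Let V := gen_voronoi_cell Q f.

(** The starting value is that of the sensor [i0], hence one of the values compared: this is the
    true maximum. *)
Definition effectiveness Y q :=
  \big[Num.max/f i0 (enorm (Y i0 - q))]_i f i (enorm (Y i - q)).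

Lemma le_effectiveness Y q i : f i (enorm (Y i - q)) <= effectiveness Y q.
Proof. exact: le_bigmax. Qed.

Lemma effectiveness_attained Y q : exists i, effectiveness Y q = f i (enorm (Y i - q)).
Proof.
rewrite /effectiveness.
apply: (big_ind (fun x => exists i, x = f i (enorm (Y i - q)))).
- by exists i0.
- by move=> x y [i ->] [j ->]; rewrite /Num.max; case: ifP => _; [exists j|exists i].
- by move=> i _; exists i.
Qed.

Lemma effectiveness_cell Y q i : V Y i q -> effectiveness Y q = f i (enorm (Y i - q)).
Proof.
move=> Vq; apply/le_anti; rewrite le_effectiveness andbT.
by have [j ->] := effectiveness_attained Y q; exact: cell_le Vq.
Qed.

Lemma measurable_effectiveness D Y : measurable_fun D (effectiveness Y).
Proof.
rewrite /effectiveness; elim: (index_enum _) => [|i s IH].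
  under eq_fun do rewrite big_nil.
  by apply: measurable_comp_enorm; exact: (@node_continuous _ _ _ _ nf).
under eq_fun do rewrite big_cons.
apply: measurable_maxr => //.
by apply: measurable_comp_enorm; exact: (@node_continuous _ _ _ _ nf).
Qed.

Definition coverage Y := \int[mu]_(q in Q) (effectiveness Y q * phi q).

Lemma effectiveness_le Y q D K : (forall i r, 0 <= r <= D -> `|f i r| <= K) ->
  (forall i, enorm (Y i - q) <= D) -> `|effectiveness Y q| <= K.
Proof.
by move=> fK YD; have [i ->] := effectiveness_attained Y q; apply: fK; rewrite enorm_ge0 YD.
Qed.

Lemma coverage_bounded : exists B, forall Y, (forall i, Q (Y i)) -> `|coverage Y| <= B.
Proof.
have [D [K [D0 K0 QD fK _]]] := uniform_bounds pb.
exists (K * fine (mu Q)) => Y QY; apply: Rintegral_le_const => //.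
  by apply: measurable_funM => //; exact: measurable_effectiveness.
move=> q Qq; have /andP[p0 p1] := phi01 Qq; rewrite normrM (ger0_norm p0).
rewrite -[leRHS]mulr1; apply: ler_pM => //.
by apply: effectiveness_le fK _ => i; exact: QD.
Qed.

Lemma effectiveness_lipschitz : exists2 K, 0 < K & forall Y Z q,
  (forall i, Q (Y i)) -> (forall i, Q (Z i)) -> Q q ->
  effectiveness Y q - effectiveness Z q <= K * \sum_i enorm (Y i - Z i).
Proof.
have [D [K [D0 K0 QD fK [EK lip]]]] := uniform_bounds pb.
exists K => // Y Z q QY QZ Qq; have [i ->] := effectiveness_attained Y q.
apply: (@le_trans _ _ (f i (enorm (Y i - q)) - f i (enorm (Z i - q)))).
  by rewrite lerD2l lerN2 le_effectiveness.
apply: le_trans (ler_norm _) _; apply: le_trans (lip i _ _ _ _) _; rewrite ?enorm_ge0 ?QD//.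
apply: ler_wpM2l; first exact: ltW.
apply: le_trans (enorm_dist _ _) _; rewrite opprB addrA subrK (bigD1 i)//= lerDl.
by apply: sumr_ge0 => j _; exact: enorm_ge0.
Qed.

Lemma coverage_lipschitz : exists2 K, 0 <= K & forall Y Z,
  (forall i, Q (Y i)) -> (forall i, Q (Z i)) ->
  `|coverage Y - coverage Z| <= K * \sum_i enorm (Y i - Z i).
Proof.
have [K K0 HK] := effectiveness_lipschitz.
have [D [K' [D0 K'0 QD fK _]]] := uniform_bounds pb.
exists (K * fine (mu Q)); first by rewrite mulr_ge0 ?(ltW K0)// fine_ge0.
move=> Y Z QY QZ.
have int Y' : (forall i, Q (Y' i)) -> mu.-integrable Q (EFin \o (fun q => effectiveness Y' q * phi q)).
  move=> QY'; apply: (@le_const_integrable _ _ _ _ _ _ K') => //.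
    by apply: measurable_funM => //; exact: measurable_effectiveness.
  move=> q Qq; have /andP[p0 p1] := phi01 Qq; rewrite normrM (ger0_norm p0).
  rewrite -[leRHS]mulr1; apply: ler_pM => //.
  by apply: effectiveness_le fK _ => i; exact: QD.
rewrite /coverage -RintegralB//; [|exact: int|exact: int].
rewrite mulrAC; apply: Rintegral_le_const => //.
  by apply: measurable_funB; apply: measurable_funM => //; exact: measurable_effectiveness.
move=> q Qq; have /andP[p0 p1] := phi01 Qq.
rewrite -mulrBl normrM (ger0_norm p0) -[leRHS]mulr1; apply: ler_pM => //.
rewrite ler_norml HK// andbT lerNl opprB.
have -> : \sum_i enorm (Y i - Z i) = \sum_i enorm (Z i - Y i) by apply: eq_bigr => i _; exact: enormB.
exact: HK.
Qed.

(** Sensors with different node functions may meet. Identical ones at the same place would share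
    their whole cell, and sums over maximal sensors would count it twice. *)
Definition unmerged Y := forall i j, i != j -> Y i = Y j -> ~ (forall x, 0 <= x -> f i x = f j x).

Definition chi Y i q : R := (`[< maximal f Y i >])%:R * \1_(V Y i) q.

Lemma chi01 Y i q : 0 <= chi Y i q <= 1.
Proof.
rewrite /chi indicE; case: (asbool _); case: (_ \in _);
  by rewrite ?mulr1 ?mulr0 ?mul0r ?lexx ?ler01.
Qed.

Lemma measurable_chi D Y i : measurable_fun D (chi Y i).
Proof.
apply: measurable_funM; first exact: measurable_cst.
by apply: measurable_indic; exact: measurable_cell pb Y i.
Qed.

Lemma chi_cell Y i q : chi Y i q != 0 -> maximal f Y i /\ V Y i q.
Proof.
rewrite /chi indicE mulf_eq0 negb_or !pnatr_eq0 !eqb0 !negbK => /andP[/asboolP m /set_mem v].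
by [].
Qed.

(* In particular, the cells of the maximal sensors cover [Q] and overlap in null sets
   only. *)
Lemma chi_sum Y q : unmerged Y -> Q q -> generic f E Y q ->
  exists i, [/\ maximal f Y i, V Y i q & forall a : 'I_N -> R, \sum_j chi Y j q * a j = a i].
Proof.
move=> sepY Qq [_ gY]; have [j Wj] := effectiveness_attained Y q.
have [i bji mi] := exists_maximal nf Y j.
have Vi : V Y i q.
  split => // l _; apply: le_trans (le_effectiveness Y q l) _.
  by rewrite Wj; exact: (below_le nf).
exists i; split => // a; rewrite (bigD1 i)//= {1}/chi indicE mem_set//.
rewrite (introT (asboolP _) mi) !mul1r big1 ?addr0// => l li.
have [->|/chi_cell[ml Vl]] := eqVneq (chi Y l q) 0; first by rewrite mul0r.
exfalso.
have fE : f l (enorm (Y l - q)) = f i (enorm (Y i - q)).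
  by rewrite -(effectiveness_cell Vl) (effectiveness_cell Vi).
(* Maximality makes the two tied sensors equivalent, hence identical and at the same place, which is
   excluded. *)
have [[bli|bil] _] := gY l i fE.
  have bil := ml _ bli.
  by have [YE fe] := below_antisym nf bli bil; exact: sepY li YE fe.
have bli := mi _ bil.
by have [YE fe] := below_antisym nf bli bil; exact: sepY li YE fe.
Qed.

(* Up to the gain, a lower bound for the growth rate of the coverage along the control
   law ([coverage_growth]). *)
Definition dissipation Y := \sum_(i | `[< maximal f Y i >])
  cell_mass Q phi f Y i * enorm (Y i - cell_centroid Q phi f Y i) ^+ 2.

(** The squared distance is a polynomial in z, so its quotient is explicit; the rest is the chain
    rule for the node function of the square root. *)
Lemma cvg_effectiveness_quotient i q p (z : nat -> 'rV[R]_d) (h : nat -> R) (u : 'rV[R]_d) :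
  enorm (p - q) != 0 -> (forall n, h n != 0) -> h n @[n --> \oo] --> 0 ->
  (forall k, (z n - p) ord0 k / h n @[n --> \oo] --> u ord0 k) ->
  (f i (enorm (z n - q)) - f i (enorm (p - q))) / h n @[n --> \oo] -->
    \sum_k radial_slope E i k p q * u ord0 k.
Proof.
move=> r0 h0 hcv zcv; set r := enorm (p - q) in r0 *.
have rp : 0 < r by rewrite lt_neqAle eq_sym r0 enorm_ge0.
have dz := is_derive_comp_sqrt nf i rp.
pose s n := enorm (z n - q) ^+ 2.
have zcv0 k : (z n - p) ord0 k @[n --> \oo] --> 0.
  have -> : (fun n => (z n - p) ord0 k) = (fun n => (z n - p) ord0 k / h n * h n).
    by apply/funext => n; rewrite divfK.
  by rewrite -[X in _ --> X](mulr0 (u ord0 k)); exact: cvgM.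
have scv : (s n - r ^+ 2) / h n @[n --> \oo] --> \sum_k u ord0 k * (2 * (p - q) ord0 k).
  have -> : (fun n => (s n - r ^+ 2) / h n) = (fun n => \sum_k
      ((z n - p) ord0 k / h n) * ((z n - p) ord0 k + 2 * (p - q) ord0 k)).
    apply/funext => n; rewrite /s /r !enorm_sqr -sumrB mulr_suml.
    by apply: eq_bigr => k _; rewrite !mxE; ring.
  apply: cvg_sumr => k; apply: cvgM => //.
  by rewrite -[X in _ --> X]add0r; apply: cvgD => //; exact: cvg_cst.
have := cvg_comp_quotient dz h0 hcv scv.
have sE n : Num.sqrt (s n) = enorm (z n - q) by rewrite /s sqrtr_sqr ger0_norm ?enorm_ge0.
have -> : (fun n => (f i (Num.sqrt (s n)) - f i (Num.sqrt (r ^+ 2))) / h n) =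
   (fun n => (f i (enorm (z n - q)) - f i r) / h n).
  by apply/funext => n; rewrite sE sqrtr_sqr (gtr0_norm rp).
suff -> : E i r / (2 * r) * (\sum_k u ord0 k * (2 * (p - q) ord0 k)) =
  \sum_k radial_slope E i k p q * u ord0 k by [].
rewrite mulr_sumr; apply: eq_bigr => k _; rewrite /radial_slope -/r; field; exact: r0.
Qed.

(** At a generic q, the maximal sensor i whose cell contains q gives the old maximum, and its new
    value is at most the new maximum. So the coverage quotient dominates the integral of [S n],
    which tends to [kp * dissipation Y] by dominated convergence. *)
Lemma coverage_growth Y (Z : nat -> 'I_N -> 'rV[R]_d) (h : nat -> R) (u : 'I_N -> 'rV[R]_d)
    (kp c : R) :
  (forall i, Q (Y i)) -> unmerged Y -> (forall n i, Q (Z n i)) ->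
  (forall n, 0 < h n) -> h n @[n --> \oo] --> 0 ->
  (forall i k, (Z n i - Y i) ord0 k / h n @[n --> \oo] --> u i ord0 k) ->
  (forall i, u i = - kp *: (Y i - cell_centroid Q phi f Y i)) ->
  c < kp * dissipation Y ->
  \forall n \near \oo, coverage Y + c * h n <= coverage (Z n).
Proof.
move=> QY sepY QZ hp hcv Zcv uE clt.
have [D [K [D0 K0 QD fK [EK lip]]]] := uniform_bounds pb.
have h0 n : h n != 0 by rewrite gt_eqF.
pose quot n i q := (f i (enorm (Z n i - q)) - f i (enorm (Y i - q))) / h n.
pose lim i q := \sum_k radial_slope E i k (Y i) q * u i ord0 k.
pose S n q := \sum_i chi Y i q * (quot n i q * phi q).
pose S' q := \sum_i chi Y i q * (\sum_k - u i ord0 k * moment_density phi f i k (Y i) q).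
have mquot n i : measurable_fun Q (quot n i).
  apply: measurable_funM; last exact: measurable_cst.
  by apply: measurable_funB; apply: measurable_comp_enorm; exact: (@node_continuous _ _ _ _ nf).
have mS n : measurable_fun Q (S n).
  apply: measurable_sum => i; apply: measurable_funM; first exact: measurable_chi.
  exact: measurable_funM.
have mS' : measurable_fun Q S'.
  apply: measurable_sum => i; apply: measurable_funM; first exact: measurable_chi.
  apply: measurable_sum => k; apply: measurable_funM; first exact: measurable_cst.
  exact: (measurable_moment_density pb).
have speed i : exists B, forall n, enorm (Z n i - Y i) / h n <= B.
  have bk k : exists B, forall n, `|(Z n i - Y i) ord0 k / h n| <= B.
    have : cvgn (fun n => (Z n i - Y i) ord0 k / h n) by apply/cvg_ex; exists (u i ord0 k).
    move=> /cvg_seq_bounded[B [_ HB]]; exists (B + 1) => n.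
    by apply: HB => //; rewrite ltrDl.
  have [B HB] := choice bk; exists (\sum_k B k) => n.
  rewrite ler_pdivrMr// mulr_suml; apply: le_trans (enorm_le_sum _) _.
  apply: ler_sum => k _; rewrite -ler_pdivrMr//.
  by apply: le_trans (HB k n); rewrite normrM normfV (gtr0_norm (hp n)).
have [B HB] := choice speed.
pose Bt := \sum_i K * `|B i|.
have quotB n i q : Q q -> `|quot n i q| <= K * `|B i|.
  move=> Qq; rewrite /quot normrM normfV (gtr0_norm (hp n)) ler_pdivrMr//.
  apply: le_trans (lip i _ _ _ _) _; rewrite ?enorm_ge0 ?QD//.
  rewrite -mulrA; apply: ler_wpM2l; first exact: ltW.
  apply: le_trans (enorm_dist _ _) _; rewrite opprB addrA subrK -ler_pdivrMr//.
  by apply: le_trans (HB i n) _; exact: ler_norm.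
have SB n q : Q q -> `|S n q| <= Bt.
  move=> Qq; rewrite /S; apply: le_trans (ler_norm_sum _ _ _) _.
  apply: ler_sum => i _; rewrite normrM; have /andP[c0 c1] := chi01 Y i q.
  have /andP[p0 p1] := phi01 Qq; rewrite (ger0_norm c0) -[leRHS]mul1r ler_pM//.
  rewrite normrM (ger0_norm p0) -[leRHS]mulr1 ler_pM//; exact: quotB.
have gen := generic_ae nf k0 Y.
have cvS : {ae mu, forall q, Q q -> S ^~ q @ \oo --> S' q}.
  apply: filterS gen => q [q0 _] Qq; apply: cvg_sumr => i.
  apply: cvgM; first exact: cvg_cst.
  have -> : \sum_k - u i ord0 k * moment_density phi f i k (Y i) q = lim i q * phi q.
    rewrite /lim mulr_suml; apply: eq_bigr => k _.
    by rewrite (moment_densityE pb); ring.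
  apply: cvgM; last exact: cvg_cst.
  apply: cvg_effectiveness_quotient => //; exact: Zcv.
have icst : mu.-integrable Q (EFin \o cst Bt).
  by apply: (@le_const_integrable _ _ _ _ _ _ `|Bt|) => //; exact: measurable_cst.
have := @Rintegral_dominated_cvg _ _ _ mu Q S S' (cst Bt) mQ mS mS' icst SB cvS.
(* Under the control law - u is kp (p - C), and the moment is M (p - C): their scalar product is kp
   M |p - C|^2. *)
have -> : \int[mu]_(q in Q) S' q = kp * dissipation Y.
  have im i k : mu.-integrable Q (EFin \o (fun q => chi Y i q * (- u i ord0 k * moment_density phi f i k (Y i) q))).
    apply: (@le_const_integrable _ _ _ _ _ _ (`|u i ord0 k| * K)) => //.
      apply: measurable_funM; first exact: measurable_chi.
      apply: measurable_funM; first exact: measurable_cst.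
      exact: (measurable_moment_density pb).
    move=> q Qq; rewrite normrM; have /andP[c0 c1] := chi01 Y i q.
    rewrite (ger0_norm c0) -[leRHS]mul1r ler_pM// normrM normrN ler_wpM2l//.
    by apply: (moment_density_le pb) => //; apply: EK; rewrite enorm_ge0 QD.
  have -> : S' = (fun q => \sum_i (\sum_k chi Y i q * (- u i ord0 k * moment_density phi f i k (Y i) q))).
    by apply/funext => q; apply: eq_bigr => i _; rewrite mulr_sumr.
  rewrite Rintegral_sum_ord//; last by move=> i; exact: integrable_sum_ord.
  rewrite /dissipation mulr_sumr [RHS]big_mkcond/=; apply: eq_bigr => i _.
  rewrite Rintegral_sum_ord//.
  case: asboolP => [mi|nmi]; last first.
    apply: big1 => k _; rewrite (@eq_Rintegral _ _ _ mu Q (cst 0)) ?Rintegral_cst ?mul0r//.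
    by move=> q _; rewrite /chi (introF (asboolP _) nmi) !mul0r.
  rewrite enorm_sqr !mulr_sumr; apply: eq_bigr => k _.
  have -> : \int[mu]_(q in Q) (chi Y i q * (- u i ord0 k * moment_density phi f i k (Y i) q))
    = - u i ord0 k * cell_moment Q phi f Y i k.
    have VQ : V Y i = V Y i `&` Q by apply/esym/setIidPl; exact: cell_sub.
    rewrite /cell_moment -/V VQ Rintegral_mkcondl -RintegralZl//; last first.
      rewrite (_ : EFin \o _ = (fun q => (1%:E * (chi Y i q * moment_density phi f i k (Y i) q)%:E)%E)); last first.
        apply/funext => q /=; rewrite mul1e /patch /chi (introT (asboolP _) mi) mul1r indicE.
        by case: ifP => _; rewrite ?mul1r ?mul0r.
      apply: integrableZl => //; apply: (@le_const_integrable _ _ _ _ _ _ K) => //.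
        by apply: measurable_funM; [exact: measurable_chi|exact: (measurable_moment_density pb)].
      move=> q Qq; rewrite normrM; have /andP[c0 c1] := chi01 Y i q.
      rewrite (ger0_norm c0) -[leRHS]mul1r ler_pM//.
      by apply: (moment_density_le pb) => //; apply: EK; rewrite enorm_ge0 QD.
    apply: eq_Rintegral => q _; rewrite /patch /chi (introT (asboolP _) mi) mul1r indicE.
    by case: ifP => _; rewrite ?mul1r ?mul0r ?mulr0.
  rewrite (cell_momentE pb)// uE mxE; ring.
move=> cvI; apply: filterS (cvgr_gt _ cvI _ clt) => n cn.
have : \int[mu]_(q in Q) S n q <= (coverage (Z n) - coverage Y) / h n.
  have int Y' : (forall i, Q (Y' i)) -> mu.-integrable Q (EFin \o (fun q => effectiveness Y' q * phi q)).
    move=> QY'; apply: (@le_const_integrable _ _ _ _ _ _ K) => //.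
      by apply: measurable_funM => //; exact: measurable_effectiveness.
    move=> q Qq; have /andP[p0 p1] := phi01 Qq; rewrite normrM (ger0_norm p0).
    rewrite -[leRHS]mulr1; apply: ler_pM => //.
    by apply: effectiveness_le fK _ => i; exact: QD.
  rewrite ler_pdivlMr// /coverage -RintegralB//; [|exact: int|exact: int].
  have iS : mu.-integrable Q (EFin \o S n).
    exact: (le_const_integrable mQ Qfin (mS n) (SB n)).
  rewrite -RintegralZr//.
  have eb Y' q : (forall i, Q (Y' i)) -> Q q -> `|effectiveness Y' q * phi q| <= K.
    move=> QY' Qq; have /andP[p0 p1] := phi01 Qq; rewrite normrM (ger0_norm p0).
    rewrite -[leRHS]mulr1; apply: ler_pM => //.
    by apply: effectiveness_le fK _ => i; exact: QD.
  apply: (@ae_le_Rintegral _ _ _ _ _ _ _ (Bt * h n + 2 * K)) => //.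
  - by apply: measurable_funM => //; exact: measurable_cst.
  - by apply: measurable_funB; apply: measurable_funM => //; exact: measurable_effectiveness.
  - move=> q Qq; rewrite normrM (gtr0_norm (hp n)) -[leLHS]addr0 lerD ?mulr_ge0 ?(ltW K0)//.
    by rewrite ler_pM2r//; exact: SB.
  - move=> q Qq; apply: le_trans (ler_normB _ _) _.
    have := eb _ q (QZ n) Qq; have := eb _ q QY Qq => H1 H2.
    have Bt0 : 0 <= Bt by apply: sumr_ge0 => i _; rewrite mulr_ge0// ltW.
    rewrite -[leLHS]add0r lerD ?mulr_ge0 ?(ltW (hp n))//; lra.
  apply: filterS gen => q gq Qq.
  have [i [mi Vi chiE]] := chi_sum sepY Qq gq.
  rewrite /S chiE /quot (effectiveness_cell Vi) -mulrBl mulrAC.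
  have /andP[p0 p1] := phi01 Qq; apply: ler_wpM2r => //.
  by rewrite divfK// lerD2r le_effectiveness.
move=> /(lt_le_trans cn); rewrite ltr_pdivlMr// => /ltW; lra.
Qed.

End coverage.

Lemma cvg_normB_le (R : realType) (a b : nat -> R) (l : R) :
  (forall n, `|a n - l| <= b n) -> b n @[n --> \oo] --> 0 -> a n @[n --> \oo] --> l.
Proof.
move=> ab /cvgrPdist_lt b0; apply/cvgrPdist_lt => e e0.
apply: filterS (b0 e e0) => n; rewrite sub0r normrN distrC.
by apply: le_lt_trans; apply: le_trans (ab n) (ler_norm _).
Qed.

(** * Limits of configurations *)

Section limit_configurations.
Context {R : realType} {d N : nat} (Q : set 'rV[R]_d) (phi : 'rV[R]_d -> R).
Context (f E : 'I_N -> R -> R).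
Hypothesis pb : sensing_problem Q phi f E.
Variables (k0 : 'I_d) (i0 : 'I_N).
Implicit Types (Y X : 'I_N -> 'rV[R]_d) (p q : 'rV[R]_d) (i j l : 'I_N) (r s x : R).

Let mu := lebesgue_rV R d.
Let nf := problem_nodes pb.
Let mQ := measurable_domain pb.
Let Qfin := domain_lt_pinfty pb.
Let V := gen_voronoi_cell Q f.

Section convergent_points.
Variables (z : nat -> 'rV[R]_d) (p q : 'rV[R]_d).
Hypothesis zp : enorm (z n - p) @[n --> \oo] --> 0.

Lemma cvg_enormB : enorm (z n - q) @[n --> \oo] --> enorm (p - q).
Proof.
apply: cvg_normB_le zp => n; apply: le_trans (enorm_dist _ _) _.
by rewrite opprB addrA subrK.
Qed.

Lemma cvg_coordB k : (z n - q) ord0 k @[n --> \oo] --> (p - q) ord0 k.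
Proof.
apply: cvg_normB_le zp => n.
have -> : (z n - q) ord0 k - (p - q) ord0 k = (z n - p) ord0 k by rewrite !mxE; ring.
exact: coord_le_enorm.
Qed.

Lemma cvg_node i : f i (enorm (z n - q)) @[n --> \oo] --> f i (enorm (p - q)).
Proof.
by apply: continuous_cvg; [exact: (@node_continuous _ _ _ _ nf)|exact: cvg_enormB].
Qed.

Lemma cvg_moment_density i k : enorm (p - q) != 0 ->
  moment_density phi f i k (z n) q @[n --> \oo] --> moment_density phi f i k p q.
Proof.
move=> r0; rewrite (moment_densityE pb).
under eq_fun do rewrite (moment_densityE pb).
apply: cvgN; apply: cvgM; first exact: cvg_cst.
rewrite /radial_slope; apply: cvgM; last first.
  by apply: cvgV => //; exact: cvg_enormB.
apply: cvgM; first exact: cvg_coordB.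
by apply: continuous_cvg; [exact: (@node_slope_continuous _ _ _ _ nf)|exact: cvg_enormB].
Qed.

End convergent_points.

(** The cells of individual sensors need not converge: near X, the cell of a maximal j may be
    divided among all sensors below j that tie with it at X. They have equal gradients there at
    generic points, so it is the sum of their moments that converges. *)
Lemma cvg_cluster_moment X (Y : nat -> 'I_N -> 'rV[R]_d) j k :
  (forall i, Q (X i)) -> maximal f X j -> (forall n i, Q (Y n i)) ->
  (forall n, unmerged f (Y n)) -> (forall i, enorm (Y n i - X i) @[n --> \oo] --> 0) ->
  \sum_(i | `[< below f X i j >]) (`[< maximal f (Y n) i >])%:R * cell_moment Q phi f (Y n) i k
    @[n --> \oo] --> cell_moment Q phi f X j k.
Proof.
move=> QX mj QY sepY YX.
have [D [K [D0 K0 QD fK [EK lip]]]] := uniform_bounds pb.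
pose b i : R := (`[< below f X i j >])%:R.
have b01 i : 0 <= b i <= 1 by rewrite /b; case: asbool; rewrite ?lexx ?ler01.
pose T n i q := chi Q f (Y n) i q * (b i * moment_density phi f i k (Y n i) q).
pose S n q := \sum_i T n i q.
pose S' q := \1_(V X j) q * moment_density phi f j k (X j) q.
have mT n i : measurable_fun Q (T n i).
  apply: measurable_funM; first exact: (measurable_chi pb).
  apply: measurable_funM; first exact: measurable_cst.
  exact: (measurable_moment_density pb).
have mS n : measurable_fun Q (S n) by exact: measurable_sum.
have mS' : measurable_fun Q S'.
  apply: measurable_funM; last exact: (measurable_moment_density pb).
  exact: (measurable_indic (measurable_cell pb X j)).
have TK n i q : Q q -> `|T n i q| <= K.
  move=> Qq; rewrite /T normrM (normrM (b i)); have /andP[c0 c1] := chi01 Q f (Y n) i q.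
  have /andP[b0 b1] := b01 i.
  rewrite (ger0_norm c0) (ger0_norm b0) mulrA -[leRHS]mul1r ler_pM ?mulr_ge0//.
    by rewrite -[leRHS]mulr1 ler_pM.
  by apply: (moment_density_le pb) => //; apply: EK; rewrite enorm_ge0 QD.
have SK n q : Q q -> `|S n q| <= \sum_(i < N) K.
  move=> Qq; apply: le_trans (ler_norm_sum _ _ _) _.
  by apply: ler_sum => i _; exact: TK.
have iT n i : mu.-integrable Q (EFin \o T n i).
  by apply: (@le_const_integrable _ _ _ _ _ _ K) => // q; exact: TK.
have icst : mu.-integrable Q (EFin \o cst (\sum_(i < N) K)).
  by apply: (@le_const_integrable _ _ _ _ _ _ `|\sum_(i < N) K|).
have genX := generic_ae nf k0 X.
have genY : {ae mu, forall q, forall n, generic f E (Y n) q}.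
  by apply/ae_foralln => n; exact: (generic_ae nf k0).
have cvS : {ae mu, forall q, Q q -> S ^~ q @ \oo --> S' q}.
  apply: filterS2 genX genY => q [q0 gX] gY Qq.
  apply/cvgrPdist_lt => e e0.
  have [l Wl] := effectiveness_attained f i0 X q.
  have WX i : f i (enorm (X i - q)) <= f l (enorm (X l - q)).
    by rewrite -Wl; exact: le_effectiveness.
  (* A sensor that does not attain the maximum at X loses q for large n. One that does is below j if
     q is in the cell of j, and cannot be below j otherwise, since j would then attain the maximum
     too. *)
  have H i : \forall n \near \oo, V (Y n) i q ->
      `|S' q - b i * moment_density phi f i k (Y n i) q| < e.
    have [ilt|ige] := ltP (f i (enorm (X i - q))) (f l (enorm (X l - q))).
      pose m := (f i (enorm (X i - q)) + f l (enorm (X l - q))) / 2.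
      have [im ml] : f i (enorm (X i - q)) < m /\ m < f l (enorm (X l - q)).
        by rewrite /m; split; lra.
      have h1 : \forall n \near \oo, f i (enorm (Y n i - q)) < m.
        exact: (cvgr_lt _ (@cvg_node (fun n => Y n i) (X i) q (YX i) i) _ im).
      have h2 : \forall n \near \oo, m < f l (enorm (Y n l - q)).
        exact: (cvgr_gt _ (@cvg_node (fun n => Y n l) (X l) q (YX l) l) _ ml).
      have [a _ Ha] := filterI h1 h2; exists a => // n /Ha[n1 n2] /(cell_le l) n3.
      by have := lt_trans n2 (le_lt_trans n3 n1); rewrite ltxx.
    have WE : f i (enorm (X i - q)) = f l (enorm (X l - q)) by apply/le_anti; rewrite WX.
    have [Vq|nVq] := pselect (V X j q).
      have jE : f i (enorm (X i - q)) = f j (enorm (X j - q)).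
        by apply/le_anti; rewrite (cell_le i Vq) WE WX.
      have [bij sl] := gX i j jE.
      have bE : b i = 1.
        rewrite /b (introT (asboolP _) _)//; case: bij => // /mj.
        exact.
      have S'E : S' q = moment_density phi f i k (X i) q.
        by rewrite /S' indicE mem_set// mul1r !(moment_densityE pb) sl.
      have := @cvg_moment_density (fun n => Y n i) (X i) q (YX i) i k (q0 i); rewrite -S'E => /cvgrPdist_lt/(_ e e0).
      by apply: filterS => n; rewrite bE mul1r.
    have bE : b i = 0.
      rewrite /b (introF (asboolP _) _)// => bij; apply: nVq; split => // i' _.
      by apply: le_trans (WX i') _; rewrite -WE; exact: (below_le nf).
    apply: nearW => n _; rewrite /S' indicE memNset// mul0r bE mul0r subrr normr0.
    exact: e0.
  have : \forall n \near \oo, forall i, V (Y n) i q ->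
      `|S' q - b i * moment_density phi f i k (Y n i) q| < e by exact: filter_forall.
  apply: filterS => n Hn.
  have [i [_ Vi chiE]] := chi_sum pb i0 (sepY n) Qq (gY n).
  by rewrite /S /T chiE; exact: Hn.
have := @Rintegral_dominated_cvg _ _ _ mu Q S S' _ mQ mS mS' icst SK cvS.
have QV Y' i : V Y' i = V Y' i `&` Q by apply/esym/setIidPl; exact: cell_sub.
have -> : \int[mu]_(q in Q) S' q = cell_moment Q phi f X j k.
  rewrite /cell_moment -/V QV Rintegral_mkcondl; apply: eq_Rintegral => q _.
  by rewrite /S' /patch indicE; case: ifP => _; rewrite ?mul1r ?mul0r.
have -> // : (fun n => \int[mu]_(q in Q) S n q) = (fun n => \sum_(i | `[< below f X i j >])
   (`[< maximal f (Y n) i >])%:R * cell_moment Q phi f (Y n) i k).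
apply/funext => n; rewrite /S Rintegral_sum_ord// [RHS]big_mkcond/=; apply: eq_bigr => i _.
have -> : \int[mu]_(q in Q) T n i q =
   \int[mu]_(q in Q) (b i * (`[< maximal f (Y n) i >])%:R * (moment_density phi f i k (Y n i) \_ (V (Y n) i)) q).
  apply: eq_Rintegral => q _; rewrite /T /chi /patch indicE.
  by case: ifP => _; rewrite ?mulr1 ?mulr0 ?mul0r//; ring.
rewrite RintegralZl//; last first.
  apply: (@le_const_integrable _ _ _ _ _ _ K) => //.
    rewrite (_ : _ \_ _ = fun q => \1_(V (Y n) i) q * moment_density phi f i k (Y n i) q).
      apply: measurable_funM; last exact: (measurable_moment_density pb).
      exact: (measurable_indic (measurable_cell pb (Y n) i)).
    by apply/funext => q; rewrite /patch indicE; case: ifP => _; rewrite ?mul1r ?mul0r.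
  move=> q Qq; rewrite /patch; case: ifP => _; last by rewrite normr0 ltW.
  by apply: (moment_density_le pb) => //; apply: EK; rewrite enorm_ge0 QD.
rewrite -Rintegral_mkcondl -QV /b /cell_moment -/V.
by case: asbool; rewrite ?mul1r ?mul0r.
Qed.

(** Otherwise configurations tending to X have dissipation tending to 0; with bounded masses, the
    moments of their maximal sensors tend to 0, against the nonzero limit given by
    [cvg_cluster_moment]. *)
Lemma dissipation_bounded_below X j k :
  (forall i, Q (X i)) -> maximal f X j -> cell_moment Q phi f X j k != 0 ->
  exists D c, [/\ 0 < D, 0 < c & forall Y, (forall i, Q (Y i)) -> unmerged f Y ->
    (forall i, enorm (Y i - X i) < D) -> c <= dissipation Q phi f Y].
Proof.
move=> QX mj F0; apply: contrapT => nH.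
have [B B0 HB] := mass_bound pb k0.
have hn0 n : 0 < n.+1%:R^-1 :> R by rewrite invr_gt0 ltr0n.
have ex n : exists Y, [/\ (forall i, Q (Y i)), unmerged f Y,
    (forall i, enorm (Y i - X i) < n.+1%:R^-1) & dissipation Q phi f Y < n.+1%:R^-1].
  apply: contrapT => nY; apply: nH; exists n.+1%:R^-1, n.+1%:R^-1; split => //.
  move=> Y QY sY YX; rewrite leNgt; apply/negP => dY; apply: nY; by exists Y.
have [Y HY] := choice ex.
have hcv : n.+1%:R^-1 @[n --> \oo] --> (0 : R) by exact: cvg_harmonic.
have YX i : enorm (Y n i - X i) @[n --> \oo] --> 0.
  apply: (@cvg_normB_le _ _ (fun n => n.+1%:R^-1)) => // n.
  by rewrite subr0 ger0_norm ?enorm_ge0//; have [_ _ /(_ i)/ltW] := HY n.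
have QY n i : Q (Y n i) by have [+ _ _ _] := HY n; exact.
have sY n : unmerged f (Y n) by have [] := HY n.
have := @cvg_cluster_moment X Y j k QX mj QY sY YX.
set F := cell_moment _ _ _ _ _ _ in F0 *.
have m0 : 0 < `|F| / 2 by rewrite divr_gt0// normr_gt0.
move=> /cvgrPdist_lt/(_ _ m0) cv.
(* At most N moments of size t sum to at most |F| / 2. Since the squared moment is at most B times
   the dissipation, the latter must be below t^2 / B. *)
pose t := `|F| / 2 / N.+1%:R; have t0 : 0 < t by rewrite divr_gt0.
have tB : 0 < t ^+ 2 / B by rewrite divr_gt0// exprn_gt0.
move: hcv => /cvgrPdist_lt/(_ _ tB) hcv.
have [n _ /(_ n (leqnn n)) [H1 H2]] := filterI cv hcv.
have Fi i : maximal f (Y n) i -> `|cell_moment Q phi f (Y n) i k| <= t.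
  move=> mi; rewrite -ler_sqr ?nnegrE ?normr_ge0 ?(ltW t0)//.
  rewrite real_normK ?num_real// (cell_momentE pb)//.
  set M := cell_mass _ _ _ _ _; set C := cell_centroid _ _ _ _ _.
  have M0 : 0 <= M by exact: (cell_mass_ge0 pb).
  have MB : M <= B by apply: (cell_mass_le pb) => //; exact: HB.
  have di : M * enorm (Y n i - C) ^+ 2 <= n.+1%:R^-1.
    have [_ _ _ /ltW] := HY n; apply: le_trans.
    rewrite /dissipation (bigD1 i) ?(introT (asboolP _))//= lerDl.
    by apply: sumr_ge0 => l _; apply: mulr_ge0; [exact: (cell_mass_ge0 pb)|exact: sqr_ge0].
  have ci : (Y n i - C) ord0 k ^+ 2 <= enorm (Y n i - C) ^+ 2.
    by rewrite -[_ ord0 k ^+ 2]real_normK ?num_real// ler_sqr ?nnegrE ?enorm_ge0 ?coord_le_enorm.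
  apply: (@le_trans _ _ (B * (M * enorm (Y n i - C) ^+ 2))).
    rewrite exprMn (expr2 M) -mulrA; apply: ler_pM => //.
      by apply: mulr_ge0 => //; exact: sqr_ge0.
    exact: ler_wpM2l.
  apply: (@le_trans _ _ (B * n.+1%:R^-1)); first by apply: ler_wpM2l di; exact: ltW.
  move: H2; rewrite sub0r normrN gtr0_norm// => H2.
  by rewrite mulrC -ler_pdivlMr// ltW.
set a := \sum_(i | _) _ in H1.
have aN : `|a| <= `|F| / 2.
  apply: (@le_trans _ _ (\sum_(i < N) t)).
    apply: le_trans (ler_norm_sum _ _ _) _.
    rewrite big_mkcond/=; apply: ler_sum => i _; case: asbool; last exact: ltW.
    have [mi|nmi] := pselect (maximal f (Y n) i).
      by rewrite (introT (asboolP _) mi) mul1r; exact: Fi.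
    by rewrite (introF (asboolP _) nmi) mul0r normr0 ltW.
  have -> : \sum_(i < N) t = t * N%:R by rewrite sumr_const card_ord mulr_natr.
  rewrite /t -mulrA ler_piMr ?(ltW m0)//.
  by rewrite mulrC ler_pdivrMr// mul1r ler_nat.
have := ler_normD (F - a) a; rewrite subrK; move: H1 aN m0.
by set A := `|F - a|; set A' := `|a|; set A'' := `|F|; lra.
Qed.

Lemma eq_cell_centroid Y Y' i : Y i = Y' i -> V Y i = V Y' i ->
  cell_centroid Q phi f Y i = cell_centroid Q phi f Y' i.
Proof. by rewrite /V /cell_centroid /cell_mass => -> ->. Qed.

Lemma centroidal_approximation X : (forall i, Q (X i)) ->
  (forall j k, maximal f X j -> cell_moment Q phi f X j k = 0) ->
  forall e, 0 < e -> exists2 X' : 'I_N -> 'rV[R]_d,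
    centroidal_configuration Q phi f X' & forall i, enorm (X i - X' i) < e.
Proof.
move=> QX F0 e e0.
have [D [K [D0 K0 QD _ _]]] := uniform_bounds pb.
have [top Htop] := choice (fun i => let: ex_intro2 j b m := exists_maximal nf X i in
  ex_intro (fun j => below f X i j /\ maximal f X j) j (conj b m)).
(* This gives 0 < lam < 1 and lam D < e, where D bounds the distances in Q. *)
pose lam := Num.min 1 (e / (D + 1)) / 2.
have D1 : 0 < D + 1 by rewrite ltr_wpDl// ltW.
have mn : 0 < Num.min 1 (e / (D + 1)) by rewrite lt_min ltr01 divr_gt0.
have lam0 : 0 < lam by rewrite /lam divr_gt0.
have lam1 : lam < 1.
  by have : Num.min 1 (e / (D + 1)) <= 1 by [rewrite ge_min lexx]; rewrite /lam; lra.
have lame : lam * D < e.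
  have : Num.min 1 (e / (D + 1)) <= e / (D + 1) by rewrite ge_min lexx orbT.
  rewrite ler_pdivlMr// => H; apply: lt_le_trans H; rewrite /lam; nra.
pose X' i := if `[< maximal f X i >] then X i else X i + lam *: (X (top i) - X i).
have X'max i : maximal f X i -> X' i = X i by move=> mi; rewrite /X' (introT (asboolP _) mi).
have X'nmax i : ~ maximal f X i -> X' i = X i + lam *: (X (top i) - X i).
  by move=> mi; rewrite /X' (introF (asboolP _) mi).
have QX' i : Q (X' i).
  rewrite /X'; case: asbool => //; apply: polytope_convex => //.
    exact: problem_domain pb.
  by rewrite !ltW.
(* The shift r is positive, as r = 0 would make i equivalent to its maximal [top i]. After the move
   the distance to [top i] is strictly less than r, even if the two positions coincided before, so i
   is strictly dominated at every point. *)
have lt_top i q : ~ maximal f X i ->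
    f i (enorm (X' i - q)) < f (top i) (enorm (X (top i) - q)).
  move=> nmi; have [[r dr fr] mt] := Htop i.
  have r0 : 0 < r.
    rewrite lt_neqAle (le_trans (enorm_ge0 _) dr) andbT; apply/eqP => rE; apply: nmi.
    have bti : below f X (top i) i.
      exists 0; first by rewrite enormB rE.
      by move=> x x0; rewrite addr0 fr// -rE addr0.
    by move=> j bij; exact: below_trans (mt j (below_trans bti bij)) bti.
  rewrite fr ?enorm_ge0//; apply: (node_decreasing nf); first exact: enorm_ge0.
  apply: le_lt_trans (enorm_triangle _ (X' i) _) _; rewrite addrC ltrD2l.
  have -> : X (top i) - X' i = (1 - lam) *: (X (top i) - X i).
    by rewrite X'nmax// opprD addrA scalerBl scale1r.
  rewrite enormZ gtr0_norm ?subr_gt0// enormB.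
  by have := enorm_ge0 (X i - X (top i)) => ?; nra.
have le_top i q : f i (enorm (X i - q)) <= f (top i) (enorm (X (top i) - q)).
  by have [b _] := Htop i; exact: (below_le nf).
have cellE j : maximal f X j -> V X' j = V X j.
  move=> mj; apply/seteqP; split => q [Qq H]; split => // i ij.
    apply: le_trans (le_top i q) _; have [_ mt] := Htop i.
    have [->|tj] := eqVneq (top i) j; first by [].
    by have := H _ tj; rewrite !X'max.
  rewrite (X'max j mj); have [mi|nmi] := pselect (maximal f X i).
    by rewrite X'max//; exact: H.
  apply: (le_trans (ltW (lt_top i q nmi))).
  by have [->|tj] := eqVneq (top i) j; [|exact: H].
have cell0 i : ~ maximal f X i -> V X' i = set0.
  move=> nmi; apply/seteqP; split => // q /(cell_le (top i)).
  have [_ mt] := Htop i; rewrite (X'max _ mt) leNgt.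
  by rewrite (lt_top i q nmi).
exists X'; last first.
  move=> i; rewrite /X'; case: asbool; first by rewrite subrr enorm0.
  rewrite opprD addNKr enormN enormZ gtr0_norm//.
  apply: le_lt_trans lame; apply: ler_wpM2l; first exact: ltW.
  exact: QD.
split => // i; have [mi|nmi] := pselect (maximal f X i); last first.
  have M0 : cell_mass Q phi f X' i = 0.
    by have := cell0 i nmi; rewrite /V /cell_mass => ->; exact: Rintegral_set0.
  by rewrite /cell_centroid M0 eqxx.
have -> : cell_centroid Q phi f X' i = cell_centroid Q phi f X i.
  exact: eq_cell_centroid (X'max i mi) (cellE i mi).
rewrite X'max//; apply/eqP; rewrite -subr_eq0; apply/eqP/rowP => k.
have := F0 i k mi; rewrite (cell_momentE pb)// => /eqP; rewrite mulf_eq0 => /orP[/eqP M0|/eqP ->].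
  by rewrite /cell_centroid M0 eqxx subrr.
by rewrite mxE.
Qed.

End limit_configurations.

(** * Trajectories of the control law *)

Section control_law.
Context {R : realType} {d N : nat} (Q : set 'rV[R]_d) (phi : 'rV[R]_d -> R).
Context (f E : 'I_N -> R -> R).
Hypothesis pb : sensing_problem Q phi f E.
Variables (k0 : 'I_d) (i0 : 'I_N) (kp : R) (P : R -> 'I_N -> 'rV[R]_d).
Hypothesis kp0 : 0 < kp.
Hypothesis PQ : forall t, 0 <= t -> forall i, Q (P t i).
Hypothesis P0 : forall i j, i != j -> P 0 i != P 0 j.
Hypothesis dynP : forall t, 0 <= t -> forall i,
  is_time_derivative (fun s => P s i) t (- kp *: (P t i - cell_centroid Q phi f (P t) i)).
Implicit Types (i j l : 'I_N) (r s t x : R).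

Let C t := cell_centroid Q phi f (P t).
Let hn (n : nat) : R := n.+1%:R^-1.

Let hn0 n : 0 < hn n. Proof. by rewrite invr_gt0 ltr0n. Qed.
Let hn_cvg : hn n @[n --> \oo] --> 0. Proof. exact: cvg_harmonic. Qed.

Lemma seq_dini (g : R -> R) t c v : (g (t + hn n) - g t) / hn n @[n --> \oo] --> v ->
  c < v -> forall e, 0 < e -> exists2 h, 0 < h < e & g t + c * h <= g (t + h).
Proof.
move=> gv cv e e0.
have [n _ /(_ n (leqnn n)) [H1 H2]] := filterI (cvgr_gt _ gv _ cv) (cvgr_lt _ hn_cvg _ e0).
exists (hn n); first by rewrite hn0.
by move: H1; rewrite ltr_pdivlMr// => H1; rewrite addrC -lerBrDr ltW.
Qed.

Lemma coordinate_quotient t i k : 0 <= t ->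
  h^-1 * (P (t + h) i ord0 k - P t i ord0 k)
    @[h --> within [set h | 0 <= t + h] (0:R)^'] --> - kp * (P t i - C t i) ord0 k.
Proof.
move=> t0; have := @dynP t t0 i; rewrite /is_time_derivative -/(C t) => H.
have cc : continuous (fun M : 'rV[R]_d => M ord0 k) by exact: coord_continuous.
have -> : - kp * (P t i - C t i) ord0 k = (- kp *: (P t i - C t i)) ord0 k.
  by rewrite [RHS]mxE.
apply: cvg_trans (cvg_comp _ _ H (cc _)); apply: near_eq_cvg.
by apply: nearW => h /=; rewrite !mxE.
Qed.

Lemma right_quotient t i k : 0 <= t ->
  (P (t + hn n) i - P t i) ord0 k / hn n @[n --> \oo] --> (- kp *: (P t i - C t i)) ord0 k.
Proof.
move=> t0; rewrite mxE.
have hw : hn n @[n --> \oo] --> within [set h | 0 <= t + h] (0:R)^'.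
  move=> U; rewrite /within /dnbhs /= => /(hn_cvg) [m _ Hm].
  exists m => // n mn; apply: (Hm n mn); first by rewrite gt_eqF.
  by rewrite addr_ge0// ltW.
have := cvg_comp _ _ hw (@coordinate_quotient t i k t0).
apply: cvg_trans; apply: near_eq_cvg; apply: nearW => n /=.
by rewrite !mxE mulrC.
Qed.

Lemma local_lipschitz t i k : 0 <= t -> exists B D, 0 < D /\
  forall s, 0 <= s -> `|s - t| < D -> `|P s i ord0 k - P t i ord0 k| <= B * `|s - t|.
Proof.
move=> t0; set v := - kp * (P t i - C t i) ord0 k.
have := @coordinate_quotient t i k t0; rewrite -/v => /cvgrPdist_lt/(_ _ ltr01).
rewrite /within/= /dnbhs /within/= => /nbhs_ballP[D /= D0 HD].
exists (`|v| + 1), D; split => // s s0 st.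
have [->|nst] := eqVneq s t; first by rewrite !subrr normr0 mulr0.
have := HD (s - t); rewrite /ball/= sub0r normrN => /(_ st).
rewrite subr_eq0 nst addrC subrK => /(_ isT s0).
set w := P s i ord0 k - P t i ord0 k => H.
have st0 : s - t != 0 by rewrite subr_eq0.
have -> : w = (s - t)^-1 * w * (s - t) by rewrite mulrAC mulVf// mul1r.
rewrite normrM ler_wpM2r//.
have := ler_normB v (v - (s - t)^-1 * w); rewrite subKr.
by move=> /le_trans; apply; rewrite lerD2l ltW.
Qed.

(** Freezing the trajectory at negative times makes it continuous on the whole line, as
    [dini_growth] requires. *)
Let Pt t := P (Num.max 0 t).

Let max0 t : 0 <= Num.max 0 t. Proof. by rewrite le_max lexx. Qed.
Let max0E t : 0 <= t -> Num.max 0 t = t. Proof. by move=> t0; apply/max_idPr. Qed.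

Lemma max0_dist s t : `|Num.max 0 s - Num.max 0 t| <= `|s - t|.
Proof.
have [s0|s0] := leP 0 s; have [t0|t0] := leP 0 t.
- by [].
- by rewrite subr0 !ger0_norm ?subr_ge0 ?(le_trans (ltW t0))//; lra.
- by rewrite sub0r normrN distrC !ger0_norm ?subr_ge0 ?(le_trans (ltW s0))//; lra.
- by rewrite subrr normr0.
Qed.

Lemma continuous_trajectory i k : continuous (fun t => Pt t i ord0 k).
Proof.
move=> t; apply/cvgrPdist_lt => e e0.
have [B [D [D0 H]]] := local_lipschitz i k (max0 t).
pose D' := Num.min D (e / (`|B| + 1)).
have B1 : 0 < `|B| + 1 by rewrite ltr_wpDl.
have D'0 : 0 < D' by rewrite lt_min D0 divr_gt0.
apply/nbhs_ballP; exists D' => //= s; rewrite /ball/= distrC /D' lt_min => /andP[sD se].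
have st := max0_dist s t.
rewrite distrC; apply: le_lt_trans (H _ (max0 s) (le_lt_trans st sD)) _.
apply: (@le_lt_trans _ _ (`|B| * `|s - t|)).
  apply: (@le_trans _ _ (`|B| * `|Num.max 0 s - Num.max 0 t|)).
    by apply: ler_wpM2r => //; exact: ler_norm.
  exact: ler_wpM2l.
move: se; rewrite ltr_pdivlMr// => se; apply: le_lt_trans se.
by rewrite mulrC ler_wpM2l// lerDl.
Qed.

Lemma right_quotient_ext t i k : 0 <= t ->
  (Pt (t + hn n) i ord0 k - Pt t i ord0 k) / hn n @[n --> \oo] -->
    (- kp *: (P t i - C t i)) ord0 k.
Proof.
move=> t0; have := @right_quotient t i k t0; apply: cvg_trans; apply: near_eq_cvg.
by apply: nearW => n /=; rewrite /Pt !max0E ?addr_ge0 ?(ltW (hn0 n))// !mxE.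
Qed.

(** Each coordinate of the velocity is less than U in absolute value, because the centroid is within
    D of the sensor coordinatewise. Growth estimates for the coordinate and its opposite integrate
    this bound. *)
Lemma trajectory_lipschitz : exists2 L, 0 < L & forall i s t, 0 <= s -> s <= t ->
  enorm (P t i - P s i) <= L * (t - s).
Proof.
have [D [K [D0 K0 QD _ _]]] := uniform_bounds pb.
pose U := kp * D + 1; have U0 : 0 < U by rewrite ltr_wpDl// mulr_ge0// ltW.
have ub t i k : 0 <= t -> `|(- kp *: (P t i - C t i)) ord0 k| < U.
  move=> t0; rewrite mxE normrM normrN (gtr0_norm kp0) /U.
  apply: (@le_lt_trans _ _ (kp * D)); last by rewrite ltrDl.
  apply: ler_wpM2l; first exact: ltW.
  by apply: (centroid_displacement_le pb) => [||q Qq]; [exact: PQ|exact: ltW|apply: QD => //; exact: PQ].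
have lip i k s t : 0 <= s -> s <= t -> `|Pt t i ord0 k - Pt s i ord0 k| <= U * (t - s).
  move=> s0 st; rewrite ler_norml; apply/andP; split.
    rewrite lerBrDl -mulNr; apply: (@dini_growth _ (fun t => Pt t i ord0 k)) => //.
      exact: continuous_trajectory.
    move=> x /andP[sx _] _; have x0 : 0 <= x by exact: le_trans sx.
    apply: (@seq_dini (fun t => Pt t i ord0 k) x _ _ (@right_quotient_ext x i k x0)).
    by have := ub x i k x0; rewrite ltr_norml => /andP[].
  have := @dini_growth _ (fun t => - Pt t i ord0 k) s t (- U) _ st.
  rewrite mulNr -opprD lerN2 -lerBlDl; apply.
    by move=> x; apply: continuousN; exact: continuous_trajectory.
  move=> x /andP[sx _] _; have x0 : 0 <= x by exact: le_trans sx.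
  apply: (@seq_dini (fun t => - Pt t i ord0 k) x _ (- (- kp *: (P x i - C x i)) ord0 k)).
    rewrite (_ : (fun n => _) = (fun n => - ((Pt (x + hn n) i ord0 k - Pt x i ord0 k) / hn n))).
      by apply: cvgN; exact: right_quotient_ext.
    by apply/funext => n; ring.
  by rewrite ltrN2; have := ub x i k x0; rewrite ltr_norml => /andP[].
exists (d%:R * U); first by rewrite mulr_gt0// ltr0n; case: d k0 => // -[].
move=> i s t s0 st; apply: le_trans (enorm_le_sum _) _.
apply: (@le_trans _ _ (\sum_(k < d) U * (t - s))).
  apply: ler_sum => k _; have := lip i k s t s0 st.
  by rewrite /Pt !max0E ?(le_trans s0 st)// !mxE.
by rewrite sumr_const card_ord -[leLHS]mulr_natl mulrA.
Qed.

Lemma no_collision t : 0 <= t -> unmerged f (P t).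
Proof.
move=> t0 i j ij; suff : (forall x, 0 <= x -> f i x = f j x) -> P t i <> P t j.
  by move=> H Pij fij; exact: H fij Pij.
move=> fij.
pose dl k t := Pt t i ord0 k - Pt t j ord0 k.
pose w t := \sum_k dl k t ^+ 2.
have wE t1 : 0 <= t1 -> w t1 = enorm (P t1 i - P t1 j) ^+ 2.
  by move=> t10; rewrite enorm_sqr; apply: eq_bigr => k _; rewrite /dl /Pt max0E// !mxE.
have cdl k : continuous (dl k).
  by move=> s; apply: continuousB; exact: continuous_trajectory.
have cw : continuous w.
  move=> s; apply: cvg_sumr => k; rewrite expr2.
  by apply: cvgM; exact: cdl.
(* As the centroids stay on their sides of the bisector, [w' >= - 2 kp w], so that [g]
   is nondecreasing. *)
pose g s := expR (2 * kp * s) * w s.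
have cg : continuous g.
  move=> s; apply: cvgM; last exact: cw.
  apply: continuous_cvg; first exact: continuous_expR.
  by apply: cvgMr; exact: cvg_id.
have w0 : 0 < w 0.
  rewrite wE// exprn_gt0// lt_neqAle enorm_ge0 andbT eq_sym.
  apply/eqP => /enorm_eq0/eqP; rewrite subr_eq0; exact/negP/P0.
pose vw s := \sum_k 2 * dl k s * ((- kp *: (P s i - C s i)) ord0 k - (- kp *: (P s j - C s j)) ord0 k).
have shn s : s + hn n @[n --> \oo] --> s.
  by rewrite -[X in _ --> X]addr0; apply: cvgD; [exact: cvg_cst|exact: hn_cvg].
have qw s : 0 <= s -> (w (s + hn n) - w s) / hn n @[n --> \oo] --> vw s.
  move=> s0.
  have -> : (fun n => (w (s + hn n) - w s) / hn n) = (fun n => \sum_k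
     (dl k (s + hn n) + dl k s) * ((Pt (s + hn n) i ord0 k - Pt s i ord0 k) / hn n
       - (Pt (s + hn n) j ord0 k - Pt s j ord0 k) / hn n)).
    apply/funext => n; rewrite /w -sumrB mulr_suml; apply: eq_bigr => k _.
    by rewrite /dl; ring.
  apply: cvg_sumr => k; apply: cvgM; last first.
    by apply: cvgB; exact: right_quotient_ext.
  rewrite mulr_natl mulr2n; apply: cvgD; last exact: cvg_cst.
  apply: (@cvg_comp _ _ _ (fun n => s + hn n) (dl k)); last exact: cdl.
  exact: shn.
have qg s : 0 <= s -> (g (s + hn n) - g s) / hn n @[n --> \oo] -->
    expR (2 * kp * s) * vw s + w s * (expR (2 * kp * s) * (2 * kp)).
  move=> s0.
  have qe : (expR (2 * kp * (s + hn n)) - expR (2 * kp * s)) / hn n @[n --> \oo] -->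
      expR (2 * kp * s) * (2 * kp).
    apply: (@cvg_comp_quotient _ expR (2 * kp * s) _ _ (fun n => 2 * kp * (s + hn n))) => //.
      by move=> n; rewrite gt_eqF.
    rewrite (_ : (fun n => _) = cst (2 * kp)); first exact: cvg_cst.
    by apply/funext => n; rewrite -mulrBr addrAC subrr add0r mulfK// gt_eqF.
  have -> : (fun n => (g (s + hn n) - g s) / hn n) = (fun n =>
     expR (2 * kp * (s + hn n)) * ((w (s + hn n) - w s) / hn n)
     + w s * ((expR (2 * kp * (s + hn n)) - expR (2 * kp * s)) / hn n)).
    by apply/funext => n; rewrite /g; ring.
  apply: cvgD; last by apply: cvgM => //; exact: cvg_cst.
  apply: cvgM; last exact: qw.
  apply: continuous_cvg; first exact: continuous_expR.
  by apply: cvgMr.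
have ge0 s : 0 <= s -> 0 <= expR (2 * kp * s) * vw s + w s * (expR (2 * kp * s) * (2 * kp)).
  move=> s0.
  have -> : expR (2 * kp * s) * vw s + w s * (expR (2 * kp * s) * (2 * kp)) =
     expR (2 * kp * s) * (vw s + 2 * kp * w s) by ring.
  apply: mulr_ge0; first exact: expR_ge0.
  have fji x : 0 <= x -> f j x = f i x by move=> x0; rewrite fij.
  have := centroid_bisector pb (PQ s0 i) fij.
  have := centroid_bisector pb (PQ s0 j) fji.
  rewrite (enormB (P s j)) -wE// -/(C s i) -/(C s j).
  (* The sum of the two bisector estimates is at most w, whence vw >= - 2 kp w. *)
  have -> : vw s = - (2 * kp) * (\sum_k (P s i - P s j) ord0 k * (P s i - C s i) ord0 k +
      \sum_k (P s j - P s i) ord0 k * (P s j - C s j) ord0 k).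
    rewrite -big_split/= mulr_sumr; apply: eq_bigr => k _.
    rewrite /dl /Pt (max0E s0); move: (C s i) (C s j) (P s i) (P s j) => ci cj pi pj.
    rewrite !mxE; move: (ci _ _) (cj _ _) (pi _ _) (pj _ _) => a b x y; ring.
  move=> HB HA; rewrite mulNr addrC -mulrBr; apply: mulr_ge0.
    by apply: mulr_ge0 => //; exact: ltW.
  by rewrite subr_ge0; apply: le_trans (lerD HA HB) _; rewrite -splitr.
have gt0 : 0 < g t.
  (* The growth argument needs a strict inequality, so [g] may decrease at rate [eta]; up to time t
     this costs at most half of its initial value. *)
  pose eta := w 0 / 2 / (t + 1).
  have t1 : 0 < t + 1 by rewrite ltr_wpDl.
  have eta0 : 0 < eta by rewrite !divr_gt0.
  have := @dini_growth _ g 0 t (- eta) cg t0 => H.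
  have : g 0 + - eta * (t - 0) <= g t.
    apply: H => s /andP[s0 _] _.
    by apply: (seq_dini (qg s s0)); apply: lt_le_trans (ge0 s s0); rewrite oppr_lt0.
  rewrite /g mulr0 expR0 mul1r subr0; apply: lt_le_trans.
  have -> : w 0 + - eta * t = w 0 - w 0 / 2 * (t / (t + 1)) by rewrite /eta; ring.
  have : t / (t + 1) <= 1 by rewrite ler_pdivrMr// mul1r lerDl.
  have : 0 <= t / (t + 1) by rewrite divr_ge0// ltW.
  by set y := t / (t + 1); nra.
move=> Pij; move: gt0; rewrite /g wE// Pij subrr enorm0 expr0n/= mulr0 ltxx.
by [].
Qed.

Let cov t := coverage Q phi f i0 (Pt t).

Lemma continuous_coverage : continuous cov.
Proof.
have [K K0 HK] := coverage_lipschitz pb i0; have [L L0 HL] := trajectory_lipschitz.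
have PtL s t i : enorm (Pt s i - Pt t i) <= L * `|s - t|.
  apply: (@le_trans _ _ (L * `|Num.max 0 s - Num.max 0 t|)); last first.
    by apply: ler_wpM2l; [exact: ltW|exact: max0_dist].
  have [st|/ltW st] := leP (Num.max 0 s) (Num.max 0 t).
    by rewrite distrC enormB ger0_norm ?subr_ge0//; exact: HL.
  by rewrite ger0_norm ?subr_ge0//; exact: HL.
move=> t; apply/cvgrPdist_lt => e e0.
pose M := K * (N%:R * L); have M0 : 0 <= M by rewrite !mulr_ge0// ltW.
have M1 : 0 < M + 1 by rewrite ltr_wpDl.
apply/nbhs_ballP; exists (e / (M + 1)); first exact: divr_gt0.
move=> s; rewrite /ball/= ltr_pdivlMr// => st.
apply: le_lt_trans st; apply: le_trans (HK _ _ _ _) _; [by move=> i; exact: PQ|by move=> i; exact: PQ|].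
apply: (@le_trans _ _ (K * \sum_(i < N) L * `|t - s|)).
  by apply: ler_wpM2l => //; apply: ler_sum => i _; exact: PtL.
rewrite sumr_const card_ord -mulr_natl mulrA mulrA (mulrC `|t - s|) ler_wpM2r//.
by rewrite -mulrA lerDl.
Qed.

Lemma dissipation_ge0 t : 0 <= dissipation Q phi f (P t).
Proof.
by apply: sumr_ge0 => i _; apply: mulr_ge0; [exact: (cell_mass_ge0 pb)|exact: sqr_ge0].
Qed.

Lemma coverage_gain a b c : 0 <= a -> a <= b ->
  (forall t, a <= t < b -> c < kp * dissipation Q phi f (P t)) ->
  cov a + c * (b - a) <= cov b.
Proof.
move=> a0 ab H; apply: dini_growth => //; first exact: continuous_coverage.
move=> t /[dup] /H ct /andP[at_ _] _ e e0; have t0 : 0 <= t by exact: le_trans at_.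
have QZ n i : Q (P (t + hn n) i) by apply: PQ; rewrite addr_ge0// ltW.
have gr := coverage_growth pb k0 i0 (PQ t0) (no_collision t0) QZ hn0 hn_cvg
  (fun i k => @right_quotient t i k t0) (fun i => erefl) ct.
have [n _ /(_ n (leqnn n)) [H1 H2]] := filterI gr (cvgr_lt _ hn_cvg _ e0).
exists (hn n); first by rewrite hn0.
by rewrite /cov /Pt !max0E// addr_ge0// ltW.
Qed.

Lemma coverage_monotone a b : 0 <= a -> a <= b -> cov a <= cov b.
Proof.
move=> a0 ab; apply/ler_addgt0Pr => e e0; rewrite -lerBlDr.
have ba : 0 < b - a + 1 by rewrite ltr_wpDl// subr_ge0.
(* The dissipation may vanish, so a small negative slope, costing at most e in total, makes the
   inequality strict. *)
apply: (@le_trans _ _ (cov a + - (e / (b - a + 1)) * (b - a))).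
  rewrite lerD2l mulNr lerN2 mulrAC -mulrA ler_piMr ?(ltW e0)//.
  by rewrite ler_pdivrMr// mul1r lerDl.
apply: coverage_gain => // t _; apply: (@lt_le_trans _ _ 0).
  by rewrite oppr_lt0 divr_gt0.
by rewrite mulr_ge0 ?dissipation_ge0// ltW.
Qed.

(** If the moment were nonzero, each visit close to X would raise the coverage by a fixed amount
    that is never lost afterwards; repeated visits contradict boundedness. *)
Lemma limit_moment0 X j k : (forall i, Q (X i)) ->
  (forall D T, 0 < D -> exists t, [/\ T <= t, 0 <= t & forall i, enorm (P t i - X i) < D]) ->
  maximal f X j -> cell_moment Q phi f X j k = 0.
Proof.
move=> QX limX mj; apply/eqP; apply: contrapT => /negP F0.
have [D [c [D0 c0 Hdiss]]] := dissipation_bounded_below pb k0 i0 QX mj F0.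
have [L L0 HL] := trajectory_lipschitz.
(* A trajectory within D / 2 of X stays within D for this long. *)
pose tau := D / 2 / L; have tau0 : 0 < tau by rewrite !divr_gt0.
pose rho := kp * (c / 2); have rho0 : 0 < rho by rewrite mulr_gt0// divr_gt0.
have step t : 0 <= t -> exists2 s, 0 <= s & cov t + rho * tau <= cov s.
  move=> t0; have D20 : 0 < D / 2 by rewrite divr_gt0.
  have [s [ts s0 sX]] := limX _ t D20.
  exists (s + tau); first by rewrite addr_ge0// ltW.
  apply: (@le_trans _ _ (cov s + rho * tau)); first by rewrite lerD2r; exact: coverage_monotone.
  have := @coverage_gain s (s + tau) rho s0; rewrite addrAC subrr add0r; apply.
    by rewrite lerDl ltW.
  move=> x /andP[sx xs]; have x0 : 0 <= x by exact: le_trans sx.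
  rewrite /rho ltr_pM2l//; apply: (@lt_le_trans _ _ c); first by lra.
  apply: Hdiss; [exact: PQ|exact: no_collision|move=> i].
  apply: le_lt_trans (enorm_triangle _ (P s i) _) _.
  have : enorm (P x i - P s i) <= D / 2.
    apply: le_trans (HL i s x s0 sx) _.
    have : L * (x - s) <= L * tau by apply: ler_wpM2l; [exact: ltW|lra].
    by rewrite /tau mulrCA divff ?gt_eqF// mulr1.
  by have := sX i; lra.
have iter (m : nat) : exists2 t, 0 <= t & cov 0 + rho * tau * m%:R <= cov t.
  elim: m => [|m [t t0 Ht]]; first by exists 0; rewrite // mulr0 addr0.
  have [s s0 Hs] := step t t0; exists s => //; apply: le_trans Hs.
  by rewrite -natr1 mulrDr mulr1 addrA lerD2r.
have [B HB] := coverage_bounded pb i0.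
have covB t : `|cov t| <= B by apply: HB => i; exact: PQ.
have rt : 0 < rho * tau by rewrite mulr_gt0.
(* After this many visits the gain exceeds 2 B, while the coverage stays in [- B, B]. *)
have [t t0] := iter (Num.truncn ((B + B) / (rho * tau))).+1.
have := truncnS_gt ((B + B) / (rho * tau)).
rewrite ltr_pdivrMr// mulrC => H1 H2.
have := covB 0; have := covB t; rewrite !ler_norml => /andP[_ H3] /andP[H4 _].
by move: (le_trans H2 H3) H1; set z := rho * tau * _; lra.
Qed.

(** The times far from all centroidal configurations, if unbounded, would accumulate at some X; but
    X has a centroidal configuration within e / 2, and the trajectory is within e / 2 of X at one of
    those times. *)
Lemma convergence e : 0 < e -> \forall t \near +oo,
  exists2 X : 'I_N -> 'rV[R]_d, centroidal_configuration Q phi f X &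
    forall i, enorm (P t i - X i) < e.
Proof.
move=> e0; pose good t := exists2 X : 'I_N -> 'rV[R]_d,
  centroidal_configuration Q phi f X & forall i, enorm (P t i - X i) < e.
apply: contrapT => ngood.
have bad T : exists2 t, T <= t & 0 <= t /\ ~ good t.
  apply: contrapT => H; apply: ngood; exists (Num.max 0 T); split; first exact: num_real.
  move=> t; rewrite gt_max => /andP[t0 Tt]; apply: contrapT => nt; apply: H.
  by exists t; rewrite ?ltW//; split => //; exact: ltW.
have cQ := polytope_compact (problem_domain pb).
have [X QX limX] := trajectory_limit_point cQ PQ bad.
have F0 j k : maximal f X j -> cell_moment Q phi f X j k = 0.
  apply: limit_moment0 => // D T D0.
  by have [t [Tt [t0 _] tX]] := limX D T D0; exists t.
have e20 : 0 < e / 2 by rewrite divr_gt0.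
have [X' cX' XX'] := centroidal_approximation pb QX F0 e20.
have [t [_ [_ nt] tX]] := limX (e / 2) 0 e20.
apply: nt; exists X' => // i.
apply: le_lt_trans (enorm_triangle _ (X i) _) _.
by have := tX i; have := XX' i; lra.
Qed.

End control_law.

(** * Independence of the values of node functions at negative arguments *)

Section replace_node_functions.
Context {R : realType} {d N : nat} (Q : set 'rV[R]_d) (phi : 'rV[R]_d -> R).
Context (f g : 'I_N -> R -> R).
Hypothesis gf : forall i r, 0 <= r -> g i r = f i r.

(** Even the difference quotients at 0 evaluate the node function at square roots only, hence on the
    half-line. *)
Lemma eq_perceived_density i : perceived_density phi (g i) = perceived_density phi (f i) :> ('rV[R]_d -> 'rV[R]_d -> R).
Proof.
apply/funext => p; apply/funext => q; rewrite /perceived_density.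
rewrite (_ : (fun s => g i _) = (fun s => f i (Num.sqrt s)))//.
by apply/funext => s; rewrite gf// sqrtr_ge0.
Qed.

Lemma eq_gen_voronoi_cell Y i : gen_voronoi_cell Q g Y i = gen_voronoi_cell Q f Y i.
Proof.
apply/seteqP; split => q [Qq H]; split => // j ji; have := H j ji;
  by rewrite !gf ?enorm_ge0.
Qed.

Lemma eq_centroid_nodes Y i : cell_centroid Q phi g Y i = cell_centroid Q phi f Y i.
Proof. by rewrite /cell_centroid /cell_mass eq_gen_voronoi_cell eq_perceived_density. Qed.

End replace_node_functions.

Theorem theorem1 (R : realType) (d N : nat) (hd : (0 < d)%N) (hN : (0 < N)%N)
  (Q : set 'rV[R]_d) (hQ : convex_polytope Q)
  (phi : 'rV[R]_d -> R) (hphi : forall q, Q q -> 0 <= phi q <= 1)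
  (mphi : measurable_fun Q phi)
  (f : 'I_N -> R -> R)
  (fdec : forall i, strictly_decreasing_on_nneg (f i))
  (fana : forall i, analytic_on_nneg (f i))
  (fint : forall i p, Q p ->
    (lebesgue_rV R d).-integrable Q (EFin \o perceived_density phi (f i) p))
  (kprop : R) (hk : 0 < kprop)
  (P : R -> 'I_N -> 'rV[R]_d)
  (PQ : forall t, 0 <= t -> forall i, Q (P t i))
  (P0 : forall i j, i != j -> P 0 i != P 0 j)
  (dynP : forall t, 0 <= t -> forall i,
    is_time_derivative (fun s => P s i) t
      (- kprop *: (P t i - cell_centroid Q phi f (P t) i))) :
  forall e : R, 0 < e -> \forall t \near +oo,
    exists2 X : 'I_N -> 'rV[R]_d,
      centroidal_configuration Q phi f X &
      forall i, enorm (P t i - X i) < e.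
Proof.
(* The control law for the given node functions is also the one for their extensions, since cells
   and centroids only involve nonnegative distances. *)
have [g Hg] := choice (fun i => analytic_C1_extension (fana i)).
have [E HE] := choice Hg.
have gf i r : 0 <= r -> g i r = f i r by have [+ _ _ _] := HE i; exact.
have dg i (r : R) : is_derive r 1 (g i) (E i r) by have [_ + _ _] := HE i; exact.
have nf : node_family g E.
  split => //.
  - by move=> i; have [] := HE i.
  - by move=> i r s r0 rs; rewrite !gf// ?(ltW (le_lt_trans r0 rs))//; exact: fdec.
  - by move=> i; exact: decreasing_derive_zeros (fana i) (fdec i) (gf i) (dg i).
  - move=> i j c c0; have [H|H] := shifted_coincidence (fana i) (fana j) c0; [left|right].
      by move=> x x0; rewrite !gf ?addr_ge0//; exact: H.
    apply: sub_countable H; apply: subset_card_le => x [x0 H]; split => //.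
    by rewrite -!gf ?addr_ge0.
  - by move=> i; have [] := HE i.
have pb : sensing_problem Q phi g E.
  by split => // i p Qp; rewrite (eq_perceived_density _ gf); exact: fint.
move=> e e0.
have := @convergence R d N Q phi g E pb (Ordinal hd) (Ordinal hN) kprop P hk PQ P0.
move=> /(_ _ e e0); set G := (X in (X -> _) -> _) => H.
have /H : G.
  by move=> t t0 i; rewrite (eq_centroid_nodes Q phi gf); exact: dynP.
apply: filterS => t [X [QX cX] tX]; exists X; last exact: tX.
split; first exact: QX.
by move=> i; rewrite -(eq_centroid_nodes Q phi gf); exact: cX.
Qed.
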